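(* There is a universal constant $C>0$ such that the following holds. Let $0<p\le\frac12$ and let $\nu$ be a distribution on $\mathbb{S}^{d-1}$. For $z\in\mathbb{S}^{d-1}$, let $X(z)=\Pr_{x\sim\nu}[\langle x,z\rangle>\tau(p)]$, and for any $\kappa>0$ let $$u(t)=\left(\sqrt{\tfrac{8}{d-1}\log\|\nu\|_\infty}+\sqrt{\tfrac{8\kappa}{d-1}}\right)\cdot t .$$ Then for any $t\ge0$, $$\Pr_{z\sim\rho}\left[|X(z)-p|>p\cdot\varepsilon(t)\right]\le 2\exp(-dt^2/4),$$ where $$\varepsilon(t)=C\cdot u(t)\cdot\exp\left(2d\,\tau(p)\,u(t)\right)\cdot\sqrt{d\log\tfrac1p}+\frac{2\exp(-dt^2/4)+\exp(-\kappa)}{p}.$$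
   Context: $\mathbb{S}^{d-1}$ is the unit sphere in $\mathbb{R}^d$ ($d\ge2$) and $\rho$ is the uniform probability measure on it. For a probability distribution $\nu$ on $\mathbb{S}^{d-1}$, $\|\nu\|_\infty=\sup_x\frac{d\nu}{d\rho}(x)$ is the supremum of its relative density with respect to $\rho$. $\tau(p)$ is the threshold with $\Pr_{y\sim\rho}[\langle y,z\rangle\ge\tau(p)]=p$ for any fixed $z\in\mathbb{S}^{d-1}$. $\log$ is the natural logarithm. *)

(* Defs.v *)
From HB Require Import structures.
From mathcomp Require Import all_boot all_order all_algebra.
From mathcomp Require Import all_classical all_reals all_analysis ess_sup_inf.

Set Implicit Arguments.
Unset Strict Implicit.
Unset Printing Implicit Defensive.

Import Order.TTheory GRing.Theory Num.Theory.
Import numFieldNormedType.Exports.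

Local Open Scope classical_set_scope.
Local Open Scope ring_scope.

(* Points of R^d are d-tuples: the library's measurable structure on tuples is
   the product sigma-algebra, which on R^d is the Borel one. *)
Definition dot (R : realType) (d : nat) (x y : d.-tuple R) : R :=
  \sum_(i < d) tnth x i * tnth y i.

Definition sphere (R : realType) (d : nat) : set (d.-tuple R) :=
  [set x | dot x x = 1].
Arguments sphere : clear implicits.

Definition mxact (R : realType) (d : nat) (Q : 'M[R]_d) (x : d.-tuple R) :
    d.-tuple R :=
  [tuple \sum_(j < d) Q i j * tnth x j | i < d].

(* A distribution on the sphere is a Borel probability measure on R^d giving
   mass 1 to the sphere. *)
Definition on_sphere (R : realType) (d : nat)
    (nu : probability (d.-tuple R) R) : Prop :=
  nu (sphere R d) = 1%E.

(* The uniform probability measure on the sphere is the unique Borel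
   probability measure on it that is invariant under the orthogonal group. *)
Definition uniform_sphere (R : realType) (d : nat)
    (rho : probability (d.-tuple R) R) : Prop :=
  on_sphere rho /\
  forall Q : 'M[R]_d, Q *m Q^T = 1%:M ->
  forall A : set (d.-tuple R), measurable A -> rho (mxact Q @^-1` A) = rho A.

(* [tau] is the value of the threshold function at [p]; for 0 < p < 1 and
   2 <= d it exists and is unique. *)
Definition is_threshold (R : realType) (d : nat)
    (rho : probability (d.-tuple R) R) (p tau : R) : Prop :=
  forall z : d.-tuple R, sphere R d z -> rho [set y | tau <= dot y z] = p%:E.

(* The density is only defined rho-almost everywhere, so its supremum is the
   essential one; it is +oo when nu has no density with respect to rho. *)
Definition density_sup (R : realType) (d : nat)
    (nu rho : probability (d.-tuple R) R) : \bar R :=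
  if `[< nu `<< rho >] then
    ess_sup rho (Radon_Nikodym (charge_of_finite_measure nu) rho)
  else +oo%E.

Definition cap_mass (R : realType) (d : nat)
    (nu : probability (d.-tuple R) R) (tau : R) (z : d.-tuple R) : R :=
  fine (nu [set x | tau < dot x z]).

(* [u_dev] and [eps_dev] are extended reals because [density_sup] may be +oo.
   Conventions: [er_map Num.sqrt] and [lne] fix +oo, and 0 * +oo = 0. *)
Definition u_dev (R : realType) (d : nat) (nu rho : probability (d.-tuple R) R)
    (kappa t : R) : \bar R :=
  ((er_map Num.sqrt ((8 / (d%:R - 1))%:E * lne (density_sup nu rho))
    + (Num.sqrt (8 * kappa / (d%:R - 1)))%:E) * t%:E)%E.

Definition eps_dev (R : realType) (d : nat) (nu rho : probability (d.-tuple R) R)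
    (C p tau kappa t : R) : \bar R :=
  (C%:E * u_dev nu rho kappa t * expeR ((2 * d%:R * tau)%:E * u_dev nu rho kappa t)
     * (Num.sqrt (d%:R * ln (1 / p)))%:E
   + ((2 * expR (- (d%:R * t ^+ 2 / 4)) + expR (- kappa)) / p)%:E)%E.

(* Main.v *)
(* Invariance of rho under reflections close to the identity gives a Stein
   inequality (d-1) E[x_0 h(x_0)] >= E[(1 - x_0^2) h'(x_0)] for the first
   coordinate.  Exponentials h yield the Gaussian tail of x_0, while truncated
   exponentials and ramps bound the mass of a thin band on either side of the
   threshold tau by E[x_0 1(x_0 >= tau)] <= p sqrt (2 log(1/p) / (d-1)).

   Averaging over caps is a Markov operator that preserves rho and contracts
   Lipschitz constants; its effect on exponential moments is controlled to second
   order in the radius.  Iterating with radius tending to 0 yields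
   E[exp (f - E f)] <= exp (l^2 / (d-2)) for l-Lipschitz f, hence
   rho(A) rho(B) <= exp (- (d-2) D^2 / 8) for sets at chordal distance D.

   If |z - z'| < D, then <x,z> > tau forces <x,z'> > tau - w unless x lies in the
   cap of height w / D around z - z'; for w = 7u/4 and D = 7t/2 its nu-mass is at
   most exp (-kappa).  So if the points z with X(z) > p + p eps had rho-measure
   above exp (-d t^2 / 4), then by concentration nu[<x,z'> > tau - w] would exceed
   p + p eps - exp (-kappa) for most z', while its mean over z' is at most p plus
   the mass of a band of width w.  Deviations below p are symmetric. *)
Require Import Defs.
From HB Require Import structures.
From mathcomp Require Import all_boot all_order all_algebra.
From mathcomp Require Import all_classical all_reals all_analysis.
From mathcomp Require Import measurable_realfun ess_sup_inf.
From mathcomp Require Import ring lra.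

Set Implicit Arguments.
Unset Strict Implicit.
Unset Printing Implicit Defensive.
Import Order.TTheory GRing.Theory Num.Theory.
Import numFieldNormedType.Exports.

Local Open Scope classical_set_scope.
Local Open Scope ring_scope.

(** * Bounded measurable functions and expectations *)

(** [rho] is known only through its invariance: neither a density nor a rotation flow is at hand.
    Reflections replace infinitesimal rotations, Stein's inequality replaces the density of [x_0],
    and cap averages replace a heat semigroup. The cap radius drops out of the concentration bound:
    with [n = d - 2] and [m = d - 1], one step costs [l^2 * v / m] in the exponent and multiplies
    [l^2] by [1 - v * n / m], so the geometric sum is [l^2 / n] whatever the cap variance [v]. In
    dimension 2 there is no contraction, and that case is treated apart.

    The factors 7/4 and 7/2 meet three demands: [w / D = u / (2 t)] turns the factors 8 in [u] into
    the tail [exp (-kappa) / L], where [L] bounds the density; [(d-2) D^2 / 8 >= d t^2 / 2] for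
    [d >= 3] asks for [D >= sqrt 12 * t]; and [w < 2 u] leaves room for [1 / (1 - tau^2)] inside
    [exp (2 d tau u)]. The last needs [tau] away from 1. A violation of the claim forces
    [ln (1/p) <= ln L + kappa] and [2 ln (1/p) <= d t^2], hence [4 ln (1/p) <= d u]; with
    [tau > 1/8] the allowed deviation would then be too large to be exceeded. *)

Notation "\I[ b ]" := ((nat_of_bool b%R)%:R)
  (at level 0, b at level 200, format "\I[ b ]") : ring_scope.

Section bounded_measurable.
Context {R : realType} {dT : measure_display} {T : measurableType dT}.
Variable S : set T.
Implicit Types f g : T -> R.

(** Coordinates and inner products are unbounded on [R^d], hence the bound on [S] alone;
    measurability is global, so that compositions need no restriction. *)
Definition bmf f :=
  measurable_fun setT f /\ exists M, forall x, S x -> `|f x| <= M.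

Lemma bmf_cst (c : R) : bmf (fun=> c).
Proof. by split; [exact: measurable_cst|exists `|c|]. Qed.

Lemma bmfD f g : bmf f -> bmf g -> bmf (fun x => f x + g x).
Proof.
move=> [mf [M fM]] [mg [N gN]]; split; first exact: measurable_funD.
exists (M + N) => x Sx; apply: le_trans (ler_normD _ _) _.
by rewrite lerD ?fM ?gN.
Qed.

Lemma bmfM f g : bmf f -> bmf g -> bmf (fun x => f x * g x).
Proof.
move=> [mf [M fM]] [mg [N gN]]; split; first exact: measurable_funM.
exists (M * N) => x Sx; rewrite normrM.
by rewrite ler_pM ?fM ?gN.
Qed.

Lemma bmfZ c f : bmf f -> bmf (fun x => c * f x).
Proof. by move=> ?; apply: bmfM => //; exact: bmf_cst. Qed.

Lemma bmfN f : bmf f -> bmf (fun x => - f x).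
Proof.
move=> [mf [M fM]]; split; first exact: measurable_funN.
by exists M => x Sx; rewrite normrN fM.
Qed.

Lemma bmfB f g : bmf f -> bmf g -> bmf (fun x => f x - g x).
Proof. by move=> bf bg; apply: bmfD => //; exact: bmfN. Qed.

Lemma bmfX f n : bmf f -> bmf (fun x => f x ^+ n).
Proof.
move=> bf; elim: n => [|n IH].
  by under eq_fun do rewrite expr0; exact: bmf_cst.
by under eq_fun do rewrite exprS; exact: bmfM.
Qed.

Lemma bmf_sum (I : Type) (r : seq I) (F : I -> T -> R) :
  (forall i, bmf (F i)) -> bmf (fun x => \sum_(i <- r) F i x).
Proof.
move=> bF; elim: r => [|i r IH].
  by under eq_fun do rewrite big_nil; exact: bmf_cst.
by under eq_fun do rewrite big_cons; exact: bmfD.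
Qed.

Lemma bmf_norm f : bmf f -> bmf (fun x => `|f x|).
Proof.
move=> [mf [M fM]]; split; first exact: measurableT_comp.
by exists M => x Sx; rewrite normr_id fM.
Qed.

Lemma bmf_expR f : bmf f -> bmf (fun x => expR (f x)).
Proof.
move=> [mf [M fM]]; split; first exact: measurableT_comp.
exists (expR M) => x Sx; rewrite ger0_norm ?expR_ge0// ler_expR.
exact: le_trans (ler_norm _) (fM _ Sx).
Qed.

Lemma bmf_bool (b : T -> bool) :
  measurable_fun setT b -> bmf (fun x => (b x)%:R).
Proof.
move=> mb; split.
  rewrite (_ : (fun x => (b x)%:R) = (fun x => if b x then 1 else 0)).
    exact: measurable_fun_ifT.
  by apply/funext => x; case: (b x).
by exists 1 => x _; case: (b x); rewrite ?normr1 ?normr0.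
Qed.

Lemma bmf_indic (A : set T) : measurable A -> bmf (\1_A).
Proof.
move=> mA; split; first exact: measurable_indic.
exists 1 => x _; rewrite indicE; case: (_ \in _);
  by rewrite ?normr1 ?normr0.
Qed.

End bounded_measurable.

Section expectation_def.
Context {R : realType} {dT : measure_display} {T : measurableType dT}.
(** The indicator makes the value depend on [f] only through its restriction to [S], so identities
    such as [dot x x = 1] may be used under the integral. *)
Definition Ex (P : probability T R) (S : set T) (f : T -> R) : R :=
  \int[P]_x (\1_S x * f x).
End expectation_def.

Section expectation.
Context {R : realType} {dT : measure_display} {T : measurableType dT}.
Variables (P : probability T R) (S : set T).
Hypothesis mS : measurable S.
Implicit Types f g : T -> R.
Local Notation E := (Ex P S).

Lemma integrable_bmf f : bmf S f ->
  P.-integrable setT (EFin \o (fun x => \1_S x * f x)).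
Proof.
move=> [mf [M fM]]; apply: measurable_bounded_integrable => //.
- by rewrite (le_lt_trans (probability_le1 _ _)) ?ltry.
- by apply: measurable_funM => //; exact: measurable_indic.
- exists (Num.max 0 M); split; first by rewrite num_real.
  move=> y My x _ /=; rewrite indicE.
  have [Sx|nSx] := boolP (x \in S).
    rewrite mul1r (le_trans (fM _ (set_mem Sx)))//.
    by apply: le_trans (ltW My); rewrite le_max lexx orbT.
  by rewrite mul0r normr0; apply: le_trans (ltW My); rewrite le_max lexx.
Qed.

Lemma eq_Ex f g : (forall x, S x -> f x = g x) -> E f = E g.
Proof.
move=> fg; apply: eq_Rintegral => x _; rewrite indicE.
by have [/set_mem/fg->|] := boolP (x \in S); rewrite ?mul0r.
Qed.

Lemma ExD f g : bmf S f -> bmf S g -> E (fun x => f x + g x) = E f + E g.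
Proof.
move=> bf bg; rewrite /Ex -RintegralD//; try exact: integrable_bmf.
by apply: eq_Rintegral => x _; rewrite mulrDr.
Qed.

Lemma ExZ c f : bmf S f -> E (fun x => c * f x) = c * E f.
Proof.
move=> bf; rewrite /Ex -RintegralZl//; try exact: integrable_bmf.
by apply: eq_Rintegral => x _; rewrite mulrCA.
Qed.

Lemma ExN f : bmf S f -> E (fun x => - f x) = - E f.
Proof.
move=> bf; rewrite -mulN1r -ExZ//.
by apply: eq_Ex => x _; rewrite mulN1r.
Qed.

Lemma ExB f g : bmf S f -> bmf S g -> E (fun x => f x - g x) = E f - E g.
Proof. by move=> bf bg; rewrite ExD ?ExN//; exact: bmfN. Qed.

Lemma Ex_sum (I : Type) (r : seq I) (F : I -> T -> R) :
  (forall i, bmf S (F i)) ->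
  E (fun x => \sum_(i <- r) F i x) = \sum_(i <- r) E (F i).
Proof.
move=> bF; elim: r => [|i r IH].
  rewrite big_nil -[RHS](mul0r (E (fun=> 0))) -ExZ; last exact: bmf_cst.
  by apply: eq_Ex => x _; rewrite big_nil mul0r.
rewrite big_cons -IH -ExD//; last exact: bmf_sum.
by apply: eq_Ex => x _; rewrite big_cons.
Qed.

Lemma le_Ex f g : bmf S f -> bmf S g -> (forall x, S x -> f x <= g x) ->
  E f <= E g.
Proof.
move=> bf bg fg; apply: le_Rintegral => //; try exact: integrable_bmf.
move=> x _; rewrite indicE; have [Sx|_] := boolP (x \in S); last by rewrite !mul0r.
by rewrite !mul1r fg//; exact: set_mem.
Qed.

Lemma Ex_ge0 f : (forall x, S x -> 0 <= f x) -> 0 <= E f.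
Proof.
move=> f0; apply: Rintegral_ge0 => x _; rewrite indicE.
have [Sx|_] := boolP (x \in S); last by rewrite !mul0r.
by rewrite !mul1r f0//; exact: set_mem.
Qed.

Hypothesis PS : P S = 1%E.

Lemma Ex_indic A : measurable A -> (E (\1_A))%:E = P A.
Proof.
move=> mA.
have PC : P (~` S) = 0%E.
  by have := probability_setC P mS; rewrite PS subee.
have mSC : measurable (~` S) by exact: measurableC.
have PAS : P A = P (A `&` S).
  rewrite [in LHS](_ : A = (A `&` S) `|` (A `&` ~` S)); last first.
    by rewrite -setIUr setUv setIT.
  apply: measureU0; do ?exact: measurableI.
  by apply: (subset_measure0 _ mSC _ PC); [exact: measurableI|exact: subIsetr].
rewrite PAS /Ex /Rintegral.
rewrite (_ : (fun x => (\1_S x * \1_A x)%:E) = (fun x => (\1_(A `&` S) x)%:E)).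
  rewrite integral_indic//; last exact: measurableI.
  by rewrite setIT fineK// fin_num_measure//; exact: measurableI.
by apply/funext => x; rewrite !indicE in_setI andbC -natrM mulnb.
Qed.

Lemma Ex_cst c : E (fun=> c) = c.
Proof.
have h : E (\1_setT) = 1.
  apply: EFin_inj; rewrite Ex_indic//; exact: probability_setT.
rewrite -[RHS]mulr1 -h -ExZ; last exact: bmf_indic.
by apply: eq_Ex => x _; rewrite indicT mulr1.
Qed.

Lemma norm_Ex_le f M : bmf S f -> (forall x, S x -> `|f x| <= M) -> `|E f| <= M.
Proof.
move=> bf fM; rewrite ler_norml; apply/andP; split.
  by rewrite -[- M]Ex_cst; apply: le_Ex => //; [exact: bmf_cst|move=> x /fM; rewrite ler_norml => /andP[]].
by rewrite -[M]Ex_cst; apply: le_Ex => //; [exact: bmf_cst|move=> x /fM; rewrite ler_norml => /andP[]].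
Qed.

End expectation.

Section expectation_fubini.
Context {R : realType} {d1 d2 : measure_display}
  {T1 : measurableType d1} {T2 : measurableType d2}.
Variables (P : probability T1 R) (Q : probability T2 R) (A : set T1) (B : set T2).
Hypotheses (mA : measurable A) (mB : measurable B).

Let g (F : T1 * T2 -> R) (z : T1 * T2) := \1_A z.1 * (\1_B z.2 * F z).

Lemma integrable_prod (F : T1 * T2 -> R) : measurable_fun setT F ->
  (exists M, forall x y, A x -> B y -> `|F (x, y)| <= M) ->
  (P \x Q)%E.-integrable setT (EFin \o g F).
Proof.
move=> mF [M FM]; apply: measurable_bounded_integrable => //.
- have -> : [set: T1 * T2] = setT `*` setT by rewrite setXTT.
  have := product_measure1E P Q measurableT measurableT.
  move=> /= ->; rewrite [X in (X * _)%E](_ : _ = 1%E) ?mul1e; last exact: probability_setT.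
  by rewrite (le_lt_trans (probability_le1 _ _)) ?ltry.
- apply: measurable_funM; first by apply: measurableT_comp => //; exact: measurable_indic.
  by apply: measurable_funM => //; apply: measurableT_comp => //; exact: measurable_indic.
- exists (Num.max 0 M); split; first by rewrite num_real.
  move=> y My [u v] _ /=; rewrite /g /= !indicE.
  have My' : Num.max 0 M <= y := ltW My.
  move: My'; rewrite ge_max => /andP[y0 My'].
  have [Au|_] := boolP (u \in A); last by rewrite mul0r normr0.
  have [Bv|_] := boolP (v \in B); last by rewrite mul0r mulr0 normr0.
  by rewrite !mul1r (le_trans _ My')// FM//; exact: set_mem.
Qed.

Lemma bmf_Ex (F : T1 * T2 -> R) : measurable_fun setT F ->
  (exists M, forall x y, A x -> B y -> `|F (x, y)| <= M) -> Q B = 1%E ->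
  bmf A (fun x => Ex Q B (fun y => F (x, y))).
Proof.
move=> mF [M FM] QB; split.
  apply: measurableT_comp; first exact: fine_measurable.
  pose G z : \bar R := (\1_B z.2 * F z)%:E.
  have mG : measurable_fun setT G.
    apply/measurable_EFinP; apply: measurable_funM => //.
    by apply: measurableT_comp => //; exact: measurable_indic.
  (* The measurability part of Tonelli's theorem concerns nonnegative functions, hence the split
     into positive and negative parts. *)
  rewrite (_ : (fun x => _) = (fun x => \int[Q]_y G^\+ (x, y) - \int[Q]_y G^\- (x, y))%E).
    apply: emeasurable_funB; apply: measurable_fun_fubini_tonelli_F => //.
    - exact: measurable_funepos.
    - exact: measurable_funeneg.
  apply/funext => x; rewrite [LHS]integralE.
  by congr (_ - _)%E; apply: eq_integral => y _; rewrite ?funeposE ?funenegE.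
exists M => x Ax; apply: norm_Ex_le => //.
  split; last by exists M => y By; exact: FM.
  exact: measurableT_comp.
by move=> y By; exact: FM.
Qed.

Lemma Ex_swap (F : T1 * T2 -> R) : measurable_fun setT F ->
  (exists M, forall x y, A x -> B y -> `|F (x, y)| <= M) ->
  Ex P A (fun x => Ex Q B (fun y => F (x, y))) =
  Ex Q B (fun y => Ex P A (fun x => F (x, y))).
Proof.
move=> mF bF; have iF := integrable_prod mF bF.
have bFx x : A x -> bmf B (fun y => F (x, y)).
  move=> Ax; split; first exact: measurableT_comp.
  by case: bF => M FM; exists M => y; exact: FM.
have bFy y : B y -> bmf A (fun x => F (x, y)).
  move=> By; split; first exact: measurableT_comp.
  by case: bF => M FM; exists M => x Ax; exact: FM.
have := Fubini iF; rewrite /Ex /Rintegral => h; congr fine.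
transitivity (\int[P]_x \int[Q]_y (g F (x, y))%:E)%E.
  apply: eq_integral => x _; rewrite /g /= indicE.
  have [/set_mem Ax|_] := boolP (x \in A).
    rewrite mul1r fineK; last first.
      apply: (integrable_fin_num _ (integrable_bmf Q mB (bFx _ Ax))) => //.
    by apply: eq_integral => y _; rewrite mul1r.
  by rewrite mul0r; under eq_integral do rewrite mul0r; rewrite integral0.
rewrite h; apply: eq_integral => y _; rewrite /g /= indicE.
have [/set_mem By|_] := boolP (y \in B).
  rewrite mul1r fineK; last first.
    apply: (integrable_fin_num _ (integrable_bmf P mA (bFy _ By))) => //.
  by apply: eq_integral => x _; rewrite mul1r.
by rewrite mul0r; under eq_integral do rewrite mul0r mulr0; rewrite integral0.
Qed.

End expectation_fubini.

(** * Vectors, orthogonal maps and invariance *)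

Section vectors.
Context {R : realType} {d : nat}.
Implicit Types (x y z w : d.-tuple R) (a b : R).

Definition lincomb a x b y : d.-tuple R :=
  [tuple a * tnth x i + b * tnth y i | i < d].

Lemma dotC x y : dot x y = dot y x.
Proof. by apply: eq_bigr => i _; rewrite mulrC. Qed.

Lemma dot_lincombl a x b y z :
  dot (lincomb a x b y) z = a * dot x z + b * dot y z.
Proof.
rewrite /dot !mulr_sumr -big_split /=; apply: eq_bigr => i _.
by rewrite tnth_mktuple mulrDl !mulrA.
Qed.

Lemma dot_lincombr a x b y z :
  dot z (lincomb a x b y) = a * dot z x + b * dot z y.
Proof. by rewrite dotC dot_lincombl !(dotC z). Qed.

Definition dotE := (dot_lincombl, dot_lincombr).

Lemma dot_ge0 x : 0 <= dot x x.
Proof. by apply: sumr_ge0 => i _; rewrite -expr2 sqr_ge0. Qed.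

Lemma dot_eq0 x : dot x x = 0 -> forall y, dot x y = 0.
Proof.
move=> /eqP; rewrite psumr_eq0; last by move=> i _; rewrite -expr2 sqr_ge0.
move=> /allP x0 y; apply: big1 => i _.
have := x0 i (mem_index_enum _); rewrite mulf_eq0 orbb => /eqP ->.
by rewrite mul0r.
Qed.

Lemma dot_CS x y : dot x y ^+ 2 <= dot x x * dot y y.
Proof.
have [x0|x0] := eqVneq (dot x x) 0; first by rewrite (dot_eq0 x0) x0 mul0r expr0n.
have xp : 0 < dot x x by rewrite lt_def x0 dot_ge0.
have := dot_ge0 (lincomb (dot x y) x (- dot x x) y).
rewrite !dotE (dotC y x) => h.
have h2 : 0 <= dot x x * (dot x x * dot y y - dot x y ^+ 2).
  by apply: le_trans h _; rewrite le_eqVlt; apply/orP; left; apply/eqP; ring.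
by move: h2; rewrite pmulr_rge0// subr_ge0.
Qed.

Lemma norm_dot_le1 x y : sphere R d x -> sphere R d y -> `|dot x y| <= 1.
Proof.
rewrite /sphere /= => x1 y1; have := dot_CS x y; rewrite x1 y1 mulr1.
move=> h; have : `|dot x y| ^+ 2 <= 1 ^+ 2 by rewrite real_normK ?num_real// expr1n.
by rewrite ler_pXn2r ?nnegrE.
Qed.

Definition reflection w y := lincomb 1 y (- (2 * dot w y / dot w w)) w.

Definition reflection_mx w : 'M[R]_d :=
  1%:M - (2 / dot w w) *: \matrix_(i, j) (tnth w i * tnth w j).

Lemma mxact_reflection w y : mxact (reflection_mx w) y = reflection w y.
Proof.
apply: eq_from_tnth => i; rewrite !tnth_mktuple mul1r.
under eq_bigr do rewrite !mxE mulrBl.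
rewrite sumrB; congr (_ + _).
  rewrite (bigD1 i)//= eqxx mul1r big1 ?addr0// => j /negbTE ji.
  by rewrite eq_sym ji mul0r.
rewrite mulNr; congr (- _); move: (dot w w)^-1 => k.
rewrite /dot !mulr_sumr !mulr_suml; apply: eq_bigr => j _; ring.
Qed.

Lemma dot_reflection w x y : dot w w != 0 ->
  dot (reflection w x) (reflection w y) = dot x y.
Proof. by move=> w0; rewrite /reflection !dotE (dotC x w); field. Qed.

Lemma reflectionK w x : dot w w != 0 -> reflection w (reflection w x) = x.
Proof.
move=> w0; apply: eq_from_tnth => i; rewrite /reflection !dotE !tnth_mktuple.
by field.
Qed.

Lemma reflection_mx_sym w : (reflection_mx w)^T = reflection_mx w.
Proof. by apply/matrixP => i j; rewrite !mxE eq_sym [tnth w j * _]mulrC. Qed.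

Definition orthogonal_mx (Q : 'M[R]_d) := Q *m Q^T = 1%:M.

Lemma mxact_mul (A B : 'M[R]_d) x : mxact (A *m B) x = mxact A (mxact B x).
Proof.
apply: eq_from_tnth => i; rewrite !tnth_mktuple.
under eq_bigr do rewrite mxE mulr_suml.
rewrite exchange_big /=; apply: eq_bigr => j _.
by rewrite tnth_mktuple mulr_sumr; apply: eq_bigr => k _; rewrite mulrA.
Qed.

Definition cvec x : 'cV[R]_d := \col_i tnth x i.

Lemma dot_mx x y : dot x y = ((cvec x)^T *m cvec y) 0 0.
Proof. by rewrite mxE; apply: eq_bigr => i _; rewrite !mxE. Qed.

Lemma cvec_mxact Q x : cvec (mxact Q x) = Q *m cvec x.
Proof.
by apply/matrixP => i j; rewrite !mxE tnth_mktuple; apply: eq_bigr => k _; rewrite !mxE.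
Qed.

Lemma orthogonal_dot Q x y : orthogonal_mx Q -> dot (mxact Q x) (mxact Q y) = dot x y.
Proof.
move=> QQ; have QtQ : Q^T *m Q = 1%:M by exact: mulmx1C.
by rewrite !dot_mx !cvec_mxact trmx_mul -mulmxA (mulmxA Q^T) QtQ mul1mx.
Qed.

Lemma orthogonal_reflection w : dot w w != 0 -> orthogonal_mx (reflection_mx w).
Proof.
move=> w0; rewrite /orthogonal_mx reflection_mx_sym.
apply/matrixP => i j.
(* A matrix entry is read off the action on a basis vector, which reduces the identity to
   [reflectionK]. *)
pose e : d.-tuple R := [tuple (k == j)%:R | k < d].
have act (A : 'M[R]_d) : tnth (mxact A e) i = A i j.
  rewrite tnth_mktuple (bigD1 j)//= tnth_mktuple eqxx mulr1 big1 ?addr0// => k /negbTE kj.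
  by rewrite tnth_mktuple kj mulr0.
rewrite -act mxact_mul !mxact_reflection reflectionK//.
by rewrite tnth_mktuple mxE.
Qed.

Lemma orthogonal_mul A B : orthogonal_mx A -> orthogonal_mx B -> orthogonal_mx (A *m B).
Proof.
by move=> AA BB; rewrite /orthogonal_mx trmx_mul mulmxA -(mulmxA A) BB mulmx1.
Qed.

Lemma measurable_dot : measurable_fun setT (fun z : d.-tuple R * d.-tuple R => dot z.1 z.2).
Proof.
rewrite /dot; apply: measurable_sum => i; apply: measurable_funM.
  by apply: (measurableT_comp (measurable_tnth i)).
by apply: (measurableT_comp (measurable_tnth i)).
Qed.

Lemma measurable_dotl y : measurable_fun setT (fun x => dot x y).
Proof. exact: (measurable_fun_pair1 y measurable_dot). Qed.

Lemma measurable_dot_diag : measurable_fun setT (fun x : d.-tuple R => dot x x).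
Proof.
apply: (measurableT_comp (f := fun z : d.-tuple R * d.-tuple R => dot z.1 z.2)
  (g := fun x => (x, x))); first exact: measurable_dot.
by apply: measurable_fun_pair; exact: measurable_id.
Qed.

Lemma measurable_sphere : measurable (sphere R d).
Proof.
rewrite -[sphere R d]setTI.
exact: (measurable_dot_diag measurableT (measurable_set1 (1 : R))).
Qed.

Lemma measurable_mxact (Q : 'M[R]_d) : measurable_fun setT (mxact Q).
Proof.
apply/measurable_fun_tnthP => i.
rewrite (_ : _ \o _ = fun x => \sum_(j < d) Q i j * tnth x j); last first.
  by apply/funext => x /=; rewrite tnth_mktuple.
apply: measurable_sum => j; apply: measurable_funM => //.
exact: measurable_tnth.
Qed.

Lemma sphere_mxact Q x : orthogonal_mx Q -> sphere R d (mxact Q x) = sphere R d x.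
Proof. by move=> QQ; rewrite /sphere /= orthogonal_dot. Qed.

End vectors.

Section exchange.
Context {R : realType} {d : nat}.
Implicit Types x y z u : d.-tuple R.

Definition basis_vec (j : 'I_d) : d.-tuple R := [tuple (k == j)%:R | k < d].

Lemma dot_basis x j : dot x (basis_vec j) = tnth x j.
Proof.
rewrite /dot (bigD1 j)//= tnth_mktuple eqxx mulr1 big1 ?addr0// => k /negbTE kj.
by rewrite tnth_mktuple kj mulr0.
Qed.

Lemma basis_sphere j : sphere R d (basis_vec j).
Proof. by rewrite /sphere /= dot_basis tnth_mktuple eqxx. Qed.

(** The reflection with normal [x - y] swaps two vectors of equal length and fixes every [z] in the
    bisecting hyperplane. It degenerates for [x = y], where the identity serves. *)
Lemma exists_exchange x y : dot x x = dot y y ->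
  exists2 Q : 'M[R]_d, orthogonal_mx Q &
    (forall u, dot (mxact Q u) y = dot u x) /\
    (forall z, dot z x = dot z y -> forall u, dot (mxact Q u) z = dot u z).
Proof.
move=> xy; pose w := lincomb 1 x (-1) y.
have [w0|w0] := eqVneq (dot w w) 0.
  exists 1%:M; first by rewrite /orthogonal_mx trmx1 mulmx1.
  have id1 u : mxact 1%:M u = u.
    apply: eq_from_tnth => i; rewrite tnth_mktuple (bigD1 i)//= mxE eqxx mul1r.
    by rewrite big1 ?addr0// => j /negbTE ji; rewrite mxE eq_sym ji mul0r.
  split=> [u|z _ u]; rewrite id1//.
  have := dot_eq0 w0 u; rewrite dotE !(dotC _ u) mul1r mulN1r => /eqP.
  by rewrite subr_eq0 => /eqP.
have wwE : dot w w = 2 * dot w x by rewrite /w !dotE (dotC y x) -xy; ring.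
exists (reflection_mx w); first exact: orthogonal_reflection.
split=> [u|z zxy u]; rewrite mxact_reflection.
  rewrite -(dot_reflection u x w0); congr (dot _ _).
  rewrite /reflection -wwE divff// /w.
  by apply: eq_from_tnth => i; rewrite !tnth_mktuple; lra.
rewrite /reflection dot_lincombl (_ : dot w z = 0) ?mulr0 ?addr0 ?mul1r//.
by rewrite /w dotE !(dotC _ z) zxy; ring.
Qed.

End exchange.

Section invariance.
Context {R : realType} {d : nat}.
Variable rho : probability (d.-tuple R) R.
Hypothesis unif : uniform_sphere rho.
Local Notation S := (sphere R d).
Local Notation E := (Ex rho S).
Local Notation mS := (@measurable_sphere R d).

Lemma bmf_mxact Q (f : d.-tuple R -> R) : orthogonal_mx Q -> bmf S f ->
  bmf S (fun x => f (mxact Q x)).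
Proof.
move=> QQ [mf [M fM]]; split.
  by apply: measurableT_comp => //; exact: measurable_mxact.
by exists M => x Sx; apply: fM; rewrite sphere_mxact.
Qed.

Lemma Ex_mxact Q (f : d.-tuple R -> R) : orthogonal_mx Q -> bmf S f ->
  E (fun x => f (mxact Q x)) = E f.
Proof.
move=> QQ bf; rewrite /Ex /Rintegral; congr fine.
pose g x := (\1_S x * f x)%:E.
have mg : measurable_fun setT g by case/integrableP: (integrable_bmf rho mS bf).
have gQ : g \o mxact Q = fun x => (\1_S x * f (mxact Q x))%:E.
  apply/funext => x; rewrite /g /= !indicE.
  congr (_%:R * _)%:E; congr nat_of_bool; apply/idP/idP; rewrite !inE sphere_mxact//.
rewrite -gQ.
have ig : rho.-integrable (mxact Q @^-1` setT) (g \o mxact Q).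
  rewrite preimage_setT gQ.
  exact: (integrable_bmf rho mS (bmf_mxact QQ bf)).
have := integral_pushforward (measurable_mxact Q) mg ig measurableT.
rewrite preimage_setT => <-.
apply: eq_measure_integral; first exact: measurable_mxact.
move=> mQ A mA _; case: unif => _ /(_ Q QQ A mA) h.
exact: h.
Qed.

Lemma Ex_reflection w (f : d.-tuple R -> R) : dot w w != 0 -> bmf S f ->
  E (fun x => f (reflection w x)) = E f.
Proof.
move=> w0 bf; rewrite -(Ex_mxact (orthogonal_reflection w0) bf).
by apply: eq_Ex => x _; rewrite mxact_reflection.
Qed.

End invariance.

(** * Stein's inequality for a coordinate *)

Section stein.
Context {R : realType} {n : nat}.
Local Notation d := n.+2.
Local Notation T := (d.-tuple R).
Variable rho : probability T R.
Hypothesis unif : uniform_sphere rho.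
Local Notation S := (sphere R d).
Local Notation E := (Ex rho S).
Local Notation mS := (@measurable_sphere R d).
Let PS : rho S = 1%E. Proof. by case: unif. Qed.

Local Notation coord i := (fun x : T => tnth x i).

Lemma sphere_coord (x : T) i : S x -> `|tnth x i| <= 1.
Proof.
move=> x1; have : `|tnth x i| ^+ 2 <= 1 ^+ 2.
  rewrite real_normK ?num_real// expr1n -x1 /dot (bigD1 i)//= -expr2 lerDl.
  by apply: sumr_ge0 => j _; rewrite -expr2 sqr_ge0.
by rewrite ler_pXn2r ?nnegrE.
Qed.

Lemma bmf_coord i : bmf S (coord i).
Proof.
by split; [exact: measurable_tnth|exists 1 => x; exact: sphere_coord].
Qed.

Lemma bmf_coord_comp (h : R -> R) i :
  measurable_fun setT h -> (exists M, forall x, `|x| <= 1 -> `|h x| <= M) ->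
  bmf S (fun x => h (tnth x i)).
Proof.
move=> mh [M hM]; split.
  by apply: (measurableT_comp mh); exact: measurable_tnth.
by exists M => x Sx; apply: hM; exact: sphere_coord.
Qed.

Definition plane_vector (a b : R) (j : 'I_d) : T :=
  [tuple (if k == ord0 then a else if k == j then b else 0) | k < d].

Lemma dot_plane_vector a b j x : j != ord0 ->
  dot (plane_vector a b j) x = a * tnth x ord0 + b * tnth x j.
Proof.
move=> j0; rewrite /dot (bigD1 ord0)//= (bigD1 j)//= !tnth_mktuple eqxx (negbTE j0) eqxx.
rewrite big1 ?addr0// => k /andP[k0 kj].
by rewrite tnth_mktuple (negbTE k0) (negbTE kj) mul0r.
Qed.

(* [q] minorizes the derivative of [h], with a cubic error.  The reflection of normal
   [(-a, 1)] in the plane of the coordinates [ord0] and [j] takes the role of an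
   infinitesimal rotation; the inequality appears at first order in [a]. *)
Lemma stein_coord (h q : R -> R) (l B L eta : R) (j : 'I_d) :
  measurable_fun setT h -> measurable_fun setT q ->
  (forall x, `|x| <= 1 -> `|q x| <= B) ->
  (forall x y, `|x| <= 1 -> `|y| <= 1 -> `|h x - h y| <= l * `|x - y|) ->
  0 < eta -> 0 <= L ->
  (forall x y, `|x| <= 1 -> `|y| <= 1 -> `|y - x| <= eta ->
    q x * (y - x) ^+ 2 - L * `|y - x| ^+ 3 <= (y - x) * (h y - h x)) ->
  j != ord0 ->
  E (fun x => tnth x j ^+ 2 * q (tnth x ord0)) <=
  E (fun x => tnth x ord0 * h (tnth x ord0)).
Proof.
move=> mh mq qB hl eta0 L0 hq j0.
have B0 : 0 <= B by apply: le_trans (qB 0 _); rewrite ?normr0.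
have l0 : 0 <= l.
  have := hl 1 0; rewrite normr1 normr0 subr0 normr1 mulr1 => /(_ (lexx _) ler01).
  by apply: le_trans.
have bh : bmf S (fun x => h (tnth x ord0)).
  apply: bmf_coord_comp => //; exists (`|h 0| + l) => x x1.
  have -> : h x = h 0 + (h x - h 0) by ring.
  apply: le_trans (ler_normD _ _) _; rewrite lerD2l.
  apply: le_trans (hl _ _ x1 _) _; rewrite ?normr0// subr0.
  by rewrite -[leRHS]mulr1 ler_wpM2l.
have bq : bmf S (fun x => q (tnth x ord0)).
  by apply: bmf_coord_comp => //; exists B.
have bX := bmf_coord ord0; have bY := bmf_coord j.
have bXh := bmfM bX bh; have bYh := bmfM bY bh.
pose w a := plane_vector (- a) 1 j.
have ww a : dot (w a) (w a) = 1 + a ^+ 2.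
  rewrite dot_plane_vector// !tnth_mktuple eqxx (negbTE j0) eqxx; ring.
have ww0 a : dot (w a) (w a) != 0.
  by rewrite ww; apply: lt0r_neq0; rewrite ltr_pwDl// sqr_ge0.
have [k kE] : exists k : R -> R, forall a, k a = 2 / (1 + a ^+ 2) by eexists.
have r0 a x : tnth (reflection (w a) x) ord0 =
    tnth x ord0 + k a * a * (tnth x j - a * tnth x ord0).
  rewrite tnth_mktuple ww dot_plane_vector// /w tnth_mktuple eqxx kE.
  by field; rewrite -ww; exact: ww0.
have rj a x : tnth (reflection (w a) x) j =
    k a * a * tnth x ord0 + (1 - k a) * tnth x j.
  rewrite tnth_mktuple ww dot_plane_vector// /w tnth_mktuple eqxx (negbTE j0) kE.
  by field; rewrite -ww; exact: ww0.
(* At [a = 0] the reflection only negates [x_j], and the integrand is odd under it. *)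
have EY : E (fun x => tnth x j * h (tnth x ord0)) = 0.
  have := Ex_reflection unif (ww0 0) bYh.
  under eq_Ex => x Sx do rewrite r0 rj mulr0 !mul0r add0r addr0.
  have -> : k 0 = 2 by rewrite kE expr0n addr0 divr1.
  under eq_Ex => x Sx do rewrite -mulrA.
  rewrite (ExZ _ mS)// => h1; lra.
have main a : 0 < a -> a <= 1 -> 4 * a <= eta ->
    E (fun x => tnth x j ^+ 2 * q (tnth x ord0)) <=
    E (fun x => tnth x ord0 * h (tnth x ord0)) + a * (16 * L + 2 * l + 3 * B).
  move=> a0 a1 ae.
  have k0 : 0 < k a by rewrite kE divr_gt0// ltr_pwDl// sqr_ge0.
  have k2 : k a <= 2.
    by rewrite kE ler_pdivrMr ?ltr_pwDl ?sqr_ge0// mulrDr mulr1 lerDl mulr_ge0// sqr_ge0.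
  have bhr : bmf S (fun x => h (tnth (reflection (w a) x) ord0)).
    under eq_fun do rewrite -mxact_reflection.
    exact: (bmf_mxact (orthogonal_reflection (ww0 a)) bh).
  (* The reflection is an involution, so invariance moves it from the argument of [h] onto the
     factor [x_j]; the [x_j] part of the image integrates to 0 by [EY]. *)
  have e1 : E (fun x => tnth x j * h (tnth (reflection (w a) x) ord0)) =
      k a * a * E (fun x => tnth x ord0 * h (tnth x ord0)).
    rewrite -(Ex_reflection unif (ww0 a) (bmfM bY bhr)).
    under eq_Ex => x Sx do rewrite reflectionK// rj mulrDl -!mulrA.
    rewrite (ExD _ mS); [|by do 2 apply: bmfZ|exact: bmfZ].
    by rewrite !(ExZ _ mS) ?EY ?mulr0 ?addr0 ?mulrA//; apply: bmfZ.
  have ka0 : 0 < k a * a by exact: mulr_gt0.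
  have bYhr := bmfM bY bhr.
  have e2 : E (fun x => tnth x j * h (tnth (reflection (w a) x) ord0) -
      tnth x j * h (tnth x ord0)) = k a * a * E (fun x => tnth x ord0 * h (tnth x ord0)).
    by rewrite (ExB _ mS)// EY subr0 e1.
  rewrite -(ler_pM2l ka0) mulrDr -e2.
  rewrite -(Ex_cst mS PS (k a * a * (a * (16 * L + 2 * l + 3 * B)))) -(ExD _ mS); last 2 first.
  - exact: bmfB.
  - exact: bmf_cst.
  rewrite -(ExZ _ mS); last by apply: bmfM => //; exact: bmfX.
  apply: (le_Ex rho mS).
  - by apply: bmfZ; apply: bmfM => //; exact: bmfX.
  - by apply: bmfD; [exact: bmfB|exact: bmf_cst].
  move=> x Sx; rewrite r0.
  have X1 := sphere_coord ord0 Sx; have Y1 := sphere_coord j Sx.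
  have X1' : `|tnth (reflection (w a) x) ord0| <= 1.
    by apply: sphere_coord; rewrite /sphere /= dot_reflection.
  move: X1'; rewrite r0.
  set X := tnth x ord0 in X1 *; set Y := tnth x j in Y1 *.
  set s := k a * a in ka0 *; set D := s * (Y - a * X) => X1'.
  have YaX : `|Y - a * X| <= 2.
    apply: le_trans (ler_normB _ _) _; rewrite normrM (gtr0_norm a0).
    have : a * `|X| <= 1 by rewrite -[leRHS]mulr1 ler_pM// ltW.
    lra.
  have s2a : s <= 2 * a by rewrite ler_wpM2r// ltW.
  clearbody s.
  have Ds : `|D| <= 2 * s.
    by rewrite normrM (gtr0_norm ka0) mulrC ler_wpM2r// ltW.
  have De : `|X + D - X| <= eta.
    by rewrite addrC addKr (le_trans Ds)// (le_trans _ ae)//; lra.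
  have := hq X (X + D) X1 X1' De.
  have := hl (X + D) X X1' X1.
  have -> : X + D - X = D by ring.
  set H := h (X + D) - h X => Hl DH.
  rewrite -/H (_ : Y * h (X + D) - Y * h X = Y * H); last by rewrite /H; ring.
  (* [Y = D / s + a * X] produces the increment product [D * H], which [hq] minorizes by about
     [q X * s^2 * Y^2]; the remaining terms are [s^2] times [O(a)]. *)
  have YE : s * (Y * H) = D * H + s * a * X * H by rewrite /D; ring.
  rewrite -(ler_pM2l ka0) mulrDr YE.
  have aXH : - (s * a * (l * (2 * s))) <= s * a * X * H.
    have : `|s * a * X * H| <= s * a * (l * (2 * s)).
      rewrite !normrM (gtr0_norm ka0) (gtr0_norm a0) -mulrA.
      apply: ler_wpM2l; first by rewrite mulr_ge0 ?ltW.
      rewrite -[leRHS]mul1r; apply: ler_pM => //.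
      by apply: le_trans Hl _; rewrite ler_wpM2l.
    by rewrite ler_norml => /andP[].
  have D3 : L * `|D| ^+ 3 <= L * (8 * s ^+ 3).
    rewrite ler_wpM2l// (_ : 8 * s ^+ 3 = (2 * s) ^+ 3); last ring.
    by rewrite lerXn2r ?nnegrE ?mulr_ge0// ltW.
  have qD : s ^+ 2 * (Y ^+ 2 * q X) - s ^+ 2 * (3 * a * B) <= q X * D ^+ 2.
    rewrite -subr_ge0 (_ : _ - _ = s ^+ 2 *
       (3 * a * B + q X * (a ^+ 2 * X ^+ 2 - 2 * a * X * Y))); last by rewrite /D; ring.
    rewrite mulr_ge0 ?sqr_ge0//.
    have : `|q X * (a ^+ 2 * X ^+ 2 - 2 * a * X * Y)| <= B * (3 * a).
      rewrite normrM ler_pM// ?qB//.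
      apply: le_trans (ler_normB _ _) _.
      have -> : 3 * a = a + 2 * a by ring.
      have -> : 2 * a * X * Y = 2 * a * (X * Y) by ring.
      apply: lerD.
        rewrite -exprMn normrX normrM (gtr0_norm a0) -[leRHS]mulr1 expr2.
        have aX : a * `|X| <= a by rewrite -[leRHS]mulr1 ler_wpM2l// ltW.
        have aX0 : 0 <= a * `|X| by apply: mulr_ge0 => //; exact: ltW.
        by apply: ler_pM => //; exact: le_trans aX a1.
      rewrite normrM (gtr0_norm (_ : 0 < 2 * a)) ?mulr_gt0// -[leRHS]mulr1.
      apply: ler_wpM2l; first by rewrite mulr_ge0 ?ltW.
      by rewrite normrM -[leRHS]mulr1; apply: ler_pM.
    rewrite ler_norml => /andP[h1 _]; lra.
  rewrite (_ : s * (s * (Y ^+ 2 * q X)) = s ^+ 2 * (Y ^+ 2 * q X)); last ring.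
  have s3 : L * (8 * s ^+ 3) <= s ^+ 2 * a * (16 * L).
    rewrite (_ : _ * _ = s ^+ 2 * (8 * L) * s); last ring.
    rewrite (_ : _ * (16 * L) = s ^+ 2 * (8 * L) * (2 * a)); last ring.
    by rewrite ler_wpM2l// mulr_ge0 ?sqr_ge0// mulr_ge0.
  have -> : s * (s * (a * (16 * L + 2 * l + 3 * B))) =
    s ^+ 2 * a * (16 * L) + s * a * (l * (2 * s)) + s ^+ 2 * (3 * a * B) by ring.
  lra.
apply/ler_addgt0Pr => e e0.
set C := 16 * L + 2 * l + 3 * B in main.
have C0 : 0 <= C by rewrite !addr_ge0// mulr_ge0.
pose a := Num.min (Num.min 1 (eta / 4)) (e / (C + 1)).
have C1 : 0 < C + 1 by rewrite ltr_wpDl.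
have a0 : 0 < a by rewrite !lt_min ltr01 /= !divr_gt0.
have := main a a0; rewrite /a !ge_min lexx /= => /(_ isT).
have h4 : 4 * a <= eta.
  have : a <= eta / 4 by rewrite /a !ge_min lexx !orbT.
  by rewrite ler_pdivlMr// mulrC.
move=> /(_ h4) /le_trans -> //; rewrite lerD2l -/a.
have : a <= e / (C + 1) by rewrite /a !ge_min lexx !orbT.
by rewrite ler_pdivlMr// => h4'; apply: le_trans h4'; rewrite ler_pM2l// lerDl.
Qed.

(** Summing [stein_coord] over the other coordinates turns [x_j^2] into [1 - x_0^2]. Besides the
    Lipschitz bound, only a lower bound [q] on the slopes of [h] is asked for, so functions with
    corners, such as clamps and hinges, can serve as [h]. *)
Lemma stein (h q : R -> R) (l B L eta : R) :
  measurable_fun setT h -> measurable_fun setT q ->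
  (forall x, `|x| <= 1 -> `|q x| <= B) ->
  (forall x y, `|x| <= 1 -> `|y| <= 1 -> `|h x - h y| <= l * `|x - y|) ->
  0 < eta -> 0 <= L ->
  (forall x y, `|x| <= 1 -> `|y| <= 1 -> `|y - x| <= eta ->
    q x * (y - x) ^+ 2 - L * `|y - x| ^+ 3 <= (y - x) * (h y - h x)) ->
  E (fun x => (1 - tnth x ord0 ^+ 2) * q (tnth x ord0)) <=
  n.+1%:R * E (fun x => tnth x ord0 * h (tnth x ord0)).
Proof.
move=> mh mq qB hl eta0 L0 hq.
have bq : bmf S (fun x => q (tnth x ord0)).
  by apply: bmf_coord_comp => //; exists B.
rewrite (_ : E _ = \sum_(j < n.+1) E (fun x => tnth x (lift ord0 j) ^+ 2 * q (tnth x ord0))).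
  have sumE (u : R) : n.+1%:R * u = \sum_(j < n.+1) u.
    by rewrite sumr_const card_ord mulr_natl.
  rewrite sumE; apply: ler_sum => j _.
  exact: (stein_coord mh mq qB hl eta0 L0 hq).
rewrite -(Ex_sum _ mS); last first.
  by move=> j; apply: bmfM => //; apply: bmfX; exact: bmf_coord.
apply: eq_Ex => x Sx; rewrite -mulr_suml; congr (_ * _).
have := Sx; rewrite /sphere /= /dot big_ord_recl => <-.
rewrite expr2 addrC addKr.
by apply: eq_bigr => j _; rewrite expr2.
Qed.

End stein.

(** * Elementary bounds on the exponential *)

Section exp_bounds.
Context {R : realType}.
Implicit Types (x y t l : R).

(** Squaring [expR (t / 2) * (1 - t / 2) <= 1] leaves a polynomial inequality with surplus
    [t^2 / 4 * (1 - 3 t + t^2)], nonnegative for [t <= 1/3]; negative [t] of any size are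
    allowed. *)
Lemma expR_le_quad t : t <= 1 / 3 -> expR t <= 1 + t + t ^+ 2.
Proof.
move=> t3; have ht : 0 < 1 - t / 2 by lra.
have e0 : 0 < expR (t / 2) by exact: expR_gt0.
have h : expR (t / 2) * (1 - t / 2) <= 1.
  rewrite -[leRHS](expRxMexpNx_1 (t / 2)) ler_pM2l//.
  by apply: le_trans (expR_ge1Dx _); rewrite le_eqVlt; apply/orP; left; apply/eqP; ring.
have h2 : expR t * (1 - t / 2) ^+ 2 <= 1.
  have -> : expR t = expR (t / 2) ^+ 2 by rewrite expr2 -expRD; congr expR; field.
  rewrite -exprMn expr_le1 //; apply: mulr_ge0; exact: ltW.
have h3 : 1 <= (1 + t + t ^+ 2) * (1 - t / 2) ^+ 2.
  rewrite -subr_ge0 (_ : _ - 1 = t ^+ 2 / 4 * (1 - 3 * t + t ^+ 2)); last by field.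
  apply: mulr_ge0; first by rewrite divr_ge0// sqr_ge0.
  have := sqr_ge0 t; lra.
have := le_trans h2 h3; rewrite ler_pM2r// exprn_gt0//.
Qed.

(** This is the slope condition of [stein] for [expR (l * x)], with its derivative as [q]; the
    companion [exp_increment_le] gives the condition for [- expR (l * x)]. *)
Lemma exp_increment_ge l x y : 0 < l -> `|l * (y - x)| <= 1 / 3 ->
  l * expR (l * x) * (y - x) ^+ 2 - l ^+ 2 * expR (l * x) * `|y - x| ^+ 3 <=
  (y - x) * (expR (l * y) - expR (l * x)).
Proof.
move=> l0; set t := l * (y - x) => t3.
have -> : expR (l * y) = expR (l * x) * expR t.
  by rewrite -expRD /t; congr expR; ring.
rewrite -(ler_pM2l l0).
rewrite [leLHS](_ : _ = expR (l * x) * (t ^+ 2 - `|t| ^+ 3)); last first.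
  by rewrite /t normrM (gtr0_norm l0); ring.
rewrite [leRHS](_ : _ = expR (l * x) * (t * (expR t - 1))); last by rewrite /t; ring.
rewrite ler_pM2l ?expR_gt0//.
have := t3; rewrite ler_norml => /andP[_ t3'].
have := expR_le_quad t3'; have := expR_ge1Dx t.
have [t0|t0] := leP 0 t => h1 h2.
  rewrite (ger0_norm t0); apply: (@le_trans _ _ (t ^+ 2)).
    by rewrite lerBlDr lerDl exprn_ge0.
  by rewrite expr2 ler_wpM2l//; lra.
rewrite (ltr0_norm t0) -subr_ge0.
rewrite (_ : _ - _ = - t * (1 + t + t ^+ 2 - expR t)); last by ring.
by apply: mulr_ge0; lra.
Qed.

Lemma exp_increment_le l x y : 0 < l -> `|l * (y - x)| <= 1 / 3 ->
  (y - x) * (expR (l * y) - expR (l * x)) <=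
  l * expR (l * x) * (y - x) ^+ 2 + l ^+ 2 * expR (l * x) * `|y - x| ^+ 3.
Proof.
move=> l0; set t := l * (y - x) => t3.
have -> : expR (l * y) = expR (l * x) * expR t.
  by rewrite -expRD /t; congr expR; ring.
rewrite -(ler_pM2l l0).
rewrite [leRHS](_ : _ = expR (l * x) * (t ^+ 2 + `|t| ^+ 3)); last first.
  by rewrite /t normrM (gtr0_norm l0); ring.
rewrite [leLHS](_ : _ = expR (l * x) * (t * (expR t - 1))); last by rewrite /t; ring.
rewrite ler_pM2l ?expR_gt0//.
have := t3; rewrite ler_norml => /andP[_ t3'].
have := expR_le_quad t3'; have := expR_ge1Dx t.
have [t0|t0] := leP 0 t => h1 h2.
  rewrite (ger0_norm t0) -subr_ge0.
  rewrite (_ : _ - _ = t * (1 + t + t ^+ 2 - expR t)); last by ring.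
  by apply: mulr_ge0; lra.
apply: (@le_trans _ _ (t ^+ 2)); last by rewrite lerDl exprn_ge0.
rewrite -subr_ge0.
rewrite (_ : _ - _ = - t * (expR t - (1 + t))); last by ring.
by apply: mulr_ge0; lra.
Qed.

Lemma exp_lipschitz M x y : x <= M -> y <= M ->
  `|expR x - expR y| <= expR M * `|x - y|.
Proof.
wlog xy : x y / x <= y => [hw|] xM yM.
  by have [/hw->//|/ltW/hw] := leP x y; rewrite distrC (distrC x); exact.
rewrite distrC (distrC x) !ger0_norm ?subr_ge0 ?ler_expR//.
apply: (@le_trans _ _ (expR y * (y - x))); last first.
  by rewrite ler_wpM2r ?subr_ge0 ?ler_expR.
have := expR_ge1Dx (x - y); rewrite expRD expRN => h.
have y0 := expR_gt0 y.
have : expR y * (1 + (x - y)) <= expR x.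
  apply: le_trans (ler_wpM2l (ltW y0) h) _.
  by rewrite mulrCA divff ?mulr1// lt0r_neq0.
lra.
Qed.

Lemma le_expR_lim (M c : R) :
  (forall e, 0 < e -> M <= expR (c + e)) -> M <= expR c.
Proof.
move=> h; have [M0|M0] := leP M 0; first exact: le_trans M0 (expR_ge0 _).
rewrite -(lnK M0) ler_expR; apply/ler_addgt0Pr => e e0.
by rewrite -ler_expR lnK//; exact: h.
Qed.

End exp_bounds.

(** * Exponential moments of a coordinate *)

Section marginal.
Context {R : realType} {n : nat}.
Local Notation d := n.+2.
Local Notation T := (d.-tuple R).
Variable rho : probability T R.
Hypothesis unif : uniform_sphere rho.
Local Notation S := (sphere R d).
Local Notation E := (Ex rho S).
Local Notation mS := (@measurable_sphere R d).
Local Notation m := (n.+1%:R : R).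
Local Notation X x := (@tnth n.+2 R x ord0).
Let PS : rho S = 1%E. Proof. by case: unif. Qed.

Let m0 : 0 < m. Proof. by rewrite ltr0n. Qed.

Lemma bmf_X : bmf S (fun x => X x). Proof. exact: bmf_coord. Qed.

Lemma bmf_exp_coord l : bmf S (fun x => expR (l * X x)).
Proof. by apply: bmf_expR; apply: bmfZ; exact: bmf_X. Qed.

Lemma measurable_expZ l : measurable_fun setT (fun x : R => expR (l * x)).
Proof. by apply: measurableT_comp => //; exact: (@mulrl_measurable R setT l). Qed.

Lemma exp_lipschitz1 (l x y : R) : 0 < l -> `|x| <= 1 -> `|y| <= 1 ->
  `|expR (l * x) - expR (l * y)| <= expR l * l * `|x - y|.
Proof.
move=> l0 /ler_normlP[_ x1] /ler_normlP[_ y1].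
have := @exp_lipschitz _ l (l * x) (l * y).
rewrite -mulrBr normrM (gtr0_norm l0) mulrA; apply.
  by rewrite -[leRHS]mulr1 ler_pM2l.
by rewrite -[leRHS]mulr1 ler_pM2l.
Qed.

Let etaP (l : R) : 0 < l -> 0 < 1 / (3 * l).
Proof. by move=> l0; rewrite divr_gt0// mulr_gt0. Qed.

Let eta_le (l x y : R) : 0 < l -> `|y - x| <= 1 / (3 * l) -> `|l * (y - x)| <= 1 / 3.
Proof.
move=> l0; rewrite normrM (gtr0_norm l0) => h.
apply: le_trans (ler_wpM2l (ltW l0) h) _; rewrite le_eqVlt; apply/orP; left.
by apply/eqP; field; rewrite lt0r_neq0.
Qed.

Let exp_le_l (l x : R) : 0 < l -> `|x| <= 1 -> expR (l * x) <= expR l.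
Proof.
by move=> l0; rewrite ler_norml => /andP[_ x1]; rewrite ler_expR -[leRHS]mulr1 ler_pM2l.
Qed.

Lemma stein_exp_ge l : 0 < l ->
  E (fun x => (1 - X x ^+ 2) * (l * expR (l * X x))) <=
  m * E (fun x => X x * expR (l * X x)).
Proof.
move=> l0; apply: (@stein _ _ _ unif (fun x => expR (l * x)) (fun x => l * expR (l * x))
  (expR l * l) (l * expR l) (l ^+ 2 * expR l) (1 / (3 * l))).
- exact: measurable_expZ.
- by apply: measurable_funM => //; exact: measurable_expZ.
- move=> x x1; rewrite normrM (gtr0_norm l0) ler_pM2l// ger0_norm ?expR_ge0//.
  exact: exp_le_l.
- by move=> x y x1 y1; exact: exp_lipschitz1.
- exact: etaP.
- by rewrite mulr_ge0 ?expR_ge0// sqr_ge0.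
- move=> x y x1 y1 h; apply: le_trans (exp_increment_ge l0 (eta_le l0 h)).
  rewrite lerD2l lerN2; apply: ler_wpM2r; first exact: exprn_ge0.
  by rewrite ler_wpM2l ?sqr_ge0//; exact: exp_le_l.
Qed.

(** Stein's inequality for [- expR (l * x)] points the other way, and [1 - x_0^2 <= 1]. For the
    moment generating function [M] this is the differential inequality [M' <= (l / m) * M] of a
    Gaussian of variance [1 / m]. *)
Lemma stein_exp_le l : 0 < l ->
  m * E (fun x => X x * expR (l * X x)) <=
  l * E (fun x => expR (l * X x)).
Proof.
move=> l0; have bX := bmf_X; have be := bmf_exp_coord l.
have bXe := bmfM bX be.
have : E (fun x => (1 - X x ^+ 2) * (- (l * expR (l * X x)))) <=
  m * E (fun x => X x * (- expR (l * X x))).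
  apply: (@stein _ _ _ unif (fun x => - expR (l * x)) (fun x => - (l * expR (l * x)))
  (expR l * l) (l * expR l) (l ^+ 2 * expR l) (1 / (3 * l))).
  - by apply: measurable_funN; exact: measurable_expZ.
  - by apply: measurable_funN; apply: measurable_funM => //; exact: measurable_expZ.
  - move=> x x1; rewrite normrN normrM (gtr0_norm l0) ler_pM2l// ger0_norm ?expR_ge0//.
    exact: exp_le_l.
  - by move=> x y x1 y1; rewrite -opprD normrN; exact: exp_lipschitz1.
  - exact: etaP.
  - by rewrite mulr_ge0 ?expR_ge0// sqr_ge0.
  - move=> x y x1 y1 h.
    rewrite -lerN2 (_ : - ((y - x) * _) = (y - x) * (expR (l * y) - expR (l * x))); last by ring.
    apply: le_trans (exp_increment_le l0 (eta_le l0 h)) _.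
    rewrite opprB -[leRHS]addrC mulNr opprK lerD2l.
    apply: ler_wpM2r; first exact: exprn_ge0.
    by rewrite ler_wpM2l ?sqr_ge0//; exact: exp_le_l.
under eq_Ex => x Sx do rewrite mulrN.
rewrite [in leRHS](@eq_Ex _ _ _ _ _ _ (fun x : T => - (X x * expR (l * X x)))); last first.
  by move=> x _; rewrite mulrN.
rewrite !(ExN _ mS)//; last first.
  by apply: bmfM; [apply: bmfB; [exact: bmf_cst|exact: bmfX]|exact: bmfZ].
rewrite mulrN lerN2 => /le_trans; apply.
rewrite -(ExZ _ mS)//; apply: (le_Ex rho mS).
- by apply: bmfM; [apply: bmfB; [exact: bmf_cst|exact: bmfX]|exact: bmfZ].
- exact: bmfZ.
- move=> x Sx; rewrite -[leRHS]mul1r; apply: ler_wpM2r.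
    by rewrite mulr_ge0 ?expR_ge0// ltW.
  by rewrite lerBlDr lerDl sqr_ge0.
Qed.

Lemma flip_coord (f : R -> R) : bmf S (fun x => f (X x)) ->
  E (fun x => f (- X x)) = E (fun x => f (X x)).
Proof.
move=> bf; pose w : T := basis_vec ord0.
have wx (x : T) : dot w x = X x by rewrite dotC dot_basis.
have w1 : X w = 1 by rewrite tnth_mktuple.
have ww : dot w w != 0 by rewrite wx w1 oner_neq0.
rewrite -(Ex_reflection unif ww bf).
by apply: eq_Ex => x Sx; rewrite tnth_mktuple !wx w1; congr f; field.
Qed.

Lemma Ex_X : E (fun x => X x) = 0.
Proof.
by have := flip_coord (f := id) bmf_X; rewrite (ExN _ mS bmf_X) => h; lra.
Qed.

(** An Euler step for [M' <= (l / m) * M], so that nothing is differentiated under the integral; the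
    error is quadratic in [e] because [|x_0| <= 1]. *)
Lemma mgf_step l e : 0 <= l -> 0 < e -> e <= 1 / 3 ->
  E (fun x => expR ((l + e) * X x)) <=
  expR (e * (l / m) + e ^+ 2) * E (fun x => expR (l * X x)).
Proof.
move=> l0 e0 e3; have be := bmf_exp_coord l; have bXe := bmfM bmf_X be.
apply: (@le_trans _ _ (E (fun x => (1 + e ^+ 2) * expR (l * X x) + e * (X x * expR (l * X x))))).
  apply: (le_Ex rho mS).
  - exact: bmf_exp_coord.
  - by apply: bmfD; exact: bmfZ.
  - move=> x Sx; rewrite mulrDl expRD.
    have := sphere_coord ord0 Sx; rewrite ler_norml => /andP[X1 X2].
    have : expR (e * X x) <= 1 + e ^+ 2 + e * X x.
      apply: le_trans (expR_le_quad _) _.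
        by apply: le_trans e3; rewrite -[leRHS]mulr1 ler_pM2l.
      suff : (e * X x) ^+ 2 <= e ^+ 2 by lra.
      rewrite exprMn -[leRHS]mulr1; apply: ler_wpM2l; first exact: sqr_ge0.
      rewrite -subr_ge0 (_ : 1 - _ = (1 - X x) * (1 + X x)); last by ring.
      by apply: mulr_ge0; lra.
    move=> h; apply: le_trans (ler_wpM2l (expR_ge0 _) h) _.
    by rewrite le_eqVlt; apply/orP; left; apply/eqP; ring.
rewrite (ExD _ mS); do ?exact: bmfZ.
rewrite !(ExZ _ mS)//.
set M := E (fun x => expR _).
have M0 : 0 <= M by apply: Ex_ge0 => x _; exact: expR_ge0.
have h : E (fun x => X x * expR (l * X x)) <= l / m * M.
  move: l0; rewrite le_eqVlt => /orP[/eqP l0|l0].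
    rewrite -l0 mul0r mul0r (@eq_Ex _ _ _ _ _ _ (fun x : T => X x)) ?Ex_X// => x _.
    by rewrite mul0r expR0 mulr1.
  by rewrite -(ler_pM2l m0) mulrA mulrCA divff ?lt0r_neq0// mulr1; exact: stein_exp_le.
apply: (@le_trans _ _ ((1 + (e * (l / m) + e ^+ 2)) * M)); last first.
  by apply: ler_wpM2r => //; exact: expR_ge1Dx.
have := ler_wpM2l (ltW e0) h; move: (l / m) (E _) => r K hK.
rewrite [leRHS](_ : _ = (1 + e ^+ 2) * M + e * (r * M)); last by ring.
by rewrite lerD2l.
Qed.

Lemma mgf_bound l : 0 <= l -> E (fun x => expR (l * X x)) <= expR (l ^+ 2 / (2 * m)).
Proof.
move=> l0.
have stp (e : R) k : 0 < e -> e <= 1 / 3 ->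
  E (fun x => expR ((k%:R * e) * X x)) <= expR ((k%:R * e) ^+ 2 / (2 * m) + k%:R * e ^+ 2).
  move=> e0 e3; elim: k => [|k IH].
    rewrite !mul0r expr0n mul0r addr0 expR0.
    rewrite (@eq_Ex _ _ _ _ _ _ (fun x : T => 1)) ?(Ex_cst mS PS)// => x _.
    by rewrite mul0r expR0.
  have -> : k.+1%:R * e = k%:R * e + e :> R by rewrite -natr1; ring.
  apply: le_trans (mgf_step _ e0 e3) _; first by rewrite mulr_ge0// ltW.
  apply: le_trans (ler_wpM2l (expR_ge0 _) IH) _.
  rewrite -expRD ler_expR -natr1.
  rewrite -subr_ge0 [leRHS](_ : _ = e ^+ 2 / (2 * m)); last by field; rewrite lt0r_neq0.
  by rewrite divr_ge0 ?sqr_ge0// mulr_ge0// ltW.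
move: l0; rewrite le_eqVlt => /orP[/eqP <-|l0].
  rewrite (@eq_Ex _ _ _ _ _ _ (fun x : T => 1)) ?(Ex_cst mS PS); last by move=> x _; rewrite mul0r expR0.
  by rewrite expr0n mul0r expR0.
apply: le_expR_lim => e e0.
(* The first summand makes the step [l / N] at most 1/3, the second makes the accumulated error
   [N * (l / N)^2] at most [e]. *)
pose N := (Num.truncn (3 * l + l ^+ 2 / e)).+1.
have Nb : 3 * l + l ^+ 2 / e < N%:R.
  apply: truncnS_gt.
have N0 : 0 < N%:R :> R by rewrite ltr0n.
have le0 : 0 <= l ^+ 2 / e by rewrite divr_ge0 ?sqr_ge0// ltW.
have NE : N%:R * (l / N%:R) = l by rewrite mulrC divfK// lt0r_neq0.
have := @stp (l / N%:R) N; rewrite NE => h; apply: le_trans (h _ _) _.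
- exact: divr_gt0.
- by rewrite ler_pdivrMr//; lra.
- rewrite ler_expR lerD2l expr2 [leLHS](_ : _ = l ^+ 2 / N%:R); last by field; rewrite lt0r_neq0.
  rewrite ler_pdivrMr// mulrC -ler_pdivrMr//; lra.
Qed.

End marginal.

(** * Tails and bands of a coordinate *)

Ltac case_minmax := repeat match goal with
  | |- context [Order.min ?u ?v] => case: (ltP u v) => ?
  | |- context [Order.max ?u ?v] => case: (ltP u v) => ?
  end.

Section scalar.
Context {R : realType}.

Lemma measurable_ge (a : R) : measurable_fun setT (fun x : R => a <= x).
Proof. by apply: measurable_fun_ler => //; exact: measurable_cst. Qed.

Lemma measurable_gt (a : R) : measurable_fun setT (fun x : R => a < x).
Proof. by apply: measurable_fun_ltr => //; exact: measurable_cst. Qed.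

Lemma measurable_le (a : R) : measurable_fun setT (fun x : R => x <= a).
Proof. by apply: measurable_fun_ler => //; exact: measurable_cst. Qed.

Lemma measurable_lt (a : R) : measurable_fun setT (fun x : R => x < a).
Proof. by apply: measurable_fun_ltr => //; exact: measurable_cst. Qed.

Lemma lipschitz_clamp (a b x y : R) : a <= b ->
  `|Num.max a (Num.min x b) - Num.max a (Num.min y b)| <= `|x - y|.
Proof.
move=> ab; wlog xy : x y / x <= y => [hw|].
  by have [/hw//|/ltW/hw] := leP x y; rewrite distrC (distrC x).
rewrite distrC (distrC x) (@ger0_norm _ (y - x)) ?subr_ge0//.
by rewrite ler_norml; case_minmax; apply/andP; split; lra.
Qed.

Lemma measurable_clamp (a b : R) :
  measurable_fun setT (fun x : R => Num.max a (Num.min x b)).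
Proof.
apply: measurable_maxr; first exact: measurable_cst.
by apply: measurable_minr => //; exact: measurable_cst.
Qed.

(** Clamping at [a / 2] rather than [a] leaves a margin: around every point with [|x| > a] the clamp
    is constant, so 0 is an admissible slope there in Stein's inequality. *)
Lemma clamp_eq_far (a x y : R) : 0 < a -> a < `|x| -> `|y - x| <= a / 2 ->
  Num.max (- (a / 2)) (Num.min y (a / 2)) = Num.max (- (a / 2)) (Num.min x (a / 2)).
Proof.
move=> a0; rewrite lter_normr ler_norml => /orP[xa|xa] /andP[h1 h2].
  by rewrite !min_r//; lra.
have aa : - (a / 2) <= a / 2 by lra.
have ya : y <= - (a / 2) by lra.
have {}xa : x <= - (a / 2) by lra.
by rewrite !min_l ?max_l// (le_trans _ aa).
Qed.

Lemma mul_clamp_ge (a x : R) : 0 < a ->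
  a ^+ 2 / 2 * (1 - \I[`|x| <= a]) <= x * Num.max (- (a / 2)) (Num.min x (a / 2)).
Proof.
move=> a0; case: (leP `|x| a) => xa; rewrite ?subrr ?subr0 ?mulr0 ?mulr1.
  by case_minmax; nra.
move: xa; rewrite lter_normr => /orP[xa|xa].
  rewrite min_r; last by lra.
  rewrite max_r; last by lra.
  nra.
rewrite min_l; last by lra.
rewrite max_l; last by lra.
nra.
Qed.

End scalar.

Section tails.
Context {R : realType} {n : nat}.
Local Notation d := n.+2.
Local Notation T := (d.-tuple R).
Variable rho : probability T R.
Hypothesis unif : uniform_sphere rho.
Local Notation S := (sphere R d).
Local Notation E := (Ex rho S).
Local Notation mS := (@measurable_sphere R d).
Local Notation m := (n.+1%:R : R).
Local Notation X x := (@tnth n.+2 R x ord0).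
Let PS : rho S = 1%E. Proof. by case: unif. Qed.
Let m0 : 0 < m. Proof. by rewrite ltr0n. Qed.
Let bX : bmf S (fun x => X x). Proof. exact: bmf_X. Qed.

Lemma sphere_coord_itv (x : T) : S x -> -1 <= X x /\ X x <= 1.
Proof. by move=> /(sphere_coord ord0); rewrite ler_norml => /andP[]. Qed.

Lemma bmf_coord_bool (b : R -> bool) : measurable_fun setT b ->
  bmf S (fun x => \I[b (X x)] : R).
Proof.
move=> mb; apply: bmf_bool; apply: (measurableT_comp mb).
exact: measurable_tnth.
Qed.

Lemma bmf_ge (a : R) : bmf S (fun x => \I[a <= X x] : R).
Proof. exact: (bmf_coord_bool (measurable_ge a)). Qed.

Lemma marginal_tail (s : R) : 0 <= s ->
  E (fun x => \I[s <= X x]) <= expR (- (m * s ^+ 2 / 2)).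
Proof.
move=> s0.
have ms0 : 0 <= m * s by rewrite mulr_ge0// ltW.
apply: (@le_trans _ _ (expR (- (m * s ^+ 2)) * E (fun x => expR ((m * s) * X x)))).
  rewrite -(ExZ _ mS); last exact: bmf_exp_coord.
  apply: (le_Ex rho mS); first exact: bmf_ge.
    by apply: bmfZ; exact: bmf_exp_coord.
  move=> x Sx; rewrite -expRD; case: (leP s (X x)) => [sx|_]; last by rewrite expR_ge0.
  rewrite -[leLHS]expR0 ler_expR.
  have := ler_wpM2l ms0 sx; rewrite expr2; lra.
apply: le_trans (ler_wpM2l (expR_ge0 _) (mgf_bound unif ms0)) _.
rewrite -expRD ler_expR le_eqVlt; apply/orP; left; apply/eqP.
by field; rewrite lt0r_neq0.
Qed.

(** The entropy inequality in elementary form: [expR y >= 1 + y] is used on the cap at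
    [y = la * x_0 - 2 q], with [q = ln (1 / p)]. The rate [la] makes the exponential moment at most
    [expR q = 1 / p], so the exponential term contributes [p] and cancels the [- p] from
    [(2 q - 1) * p]. *)
Lemma partial_mean_le (t p : R) : E (fun x => \I[t <= X x]) = p -> 0 < p -> p < 1 ->
  E (fun x => X x * \I[t <= X x]) <= p * Num.sqrt (2 * ln (1 / p) / m).
Proof.
move=> Ep p0 p1.
have l0 : 0 < ln (1 / p) by rewrite ln_gt0// ltr_pdivlMr// mul1r.
set q := ln (1 / p) in l0 *.
have bI := bmf_ge t; have bXI := bmfM bX bI.
set la := Num.sqrt (2 * m * q).
have la2 : la ^+ 2 = 2 * m * q by rewrite sqr_sqrtr// !mulr_ge0// ltW.
have la0 : 0 < la by rewrite sqrtr_gt0 !mulr_gt0.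
have -> : Num.sqrt (2 * q / m) = 2 * q / la.
  apply/eqP; rewrite -(@eqrXn2 _ 2) ?sqrtr_ge0 ?divr_ge0 ?mulr_ge0 ?ltW//.
  rewrite sqr_sqrtr ?divr_ge0 ?mulr_ge0 ?ltW// expr_div_n la2; apply/eqP; field.
  by rewrite !lt0r_neq0.
rewrite mulrA ler_pdivlMr//.
have h : E (fun x => la * (X x * \I[t <= X x])) <=
   E (fun x => expR (- (2 * q)) * expR (la * X x) + (2 * q - 1) * \I[t <= X x]).
  apply: (le_Ex rho mS); first exact: bmfZ.
    by apply: bmfD; apply: bmfZ => //; exact: bmf_exp_coord.
  move=> x Sx; rewrite -expRD; case: (leP t (X x)) => _; last first.
    by rewrite !mulr0 addr0 expR_ge0.
  by rewrite !mulr1; have := expR_ge1Dx (- (2 * q) + la * X x); lra.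
move: h; rewrite (ExZ _ mS)// (ExD _ mS); [|by apply: bmfZ; exact: bmf_exp_coord|exact: bmfZ].
rewrite !(ExZ _ mS)//; last exact: bmf_exp_coord.
rewrite Ep => h.
have := ler_wpM2l (expR_ge0 (- (2 * q))) (mgf_bound unif (ltW la0)).
rewrite -expRD la2 (_ : - (2 * q) + 2 * m * q / (2 * m) = - q); last first.
  by field; rewrite lt0r_neq0.
have -> : expR (- q) = p by rewrite /q -lnV ?posrE ?divr_gt0// invf_div divr1 lnK.
move: h; move: (E _) (E _) (expR _) => K M e h h2; lra.
Qed.

(** If [t < 0], the symmetry [x_0 -> - x_0] gives the band [|x_0| <= - t] mass [2 p - 1 <= 0]. But a
    band around the equator is never null: Stein's inequality for a clamp would bound the positive
    mean of [x_0] times the clamp by that mass. *)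
Lemma threshold_ge0 (t p : R) : E (fun x => \I[t <= X x]) = p -> p <= 1 / 2 -> 0 <= t.
Proof.
move=> Ep p2; rewrite leNgt; apply/negP => t0.
pose a := - t; have a0 : 0 < a by rewrite oppr_gt0.
have bI := bmf_ge t.
have bA : bmf S (fun x => \I[`|X x| <= a] : R).
  apply: (bmf_coord_bool (b := fun x => `|x| <= a)).
  by apply: measurable_fun_ler => //; exact: measurable_cst.
have A0 : E (fun x => \I[`|X x| <= a]) <= 0.
  have bI' : bmf S (fun x => \I[t <= - X x] : R).
    apply: (bmf_coord_bool (b := fun x => t <= - x)).
    by apply: measurable_fun_ler => //; exact: measurable_cst.
  have e1 : E (fun x => \I[t <= - X x]) = p.
    by rewrite -Ep; apply: (flip_coord unif (f := fun x => \I[t <= x])).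
  have -> : E (fun x => \I[`|X x| <= a]) =
      E (fun x => \I[t <= X x] + \I[t <= - X x] - 1).
    apply: eq_Ex => x _.
    have -> : (`|X x| <= a) = (t <= X x) && (t <= - X x) by rewrite ler_norml /a opprK lerNr.
    by case: (leP t (X x)) => h1; case: (leP t (- X x)) => h2 /=; rewrite ?mulr0n ?mulr1n; lra.
  rewrite (ExB _ mS); [|exact: bmfD|exact: bmf_cst].
  by rewrite (ExD _ mS)// (Ex_cst mS PS) e1 Ep; lra.
pose cl x : R := Num.max (- (a / 2)) (Num.min x (a / 2)).
have aa : - (a / 2) <= a / 2 by lra.
have clE x y : `|cl x - cl y| <= `|x - y| by exact: lipschitz_clamp.
have bcl : bmf S (fun x => cl (X x)).
  apply: (bmf_coord_comp (h := cl)); first exact: measurable_clamp.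
  exists 1 => x x1; have := clE x 0.
  have -> : cl 0 = 0 by rewrite /cl min_l ?max_r// ?oppr_le0 divr_ge0// ltW.
  by rewrite !subr0 => h; exact: le_trans h x1.
have : E (fun x => (1 - X x ^+ 2) * - \I[`|X x| <= a]) <= m * E (fun x => X x * - cl (X x)).
apply: (@stein _ _ _ unif (fun x => - cl x) (fun x => - \I[`|x| <= a]) 1 1 0 (a / 2)).
- by apply: measurable_funN; exact: measurable_clamp.
- have [mb _] : bmf [set: R] (fun x : R => \I[`|x| <= a] : R).
    by apply: bmf_bool; apply: measurable_fun_ler => //; exact: measurable_cst.
  exact: measurable_funN.
- by move=> x _; rewrite normrN; case: (`|x| <= a); rewrite ?normr1 ?normr0.
- by move=> x y _ _; rewrite -opprD normrN mul1r.
- lra.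
- by [].
- move=> x y _ _ h; rewrite mul0r subr0.
  case: (leP `|x| a) => xa; rewrite ?oppr0 ?mul0r ?mulN1r.
    rewrite -opprD mulrN lerN2.
    apply: le_trans (ler_norm _) _; rewrite normrM -[leRHS]real_normK ?num_real// expr2.
    by rewrite ler_wpM2l.
  suff -> : cl y = cl x by rewrite subrr mulr0.
  exact: clamp_eq_far.
have b1X2 : bmf S (fun x => 1 - X x ^+ 2).
  by apply: bmfB; [exact: bmf_cst|exact: bmfX].
rewrite (@eq_Ex _ _ _ _ _ _ (fun x : T => - ((1 - X x ^+ 2) * \I[`|X x| <= a]))); last first.
  by move=> x _; rewrite mulrN.
rewrite [in leRHS](@eq_Ex _ _ _ _ _ _ (fun x : T => - (X x * cl (X x)))); last first.
  by move=> x _; rewrite mulrN.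
rewrite !(ExN _ mS); [|exact: bmfM|exact: bmfM].
rewrite mulrN lerN2; apply/negP; rewrite -ltNge.
apply: (@le_lt_trans _ _ 0).
  apply: le_trans A0; apply: (le_Ex rho mS) => //; first exact: bmfM.
  move=> x Sx; case: (leP `|X x| a) => _; rewrite ?mulr0 ?mulr1//.
  by rewrite lerBlDr lerDl sqr_ge0.
apply: mulr_gt0 => //; apply: (@lt_le_trans _ _ (a ^+ 2 / 2)); first by rewrite divr_gt0// exprn_gt0.
apply: (@le_trans _ _ (E (fun x => a ^+ 2 / 2 * (1 - \I[`|X x| <= a])))).
  rewrite (ExZ _ mS); last by apply: bmfB => //; exact: bmf_cst.
  rewrite (ExB _ mS)//; last exact: bmf_cst.
  by rewrite (Ex_cst mS PS) -[leLHS]mulr1 ler_wpM2l ?divr_ge0 ?sqr_ge0//; lra.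
apply: (le_Ex rho mS); [by apply: bmfZ; apply: bmfB => //; exact: bmf_cst|exact: bmfM|].
by move=> x Sx; exact: mul_clamp_ge.
Qed.

End tails.

(** The pointwise estimate for [cap_mass_gt0], with [f], [e], [g] standing for [expR (- b)],
    [expR (b * x)], [expR b]. Below [c] the weight [b * (1 - x^2) - m * x] is at least 1; above [c]
    the crude bound [- m] is enough. *)
Lemma exp_weight_ge {R : realFieldType} (m b c x e f g : R) : 1 <= m -> 0 < b -> 1 <= b ->
  0 <= c -> m * c + 1 <= b * (1 - c ^+ 2) -> -1 <= x -> x <= 1 ->
  0 < f -> f <= e -> e <= g ->
  f - (m + 1) * g * \I[c <= x] <= (1 - x ^+ 2) * (b * e) - m * (x * e).
Proof.
move=> m1 b0 b1 c0 bc X1 X2 f0 fe eg; have m0 : 0 < m by exact: lt_le_trans m1.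
have X2' : x ^+ 2 <= 1.
  rewrite -subr_ge0 (_ : 1 - _ = (1 - x) * (1 + x)); last by ring.
  by apply: mulr_ge0; lra.
rewrite (_ : (1 - _) * _ - _ = (b * (1 - x ^+ 2) - m * x) * e); last by ring.
case: (leP c x) => cX; rewrite ?mulr0 ?mulr1 ?subr0.
  have h1 : - (m * e) <= (b * (1 - x ^+ 2) - m * x) * e.
    rewrite -mulNr; apply: ler_wpM2r; first by lra.
    have : 0 <= b * (1 - x ^+ 2) by apply: mulr_ge0; lra.
    have : m * x <= m by rewrite -[leRHS]mulr1 ler_pM2l.
    lra.
  have : m * e <= m * g by rewrite ler_pM2l.
  lra.
apply: (le_trans fe); rewrite -[leLHS]mul1r; apply: ler_wpM2r; first by lra.
have [X0|X0] := leP 0 x.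
  have h1 : m * x <= m * c by rewrite ler_pM2l// ltW.
  have h2 : b * (1 - c ^+ 2) <= b * (1 - x ^+ 2).
    rewrite ler_pM2l// lerD2l lerN2 !expr2; apply: ler_pM; lra.
  lra.
have h1 : - x <= - (m * x).
  have : 0 <= (m - 1) * - x by apply: mulr_ge0; [rewrite subr_ge0|lra].
  by rewrite mulrBl mul1r mulrN opprK; lra.
have h2 : 1 - x ^+ 2 <= b * (1 - x ^+ 2).
  by rewrite -[leLHS]mul1r; apply: ler_wpM2r; lra.
have h3 : 0 <= - x * (1 + x) by apply: mulr_ge0; lra.
rewrite mulrDr mulr1 mulNr -expr2 in h3; lra.
Qed.

Section caps.
Context {R : realType} {n : nat}.
Local Notation d := n.+2.
Local Notation T := (d.-tuple R).
Variable rho : probability T R.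
Hypothesis unif : uniform_sphere rho.
Local Notation S := (sphere R d).
Local Notation E := (Ex rho S).
Local Notation mS := (@measurable_sphere R d).
Local Notation m := (n.+1%:R : R).
Local Notation X x := (@tnth n.+2 R x ord0).
Let PS : rho S = 1%E. Proof. by case: unif. Qed.
Let m1 : 1 <= m. Proof. by rewrite ler1n. Qed.
Let m0 : 0 < m. Proof. by rewrite ltr0n. Qed.
Let bX : bmf S (fun x => X x). Proof. exact: bmf_X. Qed.
Let b1X2 : bmf S (fun x => 1 - X x ^+ 2).
Proof. by apply: bmfB; [exact: bmf_cst|exact: bmfX]. Qed.

(* Stein's inequality for [expR (b * x)] fails for large [b] if all the mass lies
   below [c]. *)
Lemma cap_mass_gt0 (c : R) : 0 <= c -> c < 1 -> 0 < E (fun x => \I[c <= X x]).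
Proof.
move=> c0 c1; rewrite ltNge; apply/negP => Ec.
have c2 : 0 < 1 - c ^+ 2.
  by rewrite (_ : 1 - _ = (1 - c) * (1 + c)); [apply: mulr_gt0; lra|ring].
pose b : R := 1 + (m * c + 1) / (1 - c ^+ 2).
have mc0 : 0 <= m * c by rewrite mulr_ge0// ltW.
have q0 : 0 <= (m * c + 1) / (1 - c ^+ 2) by rewrite divr_ge0 ?ltW//; lra.
have b1 : 1 <= b by rewrite /b lerDl.
have bc : m * c + 1 <= b * (1 - c ^+ 2).
  rewrite /b mulrDl mul1r divfK ?lt0r_neq0//; lra.
clearbody b; have b0 : 0 < b by lra.
have be : bmf S (fun x => expR (b * X x)) := bmf_exp_coord b; have bXe := bmfM bX be.
have st := stein_exp_ge unif b0.
have be' : bmf S (fun x => (1 - X x ^+ 2) * (b * expR (b * X x))).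
  by apply: bmfM => //; exact: bmfZ.
have : E (fun x => expR (- b) - (m + 1) * expR b * \I[c <= X x]) <=
   E (fun x => (1 - X x ^+ 2) * (b * expR (b * X x)) - m * (X x * expR (b * X x))).
  apply: (le_Ex rho mS).
  - by apply: bmfB; [exact: bmf_cst|apply: bmfZ; exact: bmf_ge].
  - by apply: bmfB => //; exact: bmfZ.
  move=> x Sx; have [X1 X2] := sphere_coord_itv Sx.
  have e1 : expR (- b) <= expR (b * X x).
    by rewrite ler_expR -mulrN1 ler_pM2l.
  have e2 : expR (b * X x) <= expR b by rewrite ler_expR -[leRHS]mulr1 ler_pM2l.
  have e0 := expR_gt0 (- b).
  exact: exp_weight_ge.
have bI : bmf S (fun x => \I[c <= X x] : R) := bmf_ge c.
rewrite (ExB _ mS); [|exact: bmf_cst|exact: bmfZ].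
rewrite (ExB _ mS); [|by []|exact: bmfZ].
rewrite (Ex_cst mS PS) !(ExZ _ mS)//.
have e0 := expR_gt0 (- b).
have : 0 <= (m + 1) * expR b * - E (fun x => \I[c <= X x]).
  by apply: mulr_ge0; [apply: mulr_ge0; [exact: addr_ge0|exact: expR_ge0]|rewrite oppr_ge0].
lra.
Qed.

(* Stein's inequality for the hinge function with corner at [(1 + c) / 2]. *)
Lemma cap_variance_ge (c : R) : 0 <= c -> c < 1 ->
  (1 - c) / 4 * E (fun x => \I[c <= X x]) <=
  E (fun x => (1 - X x ^+ 2) * \I[c <= X x]).
Proof.
(* With the corner strictly above [c], the hinge vanishes near every point below [c]; the margin
   [c' - c] serves as [eta]. *)
move=> c0 c1; pose c' := (1 + c) / 2.
have cc' : c < c' by rewrite /c'; lra.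
have bI : bmf S (fun x => \I[c <= X x] : R) := bmf_ge c.
pose h x : R := Num.max (x - c') 0.
have hl x y : `|h x - h y| <= `|x - y|.
  rewrite /h; wlog xy : x y / x <= y => [hw|].
    by have [/hw//|/ltW/hw] := leP x y; rewrite distrC (distrC x).
  rewrite distrC (distrC x) (@ger0_norm _ (y - x)) ?subr_ge0//.
  by rewrite ler_norml; case_minmax; apply/andP; split; lra.
have mh : measurable_fun setT h.
  apply: measurable_maxr; last exact: measurable_cst.
  by apply: measurable_funB => //; exact: measurable_cst.
have bh : bmf S (fun x => h (X x)).
  apply: (bmf_coord_comp (h := h)) => //; exists 1 => x x1; have := hl x 0.
  have -> : h 0 = 0 by rewrite /h; case_minmax; lra.
  by rewrite !subr0 => h'; exact: le_trans h' x1.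
have st : E (fun x => (1 - X x ^+ 2) * - \I[c <= X x]) <= m * E (fun x => X x * - h (X x)).
  apply: (@stein _ _ _ unif (fun x => - h x) (fun x => - \I[c <= x]) 1 1 0 (c' - c)).
  - exact: measurable_funN.
  - have [mb _] : bmf [set: R] (fun x : R => \I[c <= x] : R).
      by apply: bmf_bool; exact: measurable_ge.
    exact: measurable_funN.
  - by move=> x _; rewrite normrN; case: (c <= x); rewrite ?normr1 ?normr0.
  - by move=> x y _ _; rewrite -opprD normrN mul1r.
  - lra.
  - by [].
  - move=> x y _ _ hxy; rewrite mul0r subr0.
    case: (leP c x) => xc; rewrite ?oppr0 ?mul0r ?mulN1r.
      rewrite -opprD mulrN lerN2.
      apply: le_trans (ler_norm _) _; rewrite normrM -[leRHS]real_normK ?num_real// expr2.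
      by rewrite ler_wpM2l.
    suff -> : h y = h x by rewrite subrr mulr0.
    move: hxy; rewrite /h ler_norml => /andP[h1 h2].
    by case_minmax; lra.
have bXI : bmf S (fun x => X x * h (X x)) by exact: bmfM.
have bI2 : bmf S (fun x => (1 - X x ^+ 2) * \I[c <= X x]) by exact: bmfM.
have {}st : m * E (fun x => X x * h (X x)) <= E (fun x => (1 - X x ^+ 2) * \I[c <= X x]).
  move: st; rewrite (@eq_Ex _ _ _ _ _ _ (fun x : T => - ((1 - X x ^+ 2) * \I[c <= X x]))); last first.
    by move=> x _; rewrite mulrN.
  rewrite [in leRHS](@eq_Ex _ _ _ _ _ _ (fun x : T => - (X x * h (X x)))); last first.
    by move=> x _; rewrite mulrN.
  by rewrite !(ExN _ mS)// mulrN lerN2.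
have Xh0 : 0 <= E (fun x => X x * h (X x)).
  apply: Ex_ge0 => x Sx; rewrite /h; case_minmax; rewrite ?mulr0//.
  by apply: mulr_ge0; lra.
have h1 : E (fun x => X x * h (X x)) <= m * E (fun x => X x * h (X x)).
  by rewrite -[leLHS]mul1r; apply: ler_wpM2r.
(* On the cap [x * h x >= x^2 - c'], so the two terms add up to at least [1 - c' = (1 - c) / 2].
   Stein's inequality bounds the mean of [x * h x] by that of the other term, which halves the
   constant once more. *)
have : E (fun x => (1 - c') * \I[c <= X x]) <=
   E (fun x => (1 - X x ^+ 2) * \I[c <= X x] + X x * h (X x)).
  apply: (le_Ex rho mS); [exact: bmfZ|exact: bmfD|].
  move=> x Sx; have [X1 X2] := sphere_coord_itv Sx.
  have hX : X x - c' <= h (X x) by rewrite /h; case_minmax; lra.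
  have h0 : 0 <= h (X x) by rewrite /h; case_minmax; lra.
  case: (leP c (X x)) => cX; rewrite ?mulr0 ?mulr1 ?add0r; last first.
    move: h0; rewrite /h; case_minmax; rewrite ?mulr0//; lra.
  have : X x * (X x - c') <= X x * h (X x) by apply: ler_wpM2l => //; lra.
  have : X x * c' <= 1 * c' by apply: ler_wpM2r => //; rewrite /c'; lra.
  rewrite mulrBr -expr2; lra.
rewrite (ExZ _ mS)// (ExD _ mS)//.
rewrite /c' => h2; have h3 := le_trans h1 st.
move: h2 h3; set u := E _; set v := E _; set w := E _; clearbody u v w; lra.
Qed.

End caps.

(** For [0 <= x < t] the weight exceeds its value at [t], which is [(1 - t^2) / u]. For negative [x]
    on the band, [- m * x] makes up for the loss in [1 - x^2], since [- x * (u + x) >= 0]. *)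
Lemma upper_band_weight {R : realFieldType} (m t u x : R) (b := m * t / (1 - t ^+ 2) + u^-1) :
  1 <= m -> 0 <= t -> t < 1 -> 0 < u -> -1 <= x -> x < t ->
  0 <= b * (1 - x ^+ 2) - m * x /\
  (t - u <= x -> (1 - t ^+ 2) / u <= b * (1 - x ^+ 2) - m * x).
Proof.
move=> m1 t0 t1 u0 x1 xt.
have t2 : 0 < 1 - t ^+ 2.
  by rewrite (_ : 1 - _ = (1 - t) * (1 + t)); [apply: mulr_gt0; lra|ring].
have x2 : 0 <= 1 - x ^+ 2.
  by rewrite (_ : 1 - _ = (1 - x) * (1 + x)); [apply: mulr_ge0; lra|ring].
have ui : 0 < u^-1 by rewrite invr_gt0.
have ub : u^-1 <= b by rewrite lerDr divr_ge0 ?mulr_ge0//; lra.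
have b0 : 0 < b by exact: lt_le_trans ub.
have bE : b * (1 - t ^+ 2) = m * t + (1 - t ^+ 2) / u.
  by rewrite /b; field; rewrite !lt0r_neq0.
have [x0|x0] := leP 0 x.
  have hx : b * (1 - t ^+ 2) <= b * (1 - x ^+ 2).
    by rewrite ler_pM2l// lerD2l lerN2 !expr2; apply: ler_pM => //; exact: ltW.
  have hm : m * x <= m * t by rewrite ler_wpM2l//; lra.
  have : 0 < (1 - t ^+ 2) / u by rewrite divr_gt0.
  by clearbody b; split; lra.
have h2 : 0 <= (m - 1) * - x by apply: mulr_ge0; lra.
have h3 : u^-1 * (1 - x ^+ 2) <= b * (1 - x ^+ 2) by exact: ler_wpM2r.
have h4 : 0 <= u^-1 * (1 - x ^+ 2) by rewrite mulr_ge0// ltW.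
clear bE; clearbody b; split; first by lra.
move=> tu; apply: (@le_trans _ _ u^-1).
  by rewrite mulrC -[leRHS]mulr1 ler_pM2l// lerBlDr lerDl sqr_ge0.
rewrite -(ler_pM2l u0) divff ?lt0r_neq0//.
have h5 : u * (u^-1 * (1 - x ^+ 2)) = 1 - x ^+ 2 by rewrite mulrA divff ?mul1r// lt0r_neq0.
have h6 : u * (u^-1 * (1 - x ^+ 2) - x) <= u * (b * (1 - x ^+ 2) - m * x).
  by rewrite ler_pM2l//; lra.
apply: le_trans h6; rewrite mulrBr h5.
have : 0 <= - x * (u + x) by apply: mulr_ge0; lra.
rewrite expr2; lra.
Qed.

Section bands.
Context {R : realType} {n : nat}.
Local Notation d := n.+2.
Local Notation T := (d.-tuple R).
Variable rho : probability T R.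
Hypothesis unif : uniform_sphere rho.
Local Notation S := (sphere R d).
Local Notation E := (Ex rho S).
Local Notation mS := (@measurable_sphere R d).
Local Notation m := (n.+1%:R : R).
Local Notation X x := (@tnth n.+2 R x ord0).
Let PS : rho S = 1%E. Proof. by case: unif. Qed.
Let m1 : 1 <= m. Proof. by rewrite ler1n. Qed.
Let m0 : 0 < m. Proof. by rewrite ltr0n. Qed.
Let bX : bmf S (fun x => X x). Proof. exact: bmf_X. Qed.
Let b1X2 : bmf S (fun x => 1 - X x ^+ 2).
Proof. by apply: bmfB; [exact: bmf_cst|exact: bmfX]. Qed.

(* Stein's inequality for [expR (b * (min x t' - t'))].  The rate [b] is the sum of
   [m * t / (1 - t^2)], which makes the weight [b * (1 - x^2) - m * x] nonnegative
   below [t], and of [u^-1]; the constant 12 bounds [expR 2]. *)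
Lemma upper_band (t u : R) : 0 <= t -> t < 1 -> 0 < u ->
  E (fun x => \I[(t - u <= X x) && (X x < t)]) <=
  12 * u * m / (1 - t ^+ 2) * expR (m * t * u / (1 - t ^+ 2)) *
    E (fun x => X x * \I[t <= X x]).
Proof.
move=> t0 t1 u0.
have t2 : 0 < 1 - t ^+ 2.
  by rewrite (_ : 1 - _ = (1 - t) * (1 + t)); [apply: mulr_gt0; lra|ring].
pose r := m * t / (1 - t ^+ 2).
have r0 : 0 <= r by apply: divr_ge0; [apply: mulr_ge0 => //; exact: ltW|exact: ltW].
have rE : r * (1 - t ^+ 2) = m * t by rewrite divfK// lt0r_neq0.
pose b := r + u^-1.
have ui : 0 < u^-1 by rewrite invr_gt0.
have b0 : 0 < b by rewrite /b; lra.
have bu : b * u = r * u + 1 by rewrite /b mulrDl mulVf// lt0r_neq0.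
(* Saturation starts [1 / b] beyond [t], so that increments of length at most [1 / (3 b)] from a
   point below [t] stay in the exponential range. *)
pose t' := t + b^-1; have bi : 0 < b^-1 by rewrite invr_gt0.
have bbi : b * b^-1 = 1 by rewrite mulfV// lt0r_neq0.
pose h x : R := expR (b * (Num.min x t' - t')).
pose q x : R := b * expR (b * (x - t')) * \I[x < t].
have h1 x : h x <= 1.
  rewrite /h -[leRHS]expR0 ler_expR pmulr_rle0//; case_minmax; lra.
have mexp : measurable_fun setT (fun x : R => expR (b * (x - t'))).
  apply: measurableT_comp => //; apply: measurable_funM; first exact: measurable_cst.
  by apply: measurable_funB => //; exact: measurable_cst.
have mh : measurable_fun setT h.
  apply: measurableT_comp => //; apply: measurable_funM; first exact: measurable_cst.
  apply: measurable_funB; last exact: measurable_cst.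
  by apply: measurable_minr => //; exact: measurable_cst.
have [mlt _] : bmf [set: R] (fun x : R => \I[x < t] : R).
  by apply: bmf_bool; exact: measurable_lt.
have mq : measurable_fun setT q.
  apply: measurable_funM => //; apply: measurable_funM => //; exact: measurable_cst.
have expb (x : R) : x <= 1 -> expR (b * (x - t')) <= expR b.
  move=> x1; rewrite ler_expR -[leRHS]mulr1 ler_pM2l// /t'; lra.
have qB x : `|x| <= 1 -> `|q x| <= b * expR b.
  move=> /ler_normlP[_ x1]; rewrite /q; case: (x < t); rewrite ?mulr0 ?mulr1 ?normr0.
    by rewrite normrM (gtr0_norm b0) ger0_norm ?expR_ge0// ler_pM2l// expb.
  by apply: mulr_ge0; [exact: ltW|exact: expR_ge0].
have hl x y : `|x| <= 1 -> `|y| <= 1 -> `|h x - h y| <= b * `|x - y|.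
  move=> _ _; rewrite /h.
  apply: le_trans (@exp_lipschitz _ 0 _ _ _ _) _.
  - rewrite pmulr_rle0//; case_minmax; lra.
  - rewrite pmulr_rle0//; case_minmax; lra.
  rewrite expR0 mul1r -mulrBr normrM (gtr0_norm b0) ler_pM2l//.
  have := @lipschitz_clamp _ (- `|x| - `|y| - `|t'|) t' x y.
  have t'N : - `|x| - `|y| - `|t'| <= t'.
    have := ler_norm (- t'); rewrite normrN; have := normr_ge0 x; have := normr_ge0 y; lra.
  move=> /(_ t'N).
  have e (z : R) : - `|x| - `|y| - `|t'| <= z ->
      Num.max (- `|x| - `|y| - `|t'|) (Num.min z t') = Num.min z t'.
    by move=> zl; apply/max_idPr; rewrite le_min zl t'N.
  have nx := ler_norm (- x); have ny := ler_norm (- y); rewrite !normrN in nx ny.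
  have nt := normr_ge0 t'; have nx0 := normr_ge0 x; have ny0 := normr_ge0 y.
  rewrite !e; [|lra|lra].
  by rewrite opprB addrA subrK.
pose L := b ^+ 2 * expR b.
have L0 : 0 <= L by rewrite mulr_ge0 ?sqr_ge0 ?expR_ge0.
have hmono x y : x <= y -> h x <= h y.
  by move=> xy; rewrite /h ler_expR ler_pM2l// lerD2r le_min2.
have st : E (fun x => (1 - X x ^+ 2) * q (X x)) <= m * E (fun x => X x * h (X x)).
  apply: (@stein _ _ _ unif h q b (b * expR b) L (1 / 3 * b^-1)) => //.
  - by rewrite mulr_gt0.
  move=> x y x1 y1 hxy; rewrite /q.
  case: (ltP x t) => xt; rewrite ?mulr0 ?mulr1 ?mul0r.
    have b3 : `|b * (y - x)| <= 1 / 3.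
      rewrite normrM (gtr0_norm b0); apply: le_trans (ler_wpM2l (ltW b0) hxy) _.
      by rewrite mulrCA bbi mulr1.
    have yt : y <= t'.
      have : y - x <= 1 / 3 * b^-1 by exact: le_trans (ler_norm _) hxy.
      rewrite /t'; lra.
    have xt' : x <= t' by rewrite /t'; lra.
    rewrite /h (min_idPl yt) (min_idPl xt').
    have eE (z : R) : expR (b * (z - t')) = expR (b * z) * expR (- (b * t')).
      by rewrite mulrBr expRD.
    rewrite !eE -mulrBl.
    have := exp_increment_ge b0 b3.
    have e0 := expR_gt0 (- (b * t')).
    rewrite -(ler_pM2r e0) => hh.
    rewrite (_ : (y - x) * ((expR (b * y) - expR (b * x)) * expR (- (b * t'))) =
      (y - x) * (expR (b * y) - expR (b * x)) * expR (- (b * t'))); last by ring.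
    apply: le_trans hh.
    have LL : b ^+ 2 * (expR (b * x) * expR (- (b * t'))) * `|y - x| ^+ 3 <= L * `|y - x| ^+ 3.
      apply: ler_wpM2r; first exact: exprn_ge0.
      rewrite /L -eE; apply: ler_wpM2l; first exact: sqr_ge0.
      by apply: expb; case/ler_normlP: x1.
    rewrite -subr_ge0 (_ : _ - _ = L * `|y - x| ^+ 3 -
      b ^+ 2 * (expR (b * x) * expR (- (b * t'))) * `|y - x| ^+ 3); last by ring.
    by rewrite subr_ge0.
  rewrite add0r; apply: (@le_trans _ _ 0).
    by rewrite oppr_le0 mulr_ge0// exprn_ge0.
  have [xy|yx] := leP x y.
    by rewrite mulr_ge0 ?subr_ge0 ?hmono.
  by rewrite -mulrNN mulr_ge0// oppr_ge0 subr_le0 ?hmono// ltW.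
have bh : bmf S (fun x => h (X x)).
  apply: (bmf_coord_comp (h := h)) => //; exists 1 => x x1.
  by rewrite ger0_norm ?expR_ge0.
have bq : bmf S (fun x => q (X x)).
  by apply: (bmf_coord_comp (h := q)) => //; exists (b * expR b).
have bI : bmf S (fun x => \I[t <= X x] : R) := bmf_ge t; have bXI := bmfM bX bI; have bXh := bmfM bX bh.
have bbd : bmf S (fun x => \I[(t - u <= X x) && (X x < t)] : R).
  apply: (bmf_coord_bool (b := fun x => (t - u <= x) && (x < t))).
  exact: (measurable_and (measurable_ge _) (measurable_lt _)).
have bw : bmf S (fun x => (1 - X x ^+ 2) * q (X x)) by exact: bmfM.
(* On the band the weight is at least [(1 - t^2) / u], and [h] is smallest at [t - u], where its
   exponent is [- (b * u + 1) = - r * u - 2]; this is the origin of [expR 2]. *)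
pose k := (1 - t ^+ 2) / u * expR (- (b * u + 1)).
have : E (fun x => k * \I[(t - u <= X x) && (X x < t)]) <=
  E (fun x => (1 - X x ^+ 2) * q (X x) - m * (X x * h (X x)) + m * (X x * \I[t <= X x])).
  apply: (le_Ex rho mS); first exact: bmfZ.
    by apply: bmfD; [apply: bmfB => //; exact: bmfZ|exact: bmfZ].
  move=> x Sx; have [X1 X2] := sphere_coord_itv Sx; rewrite /q.
  case: (ltP (X x) t) => tX; rewrite ?andbF ?andbT ?mulr0 ?mulr1 ?addr0 ?add0r; last first.
    have hx : X x * h (X x) <= X x.
      by rewrite -[leRHS]mulr1; apply: ler_wpM2l; [lra|exact: h1].
    have : m * (X x * h (X x)) <= m * X x by rewrite ler_pM2l.
    lra.
  have Xt' : X x <= t' by rewrite /t'; lra.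
  rewrite /h (min_idPl Xt').
  rewrite [leRHS](_ : _ = (b * (1 - X x ^+ 2) - m * X x) * expR (b * (X x - t'))); last by ring.
  have e0 := expR_gt0 (b * (X x - t')).
  have X2' : 0 <= 1 - X x ^+ 2.
    rewrite (_ : 1 - _ = (1 - X x) * (1 + X x)); last by ring.
    by apply: mulr_ge0; lra.
  have [c0 c1] := upper_band_weight m1 t0 t1 u0 X1 tX.
  case: (leP (t - u) (X x)) => tu /=; rewrite ?mulr0 ?mulr1; last first.
    by rewrite mulr_ge0// ltW.
  rewrite /k; apply: ler_pM; [by apply: divr_ge0; exact: ltW|exact: expR_ge0|exact: c1|].
  rewrite ler_expR /t' -subr_ge0 (_ : _ - _ = b * (X x - (t - u)) + (1 - b * b^-1)); last by ring.
  by rewrite bbi subrr addr0; apply: mulr_ge0; [exact: ltW|rewrite subr_ge0].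
rewrite (ExZ _ mS)// (ExD _ mS); [|by apply: bmfB => //; exact: bmfZ|exact: bmfZ].
rewrite (ExB _ mS)//; last exact: bmfZ.
rewrite !(ExZ _ mS)//.
set P := E (fun x => \I[_]); set K := E (fun x => X x * \I[_]) => hk.
have k0 : 0 < k by rewrite mulr_gt0 ?expR_gt0 ?divr_gt0.
have {}hk : k * P <= m * K by lra.
have K0 : 0 <= K.
  apply: Ex_ge0 => x Sx; case: (leP t (X x)) => h'; rewrite ?mulr0// mulr1; exact: le_trans h'.
rewrite -(ler_pM2l k0); apply: le_trans hk _.
rewrite (_ : m * t * u / (1 - t ^+ 2) = r * u); last by rewrite /r; ring.
rewrite /k bu (_ : - (r * u + 1 + 1) = - (r * u) - 2); last by ring.
rewrite expRD [leRHS](_ : _ = (expR (- (r * u)) * expR (r * u)) * (12 * expR (-2)) * (m * K)); last first.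
  by field; rewrite !lt0r_neq0.
rewrite -expRD addNr expR0 mul1r -[leLHS]mul1r.
apply: ler_wpM2r; first by apply: mulr_ge0 => //; exact: ltW.
have h9 : expR (1 : R) ^+ 2 <= 12.
  have h3 : expR (- (1 / 3)) >= 2 / 3 :> R by apply: le_trans (expR_ge1Dx _); lra.
  have e3 : expR (1 : R) * expR (- (1 / 3)) ^+ 3 = 1.
    by rewrite -expRM_natl -expRD -[RHS]expR0; congr expR; field.
  have e0 := expR_gt0 (1 : R).
  have : (2 / 3) ^+ 3 <= expR (- (1 / 3)) ^+ 3 :> R by rewrite lerXn2r ?nnegrE ?expR_ge0//; lra.
  rewrite -(ler_pM2l e0) e3 => h4.
  have h5 : expR 1 <= 27 / 8 :> R by lra.
  apply: (@le_trans _ _ ((27 / 8) ^+ 2)); last by lra.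
  by rewrite lerXn2r ?nnegrE ?expR_ge0//; lra.
have e2 : expR (- 2) * expR (1 : R) ^+ 2 = 1.
  by rewrite expr2 -!expRD -[RHS]expR0; congr expR; ring.
rewrite -[leLHS]e2 [leLHS]mulrC; apply: ler_wpM2r => //; exact: expR_ge0.
Qed.

End bands.

Section transfer.
Context {R : realType} {n : nat}.
Local Notation d := n.+2.
Local Notation T := (d.-tuple R).
Variable rho : probability T R.
Hypothesis unif : uniform_sphere rho.
Local Notation S := (sphere R d).
Local Notation E := (Ex rho S).
Local Notation mS := (@measurable_sphere R d).
Local Notation m := (n.+1%:R : R).
Local Notation X x := (@tnth n.+2 R x ord0).
Let PS : rho S = 1%E. Proof. by case: unif. Qed.
Let m0 : 0 < m. Proof. by rewrite ltr0n. Qed.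
Let bX : bmf S (fun x => X x). Proof. exact: bmf_X. Qed.
Let b1X2 : bmf S (fun x => 1 - X x ^+ 2).
Proof. by apply: bmfB; [exact: bmf_cst|exact: bmfX]. Qed.

(* Stein's inequality for a ramp of slope 1 across the band, widened by [e] at both
   ends. *)
Lemma lower_band (t u : R) : 0 <= t -> 0 < u -> t + u < 1 ->
  (1 - (t + u) ^+ 2) * E (fun x => \I[(t <= X x) && (X x <= t + u)]) <=
  m * u * E (fun x => X x * \I[t <= X x]).
Proof.
move=> t0 u0 tu1; set K := E (fun x => X x * _).
have bI : bmf S (fun x => \I[t <= X x] : R) := bmf_ge t; have bXI := bmfM bX bI.
have bbd : bmf S (fun x => \I[(t <= X x) && (X x <= t + u)] : R).
  apply: (bmf_coord_bool (b := fun x => (t <= x) && (x <= t + u))).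
  exact: (measurable_and (measurable_ge _) (measurable_le _)).
have K1 : K <= 1.
  rewrite -[leRHS](Ex_cst mS PS); apply: (le_Ex rho mS) => //; first exact: bmf_cst.
  move=> x Sx; have [X1 X2] := sphere_coord_itv Sx.
  by case: (t <= X x); rewrite ?mulr0 ?mulr1.
(* The widening keeps the slope equal to 1 within distance [e] of every point of the closed band, as
   the parameter [eta] of [stein] requires. Its cost vanishes with [e], since [K <= 1]. *)
suff main e : 0 < e ->
    (1 - (t + u) ^+ 2) * E (fun x => \I[(t <= X x) && (X x <= t + u)]) <=
    m * ((u + 2 * e) * K + e).
  apply/ler_addgt0Pr => e e0.
  have e1 : 0 < e / (3 * m) by rewrite divr_gt0// mulr_gt0.
  apply: le_trans (main _ e1) _.
  have -> : m * ((u + 2 * (e / (3 * m))) * K + e / (3 * m)) =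
    m * u * K + (2 * K + 1) / 3 * e by field; rewrite lt0r_neq0.
  rewrite lerD2l -[leRHS]mul1r; apply: ler_wpM2r; [exact: ltW|lra].
move=> e0; pose h x : R := Num.max 0 (Num.min (x - (t - e)) (u + 2 * e)).
have ue : 0 <= u + 2 * e by lra.
have hid x : t - e <= x -> x <= t + u + e -> h x = x - (t - e).
  by move=> tx xt; rewrite /h min_l ?max_r//; lra.
have hl x y : `|h x - h y| <= `|x - y|.
  apply: le_trans (lipschitz_clamp _ _ ue) _.
  by have -> : x - (t - e) - (y - (t - e)) = x - y by ring.
have hmono x y : x <= y -> h x <= h y.
  by move=> xy; apply: le_max2 => //; apply: le_min2 => //; rewrite lerD2r.
have mh : measurable_fun setT h.
  apply: measurable_maxr; first exact: measurable_cst.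
  apply: measurable_minr; last exact: measurable_cst.
  by apply: measurable_funB => //; exact: measurable_cst.
pose q x : R := \I[(t <= x) && (x <= t + u)].
have mq : measurable_fun setT q.
  have [mb _] : bmf [set: R] q; last by [].
  apply: bmf_bool; exact: (measurable_and (measurable_ge _) (measurable_le _)).
have hB x : 0 <= h x <= u + 2 * e.
  by rewrite le_max lexx ge_max ue ge_min lexx orbT.
have bh : bmf S (fun x => h (X x)).
  apply: (bmf_coord_comp (h := h)) => //; exists (u + 2 * e) => x x1.
  by have /andP[h0 h1] := hB x; rewrite ger0_norm.
have : E (fun x => (1 - X x ^+ 2) * q (X x)) <= m * E (fun x => X x * h (X x)).
  apply: (@stein _ _ _ unif h q 1 1 0 e) => //.
  - by move=> x _; rewrite /q; case: (_ && _); rewrite ?normr1 ?normr0.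
  - by move=> x y _ _; rewrite mul1r.
  move=> x y _ _; rewrite mul0r subr0 /q => xy.
  case: (leP t x) => tx /=; last first.
    rewrite mul0r; have [le_xy|yx] := leP x y.
      by apply: mulr_ge0; rewrite subr_ge0 ?hmono.
    by rewrite -mulrNN; apply: mulr_ge0; rewrite oppr_ge0 subr_le0 ?hmono// ltW.
  case: (leP x (t + u)) => xu /=; last first.
    rewrite mul0r; have [le_xy|yx] := leP x y.
      by apply: mulr_ge0; rewrite subr_ge0 ?hmono.
    by rewrite -mulrNN; apply: mulr_ge0; rewrite oppr_ge0 subr_le0 ?hmono// ltW.
  rewrite mul1r; suff -> : h y - h x = y - x by rewrite expr2.
  move: xy; rewrite ler_norml => /andP[xy1 xy2].
  by rewrite !hid; lra.
move=> st.
apply: (@le_trans _ _ (E (fun x => (1 - X x ^+ 2) * q (X x)))).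
  rewrite -(ExZ _ mS)//; apply: (le_Ex rho mS); [exact: bmfZ|exact: bmfM|].
  move=> x Sx; rewrite /q.
  case: (leP t (X x)) => tx /=; rewrite ?mulr0//.
  case: (leP (X x) (t + u)) => xu /=; rewrite ?mulr0 ?mulr1//.
  rewrite lerD2l lerN2 !expr2; have X0 := le_trans t0 tx; exact: ler_pM.
apply: le_trans st _; rewrite ler_pM2l//.
have -> : (u + 2 * e) * K + e = E (fun x => (u + 2 * e) * (X x * \I[t <= X x]) + e).
  by rewrite (ExD _ mS); [rewrite (ExZ _ mS)// (Ex_cst mS PS)|exact: bmfZ|exact: bmf_cst].
apply: (le_Ex rho mS); [exact: bmfM|by apply: bmfD; [exact: bmfZ|exact: bmf_cst]|].
move=> x Sx; have [X1 X2] := sphere_coord_itv Sx.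
have /andP[h0 h1] := hB (X x).
case: (leP t (X x)) => tx; rewrite ?mulr1 ?mulr0.
  have : X x * h (X x) <= X x * (u + 2 * e) by apply: ler_wpM2l => //; lra.
  lra.
have [X0|X0] := leP 0 (X x).
  have : X x * h (X x) <= 1 * h (X x) by apply: ler_wpM2r.
  have : h (X x) <= e.
    by rewrite ge_max (ltW e0)/= ge_min lerBlDl subrK (ltW tx).
  lra.
have : 0 <= - X x * h (X x) by apply: mulr_ge0 => //; lra.
lra.
Qed.

Lemma exists_rotation_to_pole (x : T) : S x ->
  exists2 Q, orthogonal_mx Q & forall y, X (mxact Q y) = dot y x.
Proof.
move=> Sx; have [|Q QQ [Q1 _]] := exists_exchange (x := x) (y := basis_vec ord0).
  by move: Sx (@basis_sphere R d ord0); rewrite /sphere /= => -> ->.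
by exists Q => // y; rewrite -dot_basis Q1.
Qed.

Lemma Ex_dot (f : R -> R) (z : T) : S z -> bmf S (fun x => f (X x)) ->
  E (fun x => f (dot x z)) = E (fun x => f (X x)).
Proof.
move=> Sz bf; have [Q QQ Q1] := exists_rotation_to_pole Sz.
by rewrite -(Ex_mxact unif QQ bf); apply: eq_Ex => x _; rewrite Q1.
Qed.

Lemma bmf_dot_bool (b : R -> bool) (z : T) : measurable_fun setT b ->
  bmf S (fun x => \I[b (dot x z)] : R).
Proof.
move=> mb; apply: bmf_bool; apply: (measurableT_comp mb).
exact: measurable_dotl.
Qed.

End transfer.

(** * Cap averages *)

Section cap_average.
Context {R : realType} {n : nat}.
Local Notation d := n.+2.
Local Notation T := (d.-tuple R).
Variable rho : probability T R.
Hypothesis unif : uniform_sphere rho.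
Local Notation S := (sphere R d).
Local Notation E := (Ex rho S).
Local Notation mS := (@measurable_sphere R d).
Local Notation X x := (@tnth n.+2 R x ord0).
Let PS : rho S = 1%E. Proof. by case: unif. Qed.
Variable c : R.
Hypotheses (c0 : 0 <= c) (c1 : c < 1).

Definition cap_mass_at := E (fun y => \I[c <= X y]).
Local Notation Z := cap_mass_at.
Definition cap_average (f : T -> R) (x : T) : R :=
  Z^-1 * E (fun y => \I[c <= dot y x] * f y).
Local Notation P := cap_average.

Lemma Z_gt0 : 0 < Z. Proof. exact: cap_mass_gt0. Qed.

Lemma bmf_cap x : bmf S (fun y => \I[c <= dot y x] : R).
Proof. by apply: (bmf_dot_bool (b := fun u => c <= u)); exact: measurable_ge. Qed.

Lemma bmf_capM x (f : T -> R) : bmf S f -> bmf S (fun y => \I[c <= dot y x] * f y).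
Proof. by move=> bf; apply: bmfM => //; exact: bmf_cap. Qed.

Lemma Ex_cap x : S x -> E (fun y => \I[c <= dot y x]) = Z.
Proof.
move=> Sx; apply: (Ex_dot unif (f := fun u => \I[c <= u])) => //.
exact: bmf_ge.
Qed.

Lemma cap_average_bmf f : bmf S f -> bmf S (P f).
Proof.
move=> [mf [M fM]]; apply: bmfZ.
apply: (bmf_Ex (F := fun z : T * T => \I[c <= dot z.2 z.1] * f z.2) mS) => //.
  apply: measurable_funM; last exact: measurableT_comp.
  have [] : bmf [set: T * T] (fun z : T * T => \I[c <= dot z.2 z.1] : R); last by [].
  apply: bmf_bool; apply: measurable_fun_ler; first exact: measurable_cst.
  by under eq_fun do rewrite dotC; exact: measurable_dot.
exists M => x y Sx Sy; have := fM _ Sy; case: (c <= _) => /=; rewrite ?mul1r// mul0r normr0.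
exact: le_trans.
Qed.

(** The kernel is symmetric in its two points and all caps have the same mass [Z], so after
    exchanging the integrals the inner one is the constant [Z]. *)
Lemma Ex_cap_average f : bmf S f -> E (P f) = E f.
Proof.
move=> bf; have [mf [M fM]] := bf.
have bE : bmf S (fun x => E (fun y => \I[c <= dot y x] * f y)).
  have := bmfZ Z (cap_average_bmf bf); rewrite /cap_average.
  by under eq_fun do rewrite mulrA divff ?mul1r ?lt0r_neq0 ?Z_gt0//.
rewrite /cap_average (ExZ _ mS)//.
rewrite (Ex_swap rho rho mS mS (F := fun z : T * T => \I[c <= dot z.2 z.1] * f z.2)) /=; last 2 first.
- apply: measurable_funM; last exact: measurableT_comp.
  have [] : bmf [set: T * T] (fun z : T * T => \I[c <= dot z.2 z.1] : R); last by [].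
  apply: bmf_bool; apply: measurable_fun_ler; first exact: measurable_cst.
  by under eq_fun do rewrite dotC; exact: measurable_dot.
- exists M => x y Sx Sy; have := fM _ Sy; case: (c <= _) => /=; rewrite ?mul1r// mul0r normr0.
  exact: le_trans.
rewrite (@eq_Ex _ _ _ _ _ _ (fun y => Z * f y)); last first.
  move=> y Sy; rewrite mulrC -(Ex_cap Sy) -(ExZ _ mS); last exact: bmf_cap.
  by apply: eq_Ex => x _; rewrite mulrC dotC.
by rewrite (ExZ _ mS)// mulrA mulVf ?mul1r// lt0r_neq0// Z_gt0.
Qed.

Lemma cap_average_le f g x : bmf S f -> bmf S g ->
  (forall y, S y -> c <= dot y x -> f y <= g y) -> P f x <= P g x.
Proof.
move=> bf bg fg; rewrite /cap_average ler_pM2l ?invr_gt0 ?Z_gt0//.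
apply: (le_Ex rho mS); do ?exact: bmf_capM.
move=> y Sy; case: (leP c (dot y x)) => cy; last by rewrite !mul0r.
by rewrite !mul1r fg.
Qed.

Lemma eq_cap_average f g x :
  (forall y, S y -> c <= dot y x -> f y = g y) -> P f x = P g x.
Proof.
move=> fg; congr (_ * _); apply: eq_Ex => y Sy.
case: (leP c (dot y x)) => cy; last by rewrite !mul0r.
by rewrite !mul1r fg.
Qed.

Lemma cap_averageD f g x : bmf S f -> bmf S g ->
  P (fun y => f y + g y) x = P f x + P g x.
Proof.
move=> bf bg; rewrite /cap_average -mulrDr -(ExD _ mS); do ?exact: bmf_capM.
by congr (_ * _); apply: eq_Ex => y _; rewrite mulrDr.
Qed.

Lemma cap_averageZ a f x : bmf S f -> P (fun y => a * f y) x = a * P f x.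
Proof.
move=> bf; rewrite /cap_average mulrCA -[a * E _](ExZ _ mS); last exact: bmf_capM.
by congr (_ * _); apply: eq_Ex => y _; rewrite mulrCA.
Qed.

Lemma cap_averageN f x : bmf S f -> P (fun y => - f y) x = - P f x.
Proof.
move=> bf; rewrite -mulN1r -cap_averageZ//.
by apply: eq_cap_average => y _ _; rewrite mulN1r.
Qed.

Lemma cap_averageB f g x : bmf S f -> bmf S g ->
  P (fun y => f y - g y) x = P f x - P g x.
Proof. by move=> bf bg; rewrite cap_averageD ?cap_averageN//; exact: bmfN. Qed.

Lemma cap_average_sum (I : Type) (r : seq I) (F : I -> T -> R) x :
  (forall i, bmf S (F i)) ->
  P (fun y => \sum_(i <- r) F i y) x = \sum_(i <- r) P (F i) x.
Proof.
move=> bF; rewrite /cap_average -mulr_sumr; congr (_ * _).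
transitivity (E (fun y => \sum_(i <- r) (\I[c <= dot y x] * F i y))).
  by apply: eq_Ex => y _; rewrite mulr_sumr.
rewrite (Ex_sum _ mS)//.
by move=> i; exact: (bmf_capM x (bF i)).
Qed.

Lemma cap_average_cst a x : S x -> P (fun=> a) x = a.
Proof.
move=> Sx; rewrite /cap_average (@eq_Ex _ _ _ _ _ _ (fun y => a * \I[c <= dot y x])); last first.
  by move=> y _; rewrite mulrC.
rewrite (ExZ _ mS); last exact: bmf_cap.
by rewrite Ex_cap// mulrCA mulVf ?mulr1// lt0r_neq0// Z_gt0.
Qed.

Lemma norm_cap_average f x : bmf S f -> `|P f x| <= P (fun y => `|f y|) x.
Proof.
move=> bf; have bn := bmf_norm bf; rewrite ler_norml -cap_averageN//.
apply/andP; split; apply: cap_average_le => //.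
- exact: bmfN.
- by move=> y _ _; rewrite lerNl -normrN ler_norm.
- by move=> y _ _; rewrite ler_norm.
Qed.

Lemma norm_cap_average_le f M x : S x -> bmf S f ->
  (forall y, S y -> c <= dot y x -> `|f y| <= M) -> `|P f x| <= M.
Proof.
move=> Sx bf fM; apply: le_trans (norm_cap_average _ bf) _.
rewrite -[leRHS](cap_average_cst M Sx); apply: cap_average_le => //.
  exact: bmf_norm.
exact: bmf_cst.
Qed.

Lemma cap_average_mxact Q f x : orthogonal_mx Q -> bmf S f ->
  P f (mxact Q x) = P (fun y => f (mxact Q y)) x.
Proof.
move=> QQ bf; rewrite /cap_average -(Ex_mxact unif QQ); last exact: bmf_capM.
by congr (_ * _); apply: eq_Ex => y _; rewrite orthogonal_dot.
Qed.

End cap_average.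

(** * Contraction of Lipschitz constants by cap averages *)

Section contraction.
Context {R : realType} {n : nat}.
Local Notation d := n.+2.
Local Notation T := (d.-tuple R).
Variable rho : probability T R.
Hypothesis unif : uniform_sphere rho.
Local Notation S := (sphere R d).
Local Notation E := (Ex rho S).
Local Notation mS := (@measurable_sphere R d).
Local Notation m := (n.+1%:R : R).
Local Notation X x := (@tnth n.+2 R x ord0).
Let m0 : 0 < m. Proof. by rewrite ltr0n. Qed.
Variable c : R.
Hypotheses (c0 : 0 <= c) (c1 : c < 1).
Local Notation Z := (cap_mass_at rho c).
Local Notation P := (cap_average rho c).
Let Z0 : 0 < Z. Proof. exact: Z_gt0. Qed.

(** The mean over a cap of the squared length of the part of [y] tangential at the centre. It
    governs both the contraction of an averaging step and its cost in the exponent, and the ratio of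
    the two does not depend on it, so no sharp value is required. *)
Definition cap_var := Z^-1 * E (fun y => (1 - X y ^+ 2) * \I[c <= X y]).
Local Notation v := cap_var.

Let bX : bmf S (fun x => X x). Proof. exact: bmf_X. Qed.
Let bI : bmf S (fun y : T => \I[c <= X y] : R). Proof. exact: bmf_ge. Qed.
Let b1X2I : bmf S (fun x => (1 - X x ^+ 2) * \I[c <= X x]).
Proof. by apply: bmfM => //; apply: bmfB; [exact: bmf_cst|exact: bmfX]. Qed.

Lemma mass_cap_var : Z * v = E (fun y => (1 - X y ^+ 2) * \I[c <= X y]).
Proof. by rewrite /cap_var mulrA divff ?mul1r// lt0r_neq0. Qed.

Lemma cap_var_ge : (1 - c) / 4 <= v.
Proof.
by rewrite -(ler_pM2l Z0) mass_cap_var mulrC; exact: cap_variance_ge.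
Qed.

Lemma cap_var_le1 : v <= 1.
Proof.
rewrite -(ler_pM2l Z0) mass_cap_var mulr1.
apply: (le_Ex rho mS) => // x Sx; case: (c <= X x); rewrite ?mulr0 ?mulr1//.
by rewrite lerBlDr lerDl sqr_ge0.
Qed.

Lemma cap_var_gt0 : 0 < v.
Proof. by apply: (lt_le_trans _ cap_var_ge); rewrite divr_gt0 ?subr_gt0. Qed.

Lemma bmf_dot (x : T) : bmf S (fun y => dot y x).
Proof. by apply: bmf_sum => i; apply: bmfM; [exact: bmf_coord|exact: bmf_cst]. Qed.

Lemma bmf_dotr (x : T) : bmf S (fun y => dot x y).
Proof.
rewrite (_ : (fun y => _) = fun y => dot y x); first exact: bmf_dot.
by apply/funext => y; rewrite dotC.
Qed.

Lemma cap_average_sqr x : S x -> P (fun y => dot y x ^+ 2) x = 1 - v.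
Proof.
move=> Sx; rewrite /cap_average.
have bI2 : bmf S (fun y => \I[c <= X y] * X y ^+ 2) by apply: bmfM => //; exact: bmfX.
rewrite (Ex_dot unif (f := fun u => \I[c <= u] * u ^+ 2))//.
apply: (mulfI (lt0r_neq0 Z0)); rewrite mulrBr mass_cap_var mulr1.
rewrite mulrA divff ?lt0r_neq0// mul1r -(ExB _ mS)//; apply: eq_Ex => y _; ring.
Qed.

(** Tangential directions are equivalent: a reflection fixing the pole exchanges [g] with a vector
    of the same length along any axis [j]. The squares of the coordinates along the [n + 1] axes
    other than the pole sum to [1 - x_0^2]. *)
Lemma pole_orthogonal_sqr (g : T) : X g = 0 ->
  m * E (fun y => \I[c <= X y] * dot g y ^+ 2) =
  dot g g * E (fun y => (1 - X y ^+ 2) * \I[c <= X y]).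
Proof.
move=> g0; set s := Num.sqrt (dot g g).
have s2 : s ^+ 2 = dot g g by rewrite sqr_sqrtr// dot_ge0.
have bIj j : bmf S (fun y : T => \I[c <= X y] * tnth y j ^+ 2).
  by apply: bmfM => //; apply: bmfX; exact: bmf_coord.
have key (j : 'I_n.+1) : E (fun y => \I[c <= X y] * dot g y ^+ 2) =
    dot g g * E (fun y => \I[c <= X y] * tnth y (lift ord0 j) ^+ 2).
  pose ej := basis_vec (R := R) (lift ord0 j : 'I_d).
  pose h := lincomb s ej 0 ej.
  have hh : dot g g = dot h h.
    rewrite /h !dotE -s2; have := basis_sphere (R := R) (lift ord0 j : 'I_d).
    by rewrite /sphere /= => ->; ring.
  have [Q QQ [Q1 Q2]] := exists_exchange hh.
  rewrite -(ExZ _ mS)//.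
  have bh : bmf S (fun y => \I[c <= X y] * dot y h ^+ 2).
    by apply: bmfM => //; apply: bmfX; exact: bmf_dot.
  transitivity (E (fun y => \I[c <= X y] * dot y h ^+ 2)); last first.
    by apply: eq_Ex => y _; rewrite /h !dotE dot_basis -s2; ring.
  rewrite -(Ex_mxact unif QQ bh); apply: eq_Ex => y _.
  rewrite Q1 (dotC g y) -(dot_basis (mxact Q y)) Q2 ?dot_basis//.
  rewrite dotC dot_basis g0 dotC dot_basis /h !tnth_mktuple /=; ring.
have sumE (u : R) : m * u = \sum_(j < n.+1) u by rewrite sumr_const card_ord mulr_natl.
rewrite sumE (eq_bigr (fun j => dot g g *
  E (fun y => \I[c <= X y] * tnth y (lift ord0 j) ^+ 2))); last by move=> j _; exact: key.
rewrite -mulr_sumr -(Ex_sum _ mS)//; congr (_ * _); apply: eq_Ex => y Sy.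
rewrite -mulr_sumr mulrC; congr (_ * _).
have := Sy; rewrite /sphere /= /dot big_ord_recl => <-.
rewrite expr2 addrC addKr.
by apply: eq_bigr => j _; rewrite expr2.
Qed.

Lemma cap_average_orthogonal_sqr (x g : T) : S x -> dot g x = 0 ->
  P (fun y => dot g y ^+ 2) x = dot g g * (v / m).
Proof.
move=> Sx gx; have [Q QQ Q1] := exists_rotation_to_pole Sx.
rewrite /cap_average.
have X0 : X (mxact Q g) = 0 by rewrite Q1.
have := pole_orthogonal_sqr X0; rewrite orthogonal_dot// => h.
have bh : bmf S (fun y => \I[c <= X y] * dot (mxact Q g) y ^+ 2).
  by apply: bmfM => //; apply: bmfX; exact: bmf_dotr.
rewrite -(Ex_mxact unif QQ bh) in h.
rewrite (@eq_Ex _ _ _ _ _ _ (fun y => \I[c <= X (mxact Q y)] * dot (mxact Q g) (mxact Q y) ^+ 2)); last first.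
  by move=> y _; rewrite Q1 orthogonal_dot.
apply: (mulfI (lt0r_neq0 m0)).
by rewrite mulrCA h /cap_var; field; rewrite !lt0r_neq0.
Qed.

(** [sqrt (2 - 2 <x, y>)] is the chordal distance of unit vectors. Acute pairs suffice, and they
    keep [1 + dot x y], by which the coupling rotation divides, away from 0. *)
Definition lip_on_sphere (l : R) (f : T -> R) := forall x y, S x -> S y ->
  0 <= dot x y -> `|f x - f y| <= l * Num.sqrt (2 - 2 * dot x y).

(** For unit vectors the first reflection sends [x] to [- x], the one with normal [x + y] sends
    [- x] to [y], and both fix the orthogonal complement of the plane. *)
Definition plane_rotation_mx (x y : T) : 'M[R]_d :=
  reflection_mx (lincomb 1 x 1 y) *m reflection_mx x.

Section plane_rotation.
Variables (x y : T).
Hypotheses (Sx : S x) (Sy : S y) (xy0 : 0 <= dot x y).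
Local Notation Q := (plane_rotation_mx x y).
Let xx : dot x x = 1. Proof. exact: Sx. Qed.
Let yy : dot y y = 1. Proof. exact: Sy. Qed.
Let ww : dot (lincomb 1 x 1 y) (lincomb 1 x 1 y) = 2 * (1 + dot x y).
Proof. by rewrite !dotE xx yy (dotC y x); ring. Qed.
Let k0 : 1 + dot x y != 0. Proof. by rewrite lt0r_neq0// ltr_pwDl. Qed.
Let w0 : dot (lincomb 1 x 1 y) (lincomb 1 x 1 y) != 0.
Proof. by rewrite ww mulf_neq0. Qed.

Lemma orthogonal_plane_rotation : orthogonal_mx Q.
Proof.
by apply: orthogonal_mul; apply: orthogonal_reflection => //; rewrite xx oner_neq0.
Qed.

Lemma mxact_plane_rotation (u : T) i : tnth (mxact Q u) i =
  tnth u i + 2 * dot u x * tnth y i -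
  (dot u x + dot u y) / (1 + dot x y) * (tnth x i + tnth y i).
Proof.
rewrite mxact_mul !mxact_reflection /reflection !tnth_mktuple ww !dotE xx (dotC x u) (dotC y x) (dotC y u).
by field.
Qed.

Lemma plane_rotation_start : mxact Q x = y.
Proof.
apply: eq_from_tnth => i; rewrite mxact_plane_rotation xx.
by field.
Qed.

Lemma plane_rotation_displacement u : S u ->
  2 - 2 * dot u (mxact Q u) = 2 * (1 - dot x y) * dot u x ^+ 2 +
  2 / (1 + dot x y) * dot (lincomb 1 y (- dot x y) x) u ^+ 2.
Proof.
rewrite /sphere /= => uu.
rewrite mxact_mul !mxact_reflection /reflection ww !dotE xx uu !(dotC _ u) (dotC y x).
by field.
Qed.

(** The squared displacement of [u] is [2 (1 - <x, y>)] times the squared length of its projection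
    to the plane, at most 1 by Bessel's inequality. So no point moves farther than [x], and the
    image pairs are again acute, as [lip_on_sphere] demands. *)
Lemma plane_rotation_acute u : S u -> 0 <= dot u (mxact Q u).
Proof.
move=> Su; have := plane_rotation_displacement Su.
set g := lincomb 1 y (- dot x y) x; set k := dot x y; set a := dot u x.
have gg : dot g g = 1 - k ^+ 2 by rewrite /g !dotE xx yy (dotC y x) -/k; ring.
have kn : `|k| <= 1 by exact: norm_dot_le1.
have [k1|k1] := eqVneq k 1.
  have -> : dot g u = 0 by apply: dot_eq0; rewrite gg k1 expr1n subrr.
  rewrite k1 expr0n mulr0 addr0 subrr mulr0 mul0r => h; lra.
have kl : k < 1 by rewrite lt_neqAle k1 /=; case/ler_normlP: kn.
have gp : 0 < 1 - k ^+ 2.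
  rewrite (_ : 1 - _ = (1 - k) * (1 + k)); last by ring.
  have : 0 <= k by []. by move=> kk; apply: mulr_gt0; lra.
have gx : dot g x = 0 by rewrite /g !dotE xx (dotC y x) -/k; ring.
clearbody g; pose b := dot g u.
have := dot_ge0 (lincomb 1 (lincomb 1 u (- a) x) (- (b / (1 - k ^+ 2))) g).
rewrite !dotE gg xx (dotC x g) gx (dotC u g) -/b (dotC x u) -/a.
have -> : dot u u = 1 by exact: Su.
rewrite [leRHS](_ : _ = 1 - (a ^+ 2 + b ^+ 2 / (1 - k ^+ 2))); last by field; rewrite lt0r_neq0.
rewrite -/b => h1 h2.
have k2 : (2 * (1 - k)) * (a ^+ 2 + b ^+ 2 / (1 - k ^+ 2)) =
   2 * (1 - k) * a ^+ 2 + 2 / (1 + k) * b ^+ 2.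
  have kk1 : 1 + k != 0 := k0.
  have kk2 : 1 - k ^+ 2 != 0 by rewrite lt0r_neq0.
  by field; rewrite kk1.
rewrite -k2 in h2.
have h3 : (2 * (1 - k)) * (a ^+ 2 + b ^+ 2 / (1 - k ^+ 2)) <= 2 * (1 - k) * 1.
  by apply: ler_wpM2l; lra.
have : 0 <= k by []. lra.
Qed.

End plane_rotation.

(* The rotation taking [x] to [y] in their plane couples the caps around [x] and [y];
   it displaces the cap by [(1 - v + v / m) * |x - y|^2] in mean square. *)
Lemma cap_average_lip l f : 0 <= l -> bmf S f -> lip_on_sphere l f ->
  lip_on_sphere (l * Num.sqrt (1 - v + v / m)) (P f).
Proof.
move=> l0 bf fl x y Sx Sy xy0.
set r2 := 1 - v + v / m; set k := dot x y.
have v0 := cap_var_gt0; have v1 := cap_var_le1.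
have r20 : 0 < r2.
  by rewrite /r2 ltr_wpDl ?subr_ge0// divr_gt0.
have kn : `|k| <= 1 by exact: norm_dot_le1.
have kl : k <= 1 by case/ler_normlP: kn.
pose Q := plane_rotation_mx x y.
have QQ : orthogonal_mx Q by exact: orthogonal_plane_rotation.
have bfQ : bmf S (fun u => f (mxact Q u)) by exact: bmf_mxact.
have -> : P f y = P (fun u => f (mxact Q u)) x.
  by rewrite -{1}(plane_rotation_start Sx Sy xy0) cap_average_mxact.
rewrite -cap_averageB//.
pose A u := 2 * (1 - k) * dot u x ^+ 2 +
  2 / (1 + k) * dot (lincomb 1 y (- k) x) u ^+ 2.
have bA : bmf S A.
  apply: bmfD; apply: bmfZ; apply: bmfX; first exact: bmf_dot.
  exact: bmf_dotr.
have k10 : 1 + k != 0 by rewrite lt0r_neq0// ltr_pwDl.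
have PA : P A x = (2 - 2 * k) * r2.
  rewrite cap_averageD; last 2 first.
  - by apply: bmfZ; apply: bmfX; exact: bmf_dot.
  - by apply: bmfZ; apply: bmfX; exact: bmf_dotr.
  rewrite !cap_averageZ; last 2 first.
  - by apply: bmfX; exact: bmf_dotr.
  - by apply: bmfX; exact: bmf_dot.
  rewrite cap_average_sqr// cap_average_orthogonal_sqr//; last first.
    by rewrite !dotE (dotC y x) -/k (_ : dot x x = 1)//; ring.
  have -> : dot (lincomb 1 y (- k) x) (lincomb 1 y (- k) x) = 1 - k ^+ 2.
    by rewrite !dotE (dotC y x) -/k (_ : dot x x = 1)// (_ : dot y y = 1)//; ring.
  rewrite /r2; field; rewrite k10 /= lt0r_neq0//.
have Aq u : S u -> `|f u - f (mxact Q u)| <= l * Num.sqrt (A u).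
  move=> Su; rewrite /A -plane_rotation_displacement//.
  by apply: fl; rewrite ?sphere_mxact//; exact: plane_rotation_acute.
have [k1|k1] := eqVneq k 1.
  apply: le_trans (norm_cap_average unif c0 c1 _ _) _; first exact: bmfB.
  have PA0 : P A x = 0 by rewrite PA k1 mulr1 subrr mul0r.
  rewrite k1 mulr1 subrr sqrtr0 mulr0 -[leRHS](mulr0 l).
  rewrite -PA0 -cap_averageZ//; apply: cap_average_le => //.
  - by apply: bmf_norm; exact: bmfB.
  - exact: bmfZ.
  move=> u Su _; apply: le_trans (Aq u Su) _.
  have -> : A u = 0.
    have g0 : dot (lincomb 1 y (- k) x) u = 0.
      apply: dot_eq0; rewrite !dotE (dotC y x) -/k k1.
      by rewrite (_ : dot x x = 1)// (_ : dot y y = 1)//; ring.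
    by rewrite /A g0 k1 expr0n subrr !mulr0 mul0r addr0.
  by rewrite sqrtr0.
have kp : 0 < 2 - 2 * k.
  have : k < 1 by rewrite lt_neqAle k1. lra.
(* [t^2] is the mean [P A x], and [sqrt A <= (t + A / t) / 2] linearizes the root there, in place of
   Jensen's inequality. The case [k = 1], where [t] would be 0, is already settled. *)
pose t := Num.sqrt r2 * Num.sqrt (2 - 2 * k).
have t0 : 0 < t by rewrite mulr_gt0// sqrtr_gt0.
have t2 : t ^+ 2 = (2 - 2 * k) * r2.
  by rewrite exprMn !sqr_sqrtr ?ltW// mulrC.
rewrite -mulrA -/t.
apply: le_trans (norm_cap_average unif c0 c1 _ _) _; first exact: bmfB.
apply: (@le_trans _ _ (P (fun u => l / 2 * t + l / (2 * t) * A u) x)).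
  apply: cap_average_le => //.
  - by apply: bmf_norm; exact: bmfB.
  - by apply: bmfD; [exact: bmf_cst|exact: bmfZ].
  move=> u Su _; apply: le_trans (Aq u Su) _.
  have A0 : 0 <= A u.
    have kge : 0 <= k by [].
    apply: addr_ge0; apply: mulr_ge0; rewrite ?sqr_ge0//; first by lra.
    by apply: divr_ge0; lra.
  have -> : l / 2 * t + l / (2 * t) * A u = l * ((t + A u / t) / 2).
    by field; rewrite lt0r_neq0.
  apply: ler_wpM2l => //; rewrite ler_pdivlMr//.
  set q := Num.sqrt (A u); have q2 : q ^+ 2 = A u by rewrite sqr_sqrtr.
  rewrite -(ler_pM2r t0) mulrDl divfK ?lt0r_neq0// -q2.
  have := sqr_ge0 (t - q); rewrite sqrrB expr2 => h.
  lra.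
rewrite cap_averageD//; [|exact: bmf_cst|exact: bmfZ].
rewrite cap_average_cst// cap_averageZ// PA -t2 le_eqVlt; apply/orP; left; apply/eqP.
by field; rewrite lt0r_neq0.
Qed.

End contraction.

(** * Exponential moments under one averaging step *)

Section one_step.
Context {R : realType} {n : nat}.
Local Notation d := n.+2.
Local Notation T := (d.-tuple R).
Variable rho : probability T R.
Hypothesis unif : uniform_sphere rho.
Local Notation S := (sphere R d).
Local Notation E := (Ex rho S).
Local Notation m := (n.+1%:R : R).
Let m0 : 0 < m. Proof. by rewrite ltr0n. Qed.

(* [M x] is the differential of [Q |-> f (Q x)] at the identity. *)
Definition smooth_on_sphere (B L : R) (f : T -> R) :=
  exists M : T -> 'I_d -> 'I_d -> R,
  [/\ forall i j, bmf S (fun x => M x i j),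
      forall x i j, S x -> `|M x i j| <= B &
      forall x (Q : 'M[R]_d), S x -> orthogonal_mx Q ->
        `|f (mxact Q x) - f x - \sum_i \sum_j M x i j * (Q i j - (i == j)%:R)|
        <= L * \sum_i \sum_j (Q i j - (i == j)%:R) ^+ 2].

Section averaging.
Variable c : R.
Hypotheses (c0 : 0 <= c) (c1 : c < 1).
Local Notation P := (cap_average rho c).

(** Averaging commutes with rotations, so the differential of [P f] along the orbit of the
    orthogonal group is the average of that of [f]. This is why smoothness is measured along orbits:
    [B] and [L] survive any number of iterations unchanged. *)
Lemma cap_average_smooth B L f : bmf S f -> smooth_on_sphere B L f ->
  smooth_on_sphere B L (P f).
Proof.
move=> bf [M [bM MB fM]].
exists (fun x i j => P (fun y => M y i j) x); split.
- by move=> i j; exact: cap_average_bmf.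
- by move=> x i j Sx; apply: norm_cap_average_le => // y Sy _; exact: MB.
move=> x Q Sx QQ.
have bMD i j : bmf S (fun y => M y i j * (Q i j - (i == j)%:R)).
  by apply: bmfM => //; exact: bmf_cst.
have bMDi i : bmf S (fun y => \sum_j M y i j * (Q i j - (i == j)%:R)) by exact: bmf_sum.
have bMs : bmf S (fun y => \sum_i \sum_j M y i j * (Q i j - (i == j)%:R)) by exact: bmf_sum.
have bfQ : bmf S (fun y => f (mxact Q y)) by exact: bmf_mxact.
have -> : \sum_i \sum_j P (fun y => M y i j) x * (Q i j - (i == j)%:R) =
    P (fun y => \sum_i \sum_j M y i j * (Q i j - (i == j)%:R)) x.
  rewrite cap_average_sum//; apply: eq_bigr => i _.
  rewrite cap_average_sum//; apply: eq_bigr => j _.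
  rewrite mulrC -cap_averageZ//.
  by apply: eq_cap_average => y _ _; rewrite mulrC.
rewrite cap_average_mxact// -!cap_averageB//; last exact: bmfB.
apply: norm_cap_average_le => //; first by apply: bmfB => //; exact: bmfB.
by move=> y Sy _; exact: fM.
Qed.

End averaging.

Lemma plane_rotation_mxE (x y : T) i j : S x -> S y -> 0 <= dot x y ->
  plane_rotation_mx x y i j - (i == j)%:R =
  2 * tnth x j * tnth y i -
  (tnth x j + tnth y j) / (1 + dot x y) * (tnth x i + tnth y i).
Proof.
move=> Sx Sy xy0.
have := mxact_plane_rotation Sx Sy xy0 (basis_vec j) i.
rewrite [LHS]tnth_mktuple (bigD1 j)//= tnth_mktuple eqxx mulr1 big1 ?addr0; last first.
  by move=> k /negbTE kj; rewrite tnth_mktuple kj mulr0.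
move=> ->; rewrite tnth_mktuple !(dotC (basis_vec j)) !dot_basis; ring.
Qed.

(* [g] is the tangential gradient of [f] at [x]. *)
Lemma first_order_bound B L l f : 0 <= B -> 0 <= L -> 0 <= l ->
  lip_on_sphere l f -> smooth_on_sphere B L f ->
  forall x, S x -> exists g : T, [/\ dot g x = 0, dot g g <= l ^+ 2 &
    forall y, S y -> 0 <= dot x y ->
    `|f y - f x - dot g y| <= (d * d)%:R * (2 * B + 24 * L) * (2 - 2 * dot x y)].
Proof.
move=> B0 L0 l0 fl [M [bM MB fM]] x Sx.
(* To first order the rotation taking [x] to [y] is [1 + y x^T - x y^T]. Pairing [M x] with the
   antisymmetric part is linear in [y], and [g] represents this form. *)
pose g : T := [tuple \sum_j (M x i j - M x j i) * tnth x j | i < d].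
have gE y : dot g y = \sum_i \sum_j M x i j * (tnth y i * tnth x j - tnth x i * tnth y j).
  transitivity (\sum_i \sum_j M x i j * (tnth y i * tnth x j) -
     \sum_i \sum_j M x i j * (tnth x i * tnth y j)).
    rewrite [X in _ - X]exchange_big /= -sumrB; apply: eq_bigr => i _.
    rewrite tnth_mktuple mulr_suml -sumrB; apply: eq_bigr => j _; ring.
  by rewrite -sumrB; apply: eq_bigr => i _; rewrite -sumrB; apply: eq_bigr => j _; ring.
have gx : dot g x = 0.
  rewrite gE; apply: big1 => i _; apply: big1 => j _; ring.
(* Let [D2] be the squared chord. The entries of [Q - 1] differ from the first-order part [A] by at
   most [2 * D2], which is paired with entries bounded by [B]; their squares are at most
   [2 * 4 * D2 + 2 * 8 * D2 = 24 * D2], which is multiplied by [L]. *)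
set C := (d * d)%:R * (2 * B + 24 * L).
have C0 : 0 <= C by rewrite mulr_ge0 ?ler0n// addr_ge0// mulr_ge0.
have main y : S y -> 0 <= dot x y -> `|f y - f x - dot g y| <= C * (2 - 2 * dot x y).
  move=> Sy xy0.
  set k := dot x y; set D2 := 2 - 2 * k.
  have k1 : k <= 1 by have := norm_dot_le1 Sx Sy => /ler_normlP[].
  have k0 : 0 <= k by [].
  have kk : 1 + k != 0 by rewrite lt0r_neq0// ltr_pwDl.
  have D20 : 0 <= D2 by rewrite /D2; lra.
  have D22 : D2 <= 2 by rewrite /D2; lra.
  pose Q := plane_rotation_mx x y.
  have QQ : orthogonal_mx Q by exact: orthogonal_plane_rotation.
  have := fM x Q Sx QQ; rewrite plane_rotation_start//.
  have X1 i : `|tnth x i| <= 1 by exact: sphere_coord.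
  have Y1 i : `|tnth y i| <= 1 by exact: sphere_coord.
  have dl i : `|tnth y i - tnth x i| ^+ 2 <= D2.
    rewrite real_normK ?num_real//.
    have -> : D2 = \sum_j (tnth y j - tnth x j) ^+ 2.
      transitivity (dot (lincomb 1 y (-1) x) (lincomb 1 y (-1) x)).
        by rewrite !dotE (_ : dot x x = 1)// (_ : dot y y = 1)// (dotC y x) -/k /D2; ring.
      by apply: eq_bigr => j _; rewrite !tnth_mktuple; ring.
    by rewrite (bigD1 i)//= lerDl; apply: sumr_ge0 => j _; exact: sqr_ge0.
  pose A i j := tnth y i * tnth x j - tnth x i * tnth y j.
  pose e i j := Q i j - (i == j)%:R - A i j.
  have dij i j : `|(tnth y i - tnth x i) * (tnth y j - tnth x j)| <= D2.
    rewrite normrM; have := dl i; have := dl j.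
    have := sqr_ge0 (`|tnth y i - tnth x i| - `|tnth y j - tnth x j|).
    rewrite sqrrB; lra.
  have eb i j : `|e i j| <= 2 * D2.
    have -> : e i j = - ((tnth x i + tnth y i) * (tnth x j + tnth y j) * (1 - k) / (2 * (1 + k)))
        - (tnth y i - tnth x i) * (tnth y j - tnth x j) / 2.
      by rewrite /e /A plane_rotation_mxE// -/k; field.
    apply: le_trans (ler_normB _ _) _; rewrite normrN.
    have h2 : `|(tnth y i - tnth x i) * (tnth y j - tnth x j) / 2| <= D2.
      rewrite normrM normfV (ger0_norm (_ : 0 <= 2))// ler_pdivrMr//.
      have := dij i j; lra.
    have s2 i' : `|tnth x i' + tnth y i'| <= 2.
      by apply: le_trans (ler_normD _ _) _; have := X1 i'; have := Y1 i'; lra.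
    have h1 : `|(tnth x i + tnth y i) * (tnth x j + tnth y j) * (1 - k) / (2 * (1 + k))| <= D2.
      rewrite normrM normfV (@ger0_norm _ (2 * (1 + k))); last by lra.
      rewrite ler_pdivrMr; last by lra.
      rewrite normrM (@ger0_norm _ (1 - k)); last by lra.
      have h4 : `|(tnth x i + tnth y i) * (tnth x j + tnth y j)| <= 2 * 2.
        by rewrite normrM; apply: ler_pM.
      have kk1 : 0 <= 1 - k by lra.
      apply: le_trans (ler_wpM2r kk1 h4) _.
      have -> : D2 = 2 * (1 - k) by rewrite /D2; ring.
      have : 0 <= (1 - k) * k by rewrite mulr_ge0. lra.
    lra.
  have Ab i j : A i j ^+ 2 <= 4 * D2.
    have -> : A i j = (tnth y i - tnth x i) * tnth x j - tnth x i * (tnth y j - tnth x j).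
      by rewrite /A; ring.
    set p := (tnth y i - _) * _; set q := tnth x i * _.
    have p2 : p ^+ 2 <= D2.
      rewrite -[p ^+ 2]real_normK ?num_real// normrM exprMn.
      have := dl i; have : `|tnth x j| ^+ 2 <= 1 by rewrite expr_le1.
      move=> h1 h2; apply: le_trans (ler_wpM2l _ h1) _; first exact: sqr_ge0.
      by rewrite mulr1.
    have q2 : q ^+ 2 <= D2.
      rewrite -[q ^+ 2]real_normK ?num_real// normrM exprMn.
      have := dl j; have : `|tnth x i| ^+ 2 <= 1 by rewrite expr_le1.
      move=> h1 h2; apply: le_trans (ler_wpM2r _ h1) _; first exact: sqr_ge0.
      by rewrite mul1r.
    have := sqr_ge0 (p + q); rewrite sqrrD sqrrB; lra.
  have Db i j : (Q i j - (i == j)%:R) ^+ 2 <= 24 * D2.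
    have -> : Q i j - (i == j)%:R = A i j + e i j by rewrite /e; ring.
    have e2 : e i j ^+ 2 <= 8 * D2.
      rewrite -[e i j ^+ 2]real_normK ?num_real//.
      have h1 : `|e i j| ^+ 2 <= (2 * D2) ^+ 2 by rewrite lerXn2r ?nnegrE// mulr_ge0.
      apply: le_trans h1 _.
      have : D2 * D2 <= D2 * 2 by apply: ler_wpM2l. rewrite expr2; lra.
    have -> : (A i j + e i j) ^+ 2 = 2 * A i j ^+ 2 + 2 * e i j ^+ 2 - (A i j - e i j) ^+ 2 by ring.
    have := Ab i j; have := sqr_ge0 (A i j - e i j); lra.
  have sumC (a : R) : \sum_(i < d) \sum_(j < d) a = (d * d)%:R * a.
    by rewrite !sumr_const !card_ord -mulrnA mulr_natl.
  have hD : \sum_i \sum_j (Q i j - (i == j)%:R) ^+ 2 <= (d * d)%:R * (24 * D2).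
    rewrite -sumC; apply: ler_sum => i _; apply: ler_sum => j _; exact: Db.
  have he : `|\sum_i \sum_j M x i j * e i j| <= (d * d)%:R * (B * (2 * D2)).
    rewrite -sumC; apply: le_trans (ler_norm_sum _ _ _) _; apply: ler_sum => i _.
    apply: le_trans (ler_norm_sum _ _ _) _; apply: ler_sum => j _.
    by rewrite normrM; apply: ler_pM => //; exact: MB.
  have -> : \sum_i \sum_j M x i j * (Q i j - (i == j)%:R) =
     dot g y + \sum_i \sum_j M x i j * e i j.
    rewrite gE -big_split /=; apply: eq_bigr => i _.
    by rewrite -big_split /=; apply: eq_bigr => j _; rewrite /e /A; ring.
  move=> h; have := ler_wpM2l L0 hD => h2.
  have -> : f y - f x - dot g y =
    (f y - f x - (dot g y + \sum_i \sum_j M x i j * e i j)) + \sum_i \sum_j M x i j * e i j by ring.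
  apply: le_trans (ler_normD _ _) _.
  apply: le_trans (lerD (le_trans h h2) he) _.
  by rewrite le_eqVlt; apply/orP; left; apply/eqP; rewrite /C; ring.
exists g; split => //.
set G := Num.sqrt (dot g g).
have G2 : G ^+ 2 = dot g g by rewrite sqr_sqrtr// dot_ge0.
rewrite -G2; suff : G <= l by move=> h; rewrite lerXn2r ?nnegrE ?sqrtr_ge0.
have [G0|G0] := leP G 0; first exact: le_trans G0 l0.
suff hs s : 0 < s -> s <= 1 -> G <= l + s * (l + 2 * C).
  apply/ler_addgt0Pr => e e0.
  have K1 : 0 < l + 2 * C + 1 by rewrite ltr_wpDl// addr_ge0// mulr_ge0.
  pose s := Num.min 1 (e / (l + 2 * C + 1)).
  have s0 : 0 < s by rewrite lt_min ltr01 divr_gt0.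
  have s1 : s <= 1 by rewrite ge_min lexx.
  have se : s <= e / (l + 2 * C + 1) by rewrite ge_min lexx orbT.
  apply: le_trans (hs s s0 s1) _; rewrite lerD2l.
  rewrite ler_pdivlMr// in se; lra.
move=> s0 s1.
have s2 : 0 < 1 + s ^+ 2 by rewrite ltr_pwDl// sqr_ge0.
have s2n : 1 + s ^+ 2 != 0 by rewrite lt0r_neq0.
have Gn : G != 0 by rewrite lt0r_neq0.
(* The rational parametrization of the great circle through [x] in the direction of [g]. Comparing
   the Lipschitz bound with the expansion and dividing by [s] gives [|g| <= l] in the limit. *)
pose y := lincomb ((1 - s ^+ 2) / (1 + s ^+ 2)) x (2 * s / ((1 + s ^+ 2) * G)) g.
have Sy : S y.
  rewrite /sphere /= /y !dotE gx (dotC x g) gx -G2 (_ : dot x x = 1)//.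
  by field; rewrite ?s2n ?Gn.
have xy : dot x y = (1 - s ^+ 2) / (1 + s ^+ 2).
  by rewrite /y dot_lincombr (dotC x g) gx (_ : dot x x = 1)//; ring.
have gy : dot g y = 2 * s * G / (1 + s ^+ 2).
  by rewrite /y dot_lincombr gx -G2; field; rewrite ?s2n ?Gn.
have xy0 : 0 <= dot x y.
  rewrite xy; apply: divr_ge0; last exact: ltW.
  by rewrite subr_ge0 expr_le1//; exact: ltW.
have := main y Sy xy0; have := fl x y Sx Sy xy0.
have -> : 2 - 2 * dot x y = 4 * s ^+ 2 / (1 + s ^+ 2) by rewrite xy; field; rewrite ?s2n.
have sq : Num.sqrt (4 * s ^+ 2 / (1 + s ^+ 2)) <= 2 * s.
  have s20 : 0 <= 2 * s by lra.
  rewrite -(@ler_pXn2r _ 2)// ?nnegrE ?sqrtr_ge0// sqr_sqrtr; last first.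
    by apply: divr_ge0; [rewrite mulr_ge0// sqr_ge0|exact: ltW].
  rewrite ler_pdivrMr//.
  have : 0 <= s ^+ 2 * s ^+ 2 by rewrite mulr_ge0 ?sqr_ge0.
  rewrite exprMn; lra.
move=> h1 h2; rewrite gy in h2.
have h3 := le_trans h1 (ler_wpM2l l0 sq).
move: h2 h3 => /ler_normlP[h2 _] /ler_normlP[h3 _].
have h4 : 2 * s * G / (1 + s ^+ 2) <= l * (2 * s) + C * (4 * s ^+ 2 / (1 + s ^+ 2)) by lra.
rewrite -(ler_pM2r s2) divfK// in h4.
have e5 : (l * (2 * s) + C * (4 * s ^+ 2 / (1 + s ^+ 2))) * (1 + s ^+ 2) =
  l * (2 * s) * (1 + s ^+ 2) + C * (4 * s ^+ 2) by field.
rewrite e5 in h4.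
have h5 : 2 * (s * G) <= 2 * (s * (l * (1 + s ^+ 2) + C * (2 * s))) by lra.
rewrite ler_pM2l// ler_pM2l// in h5.
apply: le_trans h5 _.
have : s ^+ 2 <= s by rewrite expr2 -[leRHS]mulr1 ler_pM2l.
move=> ss; have := ler_wpM2l l0 ss; lra.
Qed.

Section step.
Variable c : R.
Hypotheses (c0 : 0 <= c) (c1 : c < 1).
Local Notation P := (cap_average rho c).
Local Notation v := (cap_var rho c).

(** Expanding around [P f x] removes the linear term, and the mean square of [f y - f x] over the
    cap is that of [<g, y>] up to a cubic error in the chordal radius [h]. *)
Lemma one_step_exp B L l f h : 0 <= B -> 0 <= L -> 0 <= l ->
  bmf S f -> lip_on_sphere l f -> smooth_on_sphere B L f ->
  0 <= h -> h ^+ 2 = 2 - 2 * c -> h <= 1 -> 2 * l * h <= 1 / 3 ->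
  let C := (d * d)%:R * (2 * B + 24 * L) in
  forall x, S x -> P (fun y => expR (f y)) x <=
    expR (P f x + (l ^+ 2 * (v / m) + C * (2 * l + C) * h ^+ 3)).
Proof.
move=> B0 L0 l0 bf fl fs h0 h2 h1 lh C x Sx.
have C0 : 0 <= C by rewrite mulr_ge0 ?ler0n// addr_ge0// mulr_ge0.
have [g [gx gl gf]] := first_order_bound B0 L0 l0 fl fs Sx.
have capd y : S y -> c <= dot y x -> 0 <= dot x y /\ 2 - 2 * dot x y <= h ^+ 2.
  by rewrite dotC => Sy cy; split; [exact: le_trans cy|rewrite h2; lra].
have q1 y : S y -> c <= dot y x -> `|f y - f x| <= l * h.
  move=> Sy cy; have [xy0 xyh] := capd y Sy cy.
  rewrite distrC; apply: le_trans (fl x y Sx Sy xy0) _; apply: ler_wpM2l => //.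
  by rewrite -(ger0_norm h0) -sqrtr_sqr ler_sqrt// sqr_ge0.
set a := P f x; set b := f x.
have bfb : bmf S (fun y => f y - b) by apply: bmfB => //; exact: bmf_cst.
have ab : P (fun y => f y - b) x = a - b.
  by rewrite cap_averageB ?cap_average_cst//; exact: bmf_cst.
have abh : `|a - b| <= l * h by rewrite -ab; exact: norm_cap_average_le.
have bg2 : bmf S (fun y => dot g y ^+ 2) by apply: bmfX; exact: bmf_dotr.
have bfb2 : bmf S (fun y => (f y - b) ^+ 2) by exact: bmfX.
have Pq : P (fun y => (f y - b) ^+ 2) x <= l ^+ 2 * (v / m) + C * (2 * l + C) * h ^+ 3.
  apply: (@le_trans _ _ (P (fun y => dot g y ^+ 2 + C * (2 * l + C) * h ^+ 3) x)).
    apply: cap_average_le => //; first by apply: bmfD => //; exact: bmf_cst.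
    move=> y Sy cy; have [xy0 xyh] := capd y Sy cy.
    have := q1 y Sy cy; rewrite -/b; set q := f y - b => qh.
    have e1 : `|q - dot g y| <= C * h ^+ 2.
      by apply: le_trans (gf y Sy xy0) _; apply: ler_wpM2l.
    set p := dot g y in e1 *.
    have h23 : h ^+ 2 <= h by rewrite expr2 -[leRHS]mulr1 ler_wpM2l.
    have e2 : `|q + p| <= (2 * l + C) * h.
      have -> : q + p = q + q - (q - p) by ring.
      apply: le_trans (ler_normB _ _) _.
      have : `|q + q| <= 2 * (l * h).
        by apply: le_trans (ler_normD _ _) _; lra.
      have := ler_wpM2l C0 h23; lra.
    have : `|(q - p) * (q + p)| <= C * h ^+ 2 * ((2 * l + C) * h).
      by rewrite normrM; apply: ler_pM.
    move=> /ler_normlP[_].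
    have -> : (q - p) * (q + p) = q ^+ 2 - p ^+ 2 by ring.
    have -> : C * h ^+ 2 * ((2 * l + C) * h) = C * (2 * l + C) * h ^+ 3 by ring.
    lra.
  rewrite cap_averageD//; last exact: bmf_cst.
  rewrite cap_average_cst// lerD2r cap_average_orthogonal_sqr//.
  apply: ler_wpM2r => //; apply: divr_ge0; apply: ltW => //; exact: cap_var_gt0.
have ef y : S y -> c <= dot y x ->
    expR (f y) <= expR a * (1 - (a - b) ^+ 2 +
      (1 - 2 * (a - b)) * ((f y - b) - (a - b)) + (f y - b) ^+ 2).
  move=> Sy cy.
  have -> : expR (f y) = expR a * expR (f y - a) by rewrite -expRD; congr expR; ring.
  rewrite ler_pM2l ?expR_gt0//.
  have fa : f y - a <= 1 / 3.
    have -> : f y - a = (f y - b) - (a - b) by ring.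
    apply: le_trans (ler_norm _) _; apply: le_trans (ler_normB _ _) _.
    have := q1 y Sy cy; rewrite -/b; lra.
  apply: le_trans (expR_le_quad fa) _.
  by rewrite le_eqVlt; apply/orP; left; apply/eqP; ring.
apply: (@le_trans _ _ (expR a * (1 + P (fun y => (f y - b) ^+ 2) x))).
  apply: (@le_trans _ _ (P (fun y => expR a * (1 - (a - b) ^+ 2 +
      (1 - 2 * (a - b)) * ((f y - b) - (a - b)) + (f y - b) ^+ 2)) x)).
    apply: cap_average_le => //; first exact: bmf_expR.
      apply: bmfZ; apply: bmfD => //; apply: bmfD; first exact: bmf_cst.
      by apply: bmfZ; apply: bmfB => //; exact: bmf_cst.
  have b3 : bmf S (fun y => f y - b - (a - b)) by apply: bmfB => //; exact: bmf_cst.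
  have b4 := bmfZ (1 - 2 * (a - b)) b3.
  rewrite cap_averageZ//; last by apply: bmfD => //; apply: bmfD => //; exact: bmf_cst.
  rewrite ler_pM2l ?expR_gt0// cap_averageD//; last by apply: bmfD => //; exact: bmf_cst.
  rewrite cap_averageD//; last exact: bmf_cst.
  rewrite cap_average_cst// cap_averageZ//.
  rewrite [P (fun y => f y - b - (a - b)) x]cap_averageB//; last exact: bmf_cst.
  rewrite ab cap_average_cst// subrr mulr0 addr0 lerD2r.
  by rewrite lerBlDr lerDl sqr_ge0.
rewrite expRD ler_pM2l ?expR_gt0//.
by apply: le_trans (expR_ge1Dx _); rewrite lerD2l.
Qed.

End step.
End one_step.

(** * Concentration on the sphere *)

Section iteration.
Context {R : realType} {n : nat}.
Local Notation d := n.+2.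
Local Notation T := (d.-tuple R).
Variable rho : probability T R.
Hypothesis unif : uniform_sphere rho.
Local Notation S := (sphere R d).
Local Notation E := (Ex rho S).
Local Notation mS := (@measurable_sphere R d).
Local Notation m := (n.+1%:R : R).
Let PS : rho S = 1%E. Proof. by case: unif. Qed.
Let m0 : 0 < m. Proof. by rewrite ltr0n. Qed.
Hypothesis n0 : (0 < n)%N.
Let nr0 : 0 < n%:R :> R. Proof. by rewrite ltr0n. Qed.

(* [lip_on_sphere] only compares points at an acute angle, hence the detours through
   basis vectors. *)
Lemma lip_oscillation l f : 0 <= l -> bmf S f -> lip_on_sphere l f ->
  forall x, S x -> `|f x - E f| <= 8 * l.
Proof.
move=> l0 bf fl.
pose e1 : T := basis_vec ord0; pose e2 : T := basis_vec (lift ord0 ord0).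
have S1 : S e1 by exact: basis_sphere.
have loc x y : S x -> S y -> 0 <= dot x y -> `|f x - f y| <= 2 * l.
  move=> Sx Sy xy; apply: le_trans (fl x y Sx Sy xy) _; rewrite mulrC.
  apply: ler_wpM2r => //; rewrite -(@ler_pXn2r _ 2)// ?nnegrE ?sqrtr_ge0//.
  have := norm_dot_le1 Sx Sy => /ler_normlP[_ h].
  by rewrite sqr_sqrtr; lra.
have half x : S x -> `|f x - f e1| <= 4 * l.
  move=> Sx.
  have [x0|x0] := leP 0 (dot x e1); first by apply: le_trans (loc _ _ Sx S1 x0) _; lra.
  pose s : R := if 0 <= dot x e2 then 1 else -1.
  pose z := lincomb s e2 0 e2.
  have e22 : dot e2 e2 = 1 by exact: basis_sphere.
  have Sz : S z.
    rewrite /sphere /= /z !dotE e22 /s; case: ifP => _; ring.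
  have xz : 0 <= dot x z.
    rewrite /z dot_lincombr mul0r addr0 /s; case: ifPn; first by rewrite mul1r.
    by rewrite -ltNge mulN1r oppr_ge0 => /ltW.
  have ze : 0 <= dot z e1.
    rewrite /z dot_lincombl mul0r addr0 (_ : dot e2 e1 = 0) ?mulr0//.
    by rewrite dot_basis tnth_mktuple.
  have := loc x z Sx Sz xz; have := loc z e1 Sz S1 ze => h1 h2.
  have -> : f x - f e1 = (f x - f z) + (f z - f e1) by ring.
  by apply: le_trans (ler_normD _ _) _; lra.
move=> x Sx.
rewrite -{1}(Ex_cst mS PS (f x)) -(ExB _ mS)//; last exact: bmf_cst.
apply: (norm_Ex_le mS PS); first by apply: bmfB => //; exact: bmf_cst.
move=> y Sy; have := half x Sx; have := half y Sy; rewrite distrC => h1 h2.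
have -> : f x - f y = (f x - f e1) + (f e1 - f y) by ring.
by apply: le_trans (ler_normD _ _) _; lra.
Qed.

Section fixed_radius.
Variables (B L l h c : R).
Hypotheses (B0 : 0 <= B) (L0 : 0 <= L) (l0 : 0 <= l).
Hypotheses (c0 : 0 <= c) (c1 : c < 1).
Hypotheses (h0 : 0 <= h) (h2 : h ^+ 2 = 2 - 2 * c) (h1 : h <= 1) (lh : 2 * l * h <= 1 / 3).
Local Notation P := (cap_average rho c).
Local Notation v := (cap_var rho c).
Local Notation r2 := (1 - v + v / m).
Local Notation C := ((d * d)%:R * (2 * B + 24 * L)).

Lemma contraction_sqr_ge0 : 0 <= r2.
Proof.
apply: addr_ge0; first by rewrite subr_ge0; exact: cap_var_le1.
by apply: divr_ge0; apply: ltW => //; exact: cap_var_gt0.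
Qed.

Lemma contraction_sqrE : r2 = 1 - v * n%:R / m.
Proof. by have := m0; rewrite -natr1 => ?; field; rewrite lt0r_neq0. Qed.

Lemma contraction_sqr_le1 : r2 <= 1.
Proof.
rewrite contraction_sqrE lerBlDr lerDl; apply: divr_ge0; last exact: ltW.
by apply: mulr_ge0; apply: ltW => //; exact: cap_var_gt0.
Qed.

(** [v >= (1 - c) / 4], and [n / m >= 1 / 2] because [n >= 1]. For [n = 0] the factor [r2] would
    equal 1: on the circle the coupling displaces all points equally. *)
Lemma contraction_sqr_le_exp : r2 <= expR (- ((1 - c) / 8)).
Proof.
apply: le_trans (expR_ge1Dx _); rewrite contraction_sqrE lerD2l lerN2 -mulrA.
have n2 : 1 / 2 <= n%:R / m.
  have nr1 : 1 <= n%:R :> R by rewrite ler1n.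
  rewrite ler_pdivlMr// -[n.+1%:R]natr1; lra.
rewrite (_ : (1 - c) / 8 = (1 - c) / 4 * (1 / 2)); last by field.
by apply: ler_pM => //; [rewrite divr_ge0// subr_ge0 ltW|exact: cap_var_ge].
Qed.

(** Step [k] costs [l^2 * r2^k * v / m], and [v / m = (1 - r2) / n], so the main costs telescope.
    The cubic errors merely add up, with the same [C] at every step. *)
Lemma iter_cap_average f k : bmf S f -> lip_on_sphere l f -> smooth_on_sphere B L f ->
  let fk := iter k P f in
  [/\ bmf S fk, lip_on_sphere (l * Num.sqrt r2 ^+ k) fk, smooth_on_sphere B L fk,
      E fk = E f &
      E (fun x => expR (f x)) <= E (fun x => expR (fk x)) *
        expR (l ^+ 2 / n%:R * (1 - r2 ^+ k) + k%:R * (C * (2 * l + C) * h ^+ 3))].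
Proof.
move=> bf fl fs; elim: k => [|k [b1 b2 b3 b4 b5]] /=.
  split => //; first by rewrite expr0 mulr1.
  by rewrite expr0 subrr mulr0 mul0r addr0 expR0 mulr1.
have r0 := contraction_sqr_ge0; have r1 := contraction_sqr_le1.
have rk0 : 0 <= Num.sqrt r2 ^+ k by rewrite exprn_ge0// sqrtr_ge0.
have rk1 : Num.sqrt r2 ^+ k <= 1.
  by apply: exprn_ile1; [exact: sqrtr_ge0|rewrite -[leRHS]sqrtr1 ler_sqrt].
have lk0 : 0 <= l * Num.sqrt r2 ^+ k by rewrite mulr_ge0.
have lkl : l * Num.sqrt r2 ^+ k <= l by rewrite -[leRHS]mulr1 ler_wpM2l.
split.
- exact: cap_average_bmf.
- by rewrite exprSr mulrA; exact: cap_average_lip.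
- exact: cap_average_smooth.
- by rewrite Ex_cap_average.
apply: (le_trans b5).
have lkh : 2 * (l * Num.sqrt r2 ^+ k) * h <= 1 / 3.
  by apply: le_trans lh; apply: ler_wpM2r => //; apply: ler_wpM2l.
have := one_step_exp unif c0 c1 B0 L0 lk0 b1 b2 b3 h0 h2 h1 lkh => /= step.
have C0 : 0 <= C by rewrite mulr_ge0 ?ler0n// addr_ge0// mulr_ge0.
set K := C * (2 * l + C) * h ^+ 3.
set s := l ^+ 2 * r2 ^+ k * (v / m) + K.
have stepE : E (fun x => expR (iter k P f x)) <= expR s * E (fun x => expR (P (iter k P f) x)).
  rewrite -(Ex_cap_average unif c0 c1); last exact: bmf_expR.
  rewrite -(ExZ _ mS); last by apply: bmf_expR; exact: cap_average_bmf.
  apply: (le_Ex rho mS).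
  - by apply: cap_average_bmf => //; exact: bmf_expR.
  - by apply: bmfZ; apply: bmf_expR; exact: cap_average_bmf.
  move=> x Sx; apply: le_trans (step x Sx) _; rewrite -expRD ler_expR addrC lerD2r.
  rewrite exprMn -exprM mulnC exprM sqr_sqrtr// lerD2l /K.
  apply: ler_wpM2r; first exact: exprn_ge0.
  by apply: ler_wpM2l => //; rewrite lerD2r; apply: ler_wpM2l.
apply: le_trans (ler_wpM2r (expR_ge0 _) stepE) _.
rewrite mulrAC mulrC -expRD; apply: ler_wpM2l.
  by apply: Ex_ge0 => x _; exact: expR_ge0.
rewrite ler_expR /s -/K -[k.+1%:R]natr1 [r2 ^+ k.+1]exprSr.
have -> : r2 ^+ k * r2 = r2 ^+ k - r2 ^+ k * (v * n%:R / m) by rewrite contraction_sqrE; ring.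
rewrite le_eqVlt; apply/orP; left; apply/eqP.
by field; rewrite !lt0r_neq0.
Qed.

End fixed_radius.

(* [N^5] averages over caps of radius [N^-2]: the accumulated cubic errors are of order
   [N^5 * N^-6], while the Lipschitz constant is contracted by [expR (- N / 32)]. *)
Lemma exp_concentration B L l f : 0 <= B -> 0 <= L -> 0 <= l ->
  bmf S f -> lip_on_sphere l f -> smooth_on_sphere B L f ->
  E (fun x => expR (f x - E f)) <= expR (l ^+ 2 / n%:R).
Proof.
move=> B0 L0 l0 bf fl fs; apply: le_expR_lim => e e0.
set C := (d * d)%:R * (2 * B + 24 * L).
have C0 : 0 <= C by rewrite mulr_ge0 ?ler0n// addr_ge0// mulr_ge0.
set K := C * (2 * l + C).
have K0 : 0 <= K by rewrite mulr_ge0// addr_ge0// mulr_ge0.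
pose q := e / (2 * (8 * l + 1)).
have q0 : 0 < q by rewrite divr_gt0// mulr_gt0// ltr_wpDl// mulr_ge0.
have lq : 8 * l * q <= e / 2.
  rewrite /q mulrA ler_pdivrMr ?mulr_gt0 ?ltr_wpDl ?mulr_ge0//.
  have : 0 <= l * e by rewrite mulr_ge0// ltW.
  lra.
(* The summands ensure, in order, [2 * l * h <= 1 / 3], [1 <= N], a contraction factor of at most
   [q] after [N^5] steps, and a total cubic error of at most [e / 2]. *)
pose N := (Num.truncn (6 * l + 1 + 16 / q ^+ 2 + 2 * K / e)).+1.
have Nb : 6 * l + 1 + 16 / q ^+ 2 + 2 * K / e < N%:R by exact: truncnS_gt.
have a1 : 0 <= 16 / q ^+ 2 by rewrite divr_ge0// sqr_ge0.
have a2 : 0 <= 2 * K / e by apply: divr_ge0; [exact: mulr_ge0|exact: ltW].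
have a3 : 0 <= 6 * l by rewrite mulr_ge0.
set x := (N%:R : R) in Nb.
have xK : 2 * K / e <= x by lra.
have xq : 16 / q ^+ 2 <= x by lra.
have x1 : 1 <= x by lra.
have x0 : 0 < x by lra.
have xn : x != 0 by rewrite lt0r_neq0.
pose h := x ^- 2.
pose c := 1 - x ^- 4 / 2.
have x4 : 0 < x ^- 4 by rewrite invr_gt0 exprn_gt0.
have x41 : x ^- 4 <= 1 by rewrite invf_le1 ?exprn_gt0// exprn_ege1.
have c0 : 0 <= c by rewrite /c; lra.
have c1 : c < 1 by rewrite /c; lra.
have h0 : 0 <= h by rewrite invr_ge0 exprn_ge0// ltW.
have h1 : h <= 1 by rewrite invf_le1 ?exprn_gt0// exprn_ege1.
have h2 : h ^+ 2 = 2 - 2 * c by rewrite /h /c; field.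
have xx2 : x <= x ^+ 2 by rewrite expr2 -[leLHS]mulr1 ler_wpM2l// ltW.
have lh : 2 * l * h <= 1 / 3.
  rewrite /h ler_pdivrMr ?exprn_gt0//; lra.
have [b1 b2 b3 b4 b5] := iter_cap_average B0 L0 l0 c0 c1 h0 h2 h1 lh (N ^ 5) bf fl fs.
move: b1 b2 b4 b5; set g := iter _ _ f; set r2 := 1 - _ + _ => b1 b2 b4 b5.
have r20 : 0 <= r2 by exact: contraction_sqr_ge0.
have r2e : r2 <= expR (- (x ^- 4 / 16)).
  have -> : x ^- 4 / 16 = (1 - c) / 8 by rewrite /c; field.
  exact: contraction_sqr_le_exp.
have r2k : r2 ^+ (N ^ 5) <= 16 / x.
  apply: (@le_trans _ _ (expR (- (x / 16)))).
    apply: (@le_trans _ _ (expR (- (x ^- 4 / 16)) ^+ (N ^ 5))).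
      by rewrite lerXn2r ?nnegrE// expR_ge0.
    rewrite -expRM_natl ler_expR natrX -/x le_eqVlt; apply/orP; left; apply/eqP.
    by field.
  rewrite expRN -[leRHS]invrK invf_div lef_pV2 ?posrE ?expR_gt0 ?divr_gt0//.
  by apply: le_trans (expR_ge1Dx _); rewrite lerDr.
have rk : Num.sqrt r2 ^+ (N ^ 5) <= q.
  rewrite -(@ler_pXn2r _ 2)// ?nnegrE ?exprn_ge0 ?sqrtr_ge0 ?(ltW q0)//.
  rewrite -exprM mulnC exprM sqr_sqrtr//; apply: le_trans r2k _.
  rewrite ler_pdivrMr// mulrC -ler_pdivrMr ?exprn_gt0//.
have osc y : S y -> g y <= E f + 8 * l * q.
  move=> Sy; rewrite -b4.
  have lr0 : 0 <= l * Num.sqrt r2 ^+ (N ^ 5) by rewrite mulr_ge0 ?exprn_ge0 ?sqrtr_ge0.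
  have := lip_oscillation lr0 b1 b2 Sy => /ler_normlP[_ hh].
  rewrite -lerBlDl; apply: le_trans hh _; rewrite -mulrA.
  by apply: ler_wpM2l => //; exact: ler_wpM2l.
have Eg : E (fun y => expR (g y)) <= expR (E f + 8 * l * q).
  rewrite -[leRHS](Ex_cst mS PS); apply: (le_Ex rho mS).
  - exact: bmf_expR.
  - exact: bmf_cst.
  by move=> y Sy; rewrite ler_expR; exact: osc.
rewrite (@eq_Ex _ _ _ _ _ _ (fun y => expR (- E f) * expR (f y))); last first.
  by move=> y _; rewrite -expRD addrC.
rewrite (ExZ _ mS); last exact: bmf_expR.
apply: le_trans (ler_wpM2l (expR_ge0 _) b5) _.
apply: le_trans (ler_wpM2l (expR_ge0 _) (ler_wpM2r (expR_ge0 _) Eg)) _.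
rewrite -!expRD ler_expR -/C -/K.
have -> : (N ^ 5)%:R * (K * h ^+ 3) = K / x by rewrite natrX -/x /h; field.
have Kx : K / x <= e / 2.
  rewrite ler_pdivrMr// mulrC -ler_pdivrMr ?divr_gt0//.
  by have -> : K / (e / 2) = 2 * K / e by field; rewrite lt0r_neq0.
have ln0 : 0 <= l ^+ 2 / n%:R by apply: divr_ge0; [exact: sqr_ge0|exact: ltW].
have lr : l ^+ 2 / n%:R * (1 - r2 ^+ (N ^ 5)) <= l ^+ 2 / n%:R.
  by rewrite -[leRHS]mulr1; apply: ler_wpM2l => //; rewrite lerBlDr lerDl exprn_ge0.
rewrite -!addrA addKr addrCA; apply: lerD => //.
by rewrite [leRHS]splitr; exact: lerD.
Qed.

End iteration.

(** * Calculus of functions smooth along rotations *)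

Section smooth_calculus.
Context {R : realType} {n : nat}.
Local Notation d := n.+2.
Local Notation T := (d.-tuple R).
Local Notation S := (sphere R d).

Definition frob (Q : 'M[R]_d) : R := \sum_i \sum_j (Q i j - (i == j)%:R) ^+ 2.
Definition pairing (M : 'I_d -> 'I_d -> R) (Q : 'M[R]_d) : R :=
  \sum_i \sum_j M i j * (Q i j - (i == j)%:R).

(** The bound [K] on squared increments is added to [smooth_on_sphere] for the chain rule: it
    absorbs the quadratic Taylor remainder of the outer function. *)
Definition smooth (f : T -> R) := bmf S f /\ exists B L K M,
  [/\ 0 <= B, 0 <= L, 0 <= K, forall i j, bmf S (fun x => M x i j) &
   [/\ forall x i j, S x -> `|M x i j| <= B,
      forall x (Q : 'M[R]_d), S x -> orthogonal_mx Q ->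
        `|f (mxact Q x) - f x - pairing (M x) Q| <= L * frob Q &
      forall x (Q : 'M[R]_d), S x -> orthogonal_mx Q ->
        (f (mxact Q x) - f x) ^+ 2 <= K * frob Q]].

Lemma smooth_smooth_on_sphere f : smooth f ->
  exists B L, [/\ 0 <= B, 0 <= L & smooth_on_sphere B L f].
Proof.
by move=> [bf [B [L [K [M [B0 L0 K0 bM [MB fM _]]]]]]]; exists B, L; split => //; exists M.
Qed.

Lemma frob_ge0 Q : 0 <= frob Q.
Proof. by apply: sumr_ge0 => i _; apply: sumr_ge0 => j _; exact: sqr_ge0. Qed.

Lemma le_frob (Q : 'M[R]_d) i j : (Q i j - (i == j)%:R) ^+ 2 <= frob Q.
Proof.
rewrite /frob (bigD1 i)//= (bigD1 j)//= -addrA lerDl addr_ge0//.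
  by apply: sumr_ge0 => k _; exact: sqr_ge0.
by apply: sumr_ge0 => k _; apply: sumr_ge0 => l _; exact: sqr_ge0.
Qed.

Lemma pairing_scale a (M : 'I_d -> 'I_d -> R) Q :
  pairing (fun i j => a * M i j) Q = a * pairing M Q.
Proof.
rewrite /pairing mulr_sumr; apply: eq_bigr => i _.
by rewrite mulr_sumr; apply: eq_bigr => j _; rewrite mulrA.
Qed.

Lemma pairing_add (M N : 'I_d -> 'I_d -> R) Q :
  pairing (fun i j => M i j + N i j) Q = pairing M Q + pairing N Q.
Proof.
rewrite /pairing -big_split /=; apply: eq_bigr => i _.
by rewrite -big_split /=; apply: eq_bigr => j _; rewrite mulrDl.
Qed.

Lemma smooth_cst a : smooth (fun=> a).
Proof.
split; first exact: bmf_cst.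
exists 0, 0, 0, (fun _ _ _ => 0); split => //; first by move=> *; exact: bmf_cst.
split => [x i j _|x Q _ _|x Q _ _]; first by rewrite normr0.
  rewrite subrr sub0r normrN mul0r /pairing big1 ?normr0// => i _.
  by rewrite big1// => j _; rewrite mul0r.
by rewrite subrr expr0n mul0r.
Qed.

Lemma smooth_dot (a : T) : S a -> smooth (fun x => dot x a).
Proof.
move=> Sa; split; first exact: bmf_dot.
pose M (x : T) (i j : 'I_d) := tnth a i * tnth x j.
have pE x Q : dot (mxact Q x) a - dot x a = pairing (M x) Q.
  rewrite /dot -sumrB; apply: eq_bigr => i _.
  rewrite tnth_mktuple -mulrBl mulrC.
  have -> : \sum_j Q i j * tnth x j - tnth x i = \sum_j (Q i j - (i == j)%:R) * tnth x j.
    under [RHS]eq_bigr do rewrite mulrBl.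
    rewrite sumrB; congr (_ - _); rewrite (bigD1 i)//= eqxx mul1r big1 ?addr0// => j /negbTE ji.
    by rewrite eq_sym ji mul0r.
  rewrite mulr_sumr; apply: eq_bigr => j _; rewrite /M; ring.
exists 1, 0, ((d * d)%:R ^+ 2), M; split => //.
- by move=> i j; apply: bmfZ; exact: bmf_coord.
split.
- move=> x i j Sx; rewrite /M normrM -[leRHS]mulr1.
  by apply: ler_pM => //; exact: sphere_coord.
- by move=> x Q _ _; rewrite pE subrr normr0 mul0r.
move=> x Q Sx QQ; rewrite pE.
set F := Num.sqrt (frob Q).
have F2 : F ^+ 2 = frob Q by rewrite sqr_sqrtr// frob_ge0.
have F0 : 0 <= F by exact: sqrtr_ge0.
rewrite -F2 -exprMn -[leLHS]real_normK ?num_real//.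
rewrite lerXn2r ?nnegrE ?mulr_ge0//.
have -> : (d * d)%:R * F = \sum_(i < d) \sum_(j < d) F.
  by rewrite !sumr_const !card_ord -mulrnA mulr_natl.
apply: le_trans (ler_norm_sum _ _ _) _; apply: ler_sum => i _.
apply: le_trans (ler_norm_sum _ _ _) _; apply: ler_sum => j _.
rewrite /M normrM normrM -[leRHS]mul1r; apply: ler_pM; rewrite ?mulr_ge0//.
  by rewrite -[leRHS]mulr1; apply: ler_pM => //; exact: sphere_coord.
rewrite -(@ler_pXn2r _ 2)// ?nnegrE// F2 real_normK ?num_real//.
exact: le_frob.
Qed.

Lemma smoothD f g : smooth f -> smooth g -> smooth (fun x => f x + g x).
Proof.
move=> [bf [B [L [K [M [B0 L0 K0 bM [MB fM fK]]]]]]] [bg [B' [L' [K' [M' [B0' L0' K0' bM' [MB' fM' fK']]]]]]].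
split; first exact: bmfD.
exists (B + B'), (L + L'), (2 * K + 2 * K'), (fun x i j => M x i j + M' x i j).
split; rewrite ?addr_ge0 ?mulr_ge0//; first by move=> i j; exact: bmfD.
split.
- move=> x i j Sx; apply: le_trans (ler_normD _ _) _.
  by apply: lerD; [exact: MB|exact: MB'].
- move=> x Q Sx QQ; rewrite pairing_add.
  have -> : f (mxact Q x) + g (mxact Q x) - (f x + g x) - (pairing (M x) Q + pairing (M' x) Q) =
    (f (mxact Q x) - f x - pairing (M x) Q) + (g (mxact Q x) - g x - pairing (M' x) Q) by ring.
  by rewrite mulrDl; apply: le_trans (ler_normD _ _) _; apply: lerD; [exact: fM|exact: fM'].
- move=> x Q Sx QQ; have := fK x Q Sx QQ; have := fK' x Q Sx QQ.
  set u := g _ - g x; set w := f _ - f x.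
  have -> : f (mxact Q x) + g (mxact Q x) - (f x + g x) = w + u by rewrite /w /u; ring.
  have -> : (w + u) ^+ 2 = 2 * w ^+ 2 + 2 * u ^+ 2 - (w - u) ^+ 2 by ring.
  have := sqr_ge0 (w - u); lra.
Qed.

Lemma smooth_comp (f : T -> R) (phi phi' : R -> R) (I : set R) (A D : R) :
  smooth f -> (forall x, S x -> I (f x)) -> 0 <= A -> 0 <= D ->
  bmf S (fun x => phi (f x)) -> bmf S (fun x => phi' (f x)) ->
  (forall u, I u -> `|phi' u| <= D) ->
  (forall u w, I u -> I w -> `|phi w - phi u - phi' u * (w - u)| <= A * (w - u) ^+ 2) ->
  (forall u w, I u -> I w -> `|phi w - phi u| <= D * `|w - u|) ->
  smooth (fun x => phi (f x)).
Proof.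
move=> [bf [B [L [K [M [B0 L0 K0 bM [MB fM fK]]]]]]] fI A0 D0 bp bp' pD pA pL.
split=> //; exists (D * B), (A * K + D * L), (D ^+ 2 * K), (fun x i j => phi' (f x) * M x i j).
split; rewrite ?addr_ge0 ?mulr_ge0 ?sqr_ge0//; first by move=> i j; exact: bmfM.
split.
- move=> x i j Sx; rewrite normrM; apply: ler_pM => //; last exact: MB.
  by apply: pD; exact: fI.
- move=> x Q Sx QQ; have SQx : S (mxact Q x) by rewrite sphere_mxact.
  rewrite pairing_scale.
  set u := f x; set w := f (mxact Q x).
  have -> : phi w - phi u - phi' u * pairing (M x) Q =
    (phi w - phi u - phi' u * (w - u)) + phi' u * (w - u - pairing (M x) Q) by ring.
  apply: le_trans (ler_normD _ _) _; rewrite mulrDl; apply: lerD.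
    apply: le_trans (pA u w (fI _ Sx) (fI _ SQx)) _; rewrite -mulrA.
    by apply: ler_wpM2l => //; exact: fK.
  rewrite normrM -mulrA; apply: ler_pM => //; last exact: fM.
  by apply: pD; exact: fI.
- move=> x Q Sx QQ; have SQx : S (mxact Q x) by rewrite sphere_mxact.
  have := pL _ _ (fI _ Sx) (fI _ SQx).
  move=> h; rewrite -[leLHS]real_normK ?num_real//.
  apply: (@le_trans _ _ ((D * `|f (mxact Q x) - f x|) ^+ 2)).
    by rewrite lerXn2r ?nnegrE// mulr_ge0.
  rewrite exprMn real_normK ?num_real// -[leRHS]mulrA.
  by apply: ler_wpM2l; [exact: sqr_ge0|exact: fK].
Qed.

Lemma smoothZ a f : smooth f -> smooth (fun x => a * f x).
Proof.
move=> sf; apply: (@smooth_comp f (fun u => a * u) (fun=> a) setT 0 `|a|) => //.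
- by apply: bmfZ; case: sf.
- exact: bmf_cst.
- by move=> u w _ _; rewrite mul0r -mulrBr subrr normr0.
- by move=> u w _ _; rewrite -mulrBr normrM.
Qed.

Lemma smooth_sum (I : Type) (r : seq I) (F : I -> T -> R) :
  (forall i, smooth (F i)) -> smooth (fun x => \sum_(i <- r) F i x).
Proof.
move=> sF; elim: r => [|i r IH].
  by under eq_fun do rewrite big_nil; exact: smooth_cst.
by under eq_fun do rewrite big_cons; exact: smoothD.
Qed.

Lemma smooth_bounded f : smooth f -> exists2 F, 0 <= F & forall x, S x -> `|f x| <= F.
Proof.
move=> [[_ [F fF]] _]; exists `|F| => // x Sx; exact: le_trans (fF x Sx) (ler_norm _).
Qed.

Lemma smooth_expR f : smooth f -> smooth (fun x => expR (f x)).
Proof.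
move=> sf; have [F F0 fF] := smooth_bounded sf.
have bf : bmf S f by case: sf.
apply: (@smooth_comp f expR expR [set u | `|u| <= F] (expR F * expR (2 * F)) (expR F)) => //;
  rewrite ?mulr_ge0 ?expR_ge0//; do ?exact: bmf_expR.
- by move=> u /ler_normlP[_ uF]; rewrite ger0_norm ?expR_ge0// ler_expR.
- move=> u w /= uF wF.
  have -> : expR w = expR u * expR (w - u) by rewrite -expRD; congr expR; ring.
  set t := w - u.
  have tF : `|t| <= 2 * F by apply: le_trans (ler_normB _ _) _; lra.
  have -> : expR u * expR t - expR u - expR u * t = expR u * (expR t - 1 - t) by ring.
  rewrite normrM ger0_norm ?expR_ge0// -mulrA; apply: ler_pM; rewrite ?expR_ge0//.
    by move: uF => /ler_normlP[_ uF]; rewrite ler_expR.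
  rewrite ger0_norm; last by have := expR_ge1Dx t; lra.
  have h1 : expR t - 1 - t <= t * (expR t - 1).
    have := expR_ge1Dx (- t); have := expR_gt0 t => e0 e1.
    have := ler_wpM2l (ltW e0) e1; rewrite -expRD subrr expR0; lra.
  apply: le_trans h1 _; apply: le_trans (ler_norm _) _; rewrite normrM.
  rewrite -[t ^+ 2]real_normK ?num_real// expr2 mulrCA; apply: ler_wpM2l => //.
  have t2 : t <= 2 * F by exact: le_trans (ler_norm _) tF.
  have F2 : (0 : R) <= 2 * F by rewrite mulr_ge0.
  have := exp_lipschitz t2 F2; rewrite expR0 subr0 => h; apply: le_trans h _.
  by rewrite lexx.
- move=> u w /ler_normlP[_ uF] /ler_normlP[_ wF].
  exact: exp_lipschitz.
Qed.

Lemma smooth_ln f (a : R) : 0 < a -> (forall x, S x -> a <= f x) ->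
  smooth f -> smooth (fun x => ln (f x)).
Proof.
move=> a0 af sf; have [F F0 fF] := smooth_bounded sf.
have bf : bmf S f by case: sf.
have ain : 0 <= a^-1 by rewrite invr_ge0 ltW.
have ln1 (t : R) : 0 < t -> ln t <= t - 1.
  by move=> t0; have := expR_ge1Dx (ln t); rewrite lnK//; lra.
have lnb (u w : R) : a <= u -> a <= w ->
    (w - u) / w <= ln w - ln u /\ ln w - ln u <= (w - u) / u.
  move=> au aw; have u0 : 0 < u by exact: lt_le_trans au.
  have w0 : 0 < w by exact: lt_le_trans aw.
  rewrite -ln_div ?posrE//; split; last first.
    by apply: le_trans (ln1 _ _) _; rewrite ?divr_gt0// mulrBl divff// lt0r_neq0.
  have -> : ln (w / u) = - ln (u / w) by rewrite -lnV ?posrE ?divr_gt0// invf_div.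
  rewrite lerNr; apply: le_trans (ln1 _ _) _; first exact: divr_gt0.
  by rewrite mulrBl divff ?lt0r_neq0// opprB.
have bln : bmf S (fun x => ln (f x)).
  split; first by apply: measurableT_comp; [exact: measurable_ln|case: bf].
  exists (Num.max `|ln a| F) => x Sx.
  have fx := af x Sx; have f0 := lt_le_trans a0 fx.
  rewrite ler_norml; apply/andP; split.
    have : ln a <= ln (f x) by rewrite ler_ln.
    have := ler_norm (- ln a); rewrite normrN => h1 h2.
    rewrite lerNl le_max; apply/orP; left; lra.
  rewrite le_max; apply/orP; right; have := ln1 _ f0; have := fF x Sx.
  move=> /ler_normlP[_ h1] h2; lra.
(* The derivative [1 / u] is written [expR (- ln u)], so that its measurability and boundedness
   follow from those of [ln (f x)]. *)
apply: (@smooth_comp f (fun u => ln u) (fun u => expR (- ln u)) [set u | a <= u] (a^-1 ^+ 2) a^-1) => //.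
- by rewrite sqr_ge0.
- by apply: bmf_expR; exact: bmfN.
- move=> u /= au; have u0 : 0 < u by exact: lt_le_trans au.
  rewrite ger0_norm ?expR_ge0// expRN lnK// lef_pV2//.
- move=> u w /= au aw; have [h1 h2] := lnb u w au aw.
  have u0 : 0 < u by exact: lt_le_trans au.
  have w0 : 0 < w by exact: lt_le_trans aw.
  rewrite expRN lnK// ler0_norm; last by rewrite mulrC; lra.
  have h3 : - (ln w - ln u - u^-1 * (w - u)) <= (w - u) ^+ 2 / (u * w).
    have -> : (w - u) ^+ 2 / (u * w) = (w - u) / u - (w - u) / w.
      by field; rewrite !lt0r_neq0.
    rewrite [_^-1 * _]mulrC; lra.
  apply: le_trans h3 _; rewrite mulrC; apply: ler_wpM2r; first exact: sqr_ge0.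
  rewrite invfM expr2; apply: ler_pM; rewrite ?invr_ge0 ?(ltW u0) ?(ltW w0)//.
    by rewrite lef_pV2.
  by rewrite lef_pV2.
- move=> u w /= au aw; have [h1 h2] := lnb u w au aw.
  have u0 : 0 < u by exact: lt_le_trans au.
  have w0 : 0 < w by exact: lt_le_trans aw.
  have iu : u^-1 <= a^-1 by rewrite lef_pV2.
  have iw : w^-1 <= a^-1 by rewrite lef_pV2.
  have iu0 : 0 <= u^-1 by rewrite invr_ge0 ltW.
  have iw0 : 0 <= w^-1 by rewrite invr_ge0 ltW.
  rewrite ler_norml; apply/andP; split.
    apply: le_trans h1; rewrite lerNl -mulNr; apply: (@le_trans _ _ (`|w - u| * w^-1)).
      by apply: ler_wpM2r => //; rewrite -normrN ler_norm.
    by rewrite mulrC; apply: ler_wpM2r.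
  apply: le_trans h2 _; apply: (@le_trans _ _ (`|w - u| * u^-1)).
    by apply: ler_wpM2r => //; exact: ler_norm.
  by rewrite mulrC; apply: ler_wpM2r.
Qed.

End smooth_calculus.

(** * Soft distance to a set and separated sets *)

Section soft_distance.
Context {R : realType} {n : nat}.
Local Notation d := n.+2.
Local Notation T := (d.-tuple R).
Local Notation S := (sphere R d).

(** In a grid of side [1 / K], one point of [A] is kept in each cell that meets [A]; points sharing
    a cell are at squared distance at most [d / K^2]. Finiteness makes the soft minimum a finite
    sum. *)
Lemma finite_net (A : set T) (e : R) : 0 < e -> A `<=` S ->
  exists s : seq T, (forall a, a \in s -> A a) /\
    (forall x, A x -> exists2 a, a \in s & 2 - 2 * dot x a <= e).
Proof.
move=> e0 AS.
pose K := (Num.truncn (d%:R / e + 1)).+1.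
have Kb : d%:R / e + 1 < K%:R by exact: truncnS_gt.
have de0 : 0 <= d%:R / e by rewrite divr_ge0// ltW.
have K1 : 1 <= K%:R :> R by rewrite ler1n.
have K0 : 0 < K%:R :> R by rewrite ltr0n.
(* [(x_i + 1) * K] ranges over the closed interval from 0 to [2 K], hence [2 K + 1] cells per
   axis. *)
pose cell (x : T) : {ffun 'I_d -> 'I_(2 * K).+1} :=
  [ffun i => inord (Num.truncn ((tnth x i + 1) * K%:R))].
pose pickc c : T := xget (basis_vec ord0) [set x | A x /\ cell x = c].
pose s := [seq pickc c | c <- enum {ffun 'I_d -> 'I_(2 * K).+1} & `[< exists x, A x /\ cell x = c >]].
have pickP c : (exists x, A x /\ cell x = c) -> A (pickc c) /\ cell (pickc c) = c.
  by move=> [x Ax]; apply: (xgetPex (basis_vec ord0) (P := [set x | A x /\ cell x = c])); exists x.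
exists s; split.
  move=> a /mapP[c]; rewrite mem_filter => /andP[/asboolP hc _] ->.
  by have [] := pickP c hc.
move=> x Ax; have hx : exists y, A y /\ cell y = cell x by exists x.
exists (pickc (cell x)).
  by apply/mapP; exists (cell x) => //; rewrite mem_filter mem_enum inE andbT; apply/asboolP.
have [Ay yx] := pickP _ hx.
set y := pickc _ in Ay yx *.
have Sx := AS _ Ax; have Sy := AS _ Ay.
have close i : (tnth x i - tnth y i) ^+ 2 <= (K%:R ^+ 2)^-1.
  have coordb (z : T) : S z -> 0 <= (tnth z i + 1) * K%:R <= (2 * K)%:R.
    move=> Sz; have := sphere_coord i Sz; rewrite ler_norml => /andP[z1 z2].
    rewrite mulr_ge0 /=; [|lra|exact: ltW].
    by rewrite natrM; apply: ler_wpM2r; [exact: ltW|lra].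
  have cellE (z : T) : S z -> (cell z i : nat) = Num.truncn ((tnth z i + 1) * K%:R).
    move=> Sz; rewrite ffunE inordK// ltnS.
    have /andP[z0 z1] := coordb z Sz.
    rewrite -(ler_nat R); apply: le_trans z1; by rewrite truncn_le.
  have := cellE x Sx; rewrite -yx cellE// => tr.
  have /andP[x0 _] := coordb x Sx; have /andP[y0 _] := coordb y Sy.
  have := truncn_itv x0; have := truncn_itv y0; rewrite tr => /andP[a1 a2] /andP[b1 b2].
  rewrite -natr1 in a2; rewrite -natr1 in b2.
  have : `|(tnth x i - tnth y i) * K%:R| <= 1 by rewrite ler_norml; apply/andP; split; lra.
  move=> h; have : ((tnth x i - tnth y i) * K%:R) ^+ 2 <= 1.
    by rewrite -[leLHS]real_normK ?num_real// expr_le1.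
  by rewrite exprMn -ler_pdivlMr ?exprn_gt0// div1r.
have -> : 2 - 2 * dot x y = \sum_i (tnth x i - tnth y i) ^+ 2.
  transitivity (dot (lincomb 1 x (-1) y) (lincomb 1 x (-1) y)).
    by rewrite !dotE (_ : dot x x = 1)// (_ : dot y y = 1)// (dotC y x); ring.
  by apply: eq_bigr => j _; rewrite !tnth_mktuple; ring.
apply: (@le_trans _ _ (\sum_(i < d) (K%:R ^+ 2)^-1)); first exact: ler_sum.
rewrite sumr_const card_ord -[_ *+ _]mulr_natl ler_pdivrMr ?exprn_gt0//.
rewrite mulrC -ler_pdivrMr//.
have : K%:R <= K%:R ^+ 2 :> R by rewrite expr2 -[leLHS]mulr1 ler_wpM2l// ltW.
lra.
Qed.

(* Smooth substitutes for the chordal distance to [a] and, through a soft minimum,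
   for the distance to the finite set [s]. *)
Definition soft_chord (e : R) (a x : T) : R := expR (ln (2 + e ^+ 2 - 2 * dot x a) / 2).

Lemma chord_ge0 (a x : T) : S a -> S x -> 0 <= 2 - 2 * dot x a.
Proof. by move=> Sa Sx; have := norm_dot_le1 Sx Sa => /ler_normlP[_]; lra. Qed.

Lemma soft_chord_sqr e a x : 0 < e -> S a -> S x ->
  soft_chord e a x ^+ 2 = 2 + e ^+ 2 - 2 * dot x a.
Proof.
move=> e0 Sa Sx; rewrite /soft_chord -expRM_natl.
rewrite (_ : 2%:R * _ = ln (2 + e ^+ 2 - 2 * dot x a)); last by field.
rewrite lnK// posrE; have := chord_ge0 Sa Sx; have : 0 < e ^+ 2 by rewrite exprn_gt0.
lra.
Qed.

Lemma soft_chord_gt0 e a x : 0 < soft_chord e a x.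
Proof. exact: expR_gt0. Qed.

Lemma soft_chord_ge0 e a x : 0 <= soft_chord e a x.
Proof. exact: expR_ge0. Qed.

(** Writing the square root as the exponential of half a logarithm reduces smoothness to the rules
    for [expR] and [ln]; [e^2] keeps the argument of [ln] away from 0. *)
Lemma soft_chord_smooth e a : 0 < e -> S a -> smooth (soft_chord e a).
Proof.
move=> e0 Sa; have e20 : 0 < e ^+ 2 by rewrite exprn_gt0.
rewrite /soft_chord; apply: smooth_expR.
under eq_fun do rewrite mulrC; apply: smoothZ; apply: (smooth_ln e20).
  by move=> x Sx; have := chord_ge0 Sa Sx; lra.
apply: smoothD; first exact: smooth_cst.
by under eq_fun do rewrite -mulNr; apply: smoothZ; exact: smooth_dot.
Qed.

(** The soft chord is the distance from [x] to a point at height [e] above [a] in one more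
    dimension; the triangle inequality there follows from Cauchy-Schwarz for [y - x] and [a - y]. *)
Lemma soft_chord_lip e a x y : 0 < e -> S a -> S x -> S y ->
  soft_chord e a x <= soft_chord e a y + Num.sqrt (2 - 2 * dot x y).
Proof.
move=> e0 Sa Sx Sy.
set u := soft_chord e a x; set w := soft_chord e a y; set r := Num.sqrt _.
have u0 : 0 < u by exact: soft_chord_gt0.
have w0 : 0 < w by exact: soft_chord_gt0.
have r0 : 0 <= r by exact: sqrtr_ge0.
have r2 : r ^+ 2 = 2 - 2 * dot x y by rewrite sqr_sqrtr// chord_ge0.
have u2 : u ^+ 2 = 2 + e ^+ 2 - 2 * dot x a by exact: soft_chord_sqr.
have w2 : w ^+ 2 = 2 + e ^+ 2 - 2 * dot y a by exact: soft_chord_sqr.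
rewrite -(@ler_pXn2r _ 2)// ?nnegrE ?addr_ge0//; [|exact: ltW|exact: ltW].
have xx : dot x x = 1 by exact: Sx.
have yy : dot y y = 1 by exact: Sy.
have aa : dot a a = 1 by exact: Sa.
have := dot_CS (lincomb 1 y (-1) x) (lincomb 1 a (-1) y).
rewrite !dotE xx yy aa (dotC a y) (dotC y x).
set p := _ + _ => cs.
have pE : p = dot y a - dot x a - (1 - dot x y) by rewrite /p; ring.
have cs' : p ^+ 2 <= (r * w) ^+ 2.
  apply: le_trans cs _; rewrite exprMn r2 w2.
  rewrite [leLHS](_ : _ = (2 - 2 * dot x y) * (2 - 2 * dot y a)); last by ring.
  apply: ler_wpM2l; first exact: chord_ge0.
  have := sqr_ge0 e; lra.
have : p <= r * w.
  apply: le_trans (ler_norm _) _.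
  by rewrite -(@ler_pXn2r _ 2)// ?nnegrE ?mulr_ge0 ?real_normK ?num_real// ltW.
move=> h; rewrite u2 sqrrD w2 r2; rewrite pE in h; lra.
Qed.

Definition soft_distance (b e : R) (s : seq T) (x : T) : R :=
  - b^-1 * ln (\sum_(a <- s) expR (- b * soft_chord e a x)).

Section soft_distance_lemmas.
Variables (b e : R) (s : seq T).
Hypotheses (b0 : 0 < b) (e0 : 0 < e) (sS : forall a, a \in s -> S a) (s0 : s != [::]).
Local Notation F x := (\sum_(a <- s) expR (- b * soft_chord e a x)).
Let bi0 : 0 < b^-1. Proof. by rewrite invr_gt0. Qed.
Let scale_le (r v w : R) : - b * r + v <= w -> - (b^-1 * w) <= r - b^-1 * v.
Proof.
move=> /(ler_wpM2l (ltW bi0)).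
have -> : b^-1 * (- b * r + v) = - r + b^-1 * v by field; rewrite lt0r_neq0.
by move: (b^-1 * v) (b^-1 * w) => v' w'; lra.
Qed.
Let scale_ge (r v w : R) : v <= w - b * r -> r - b^-1 * w <= - (b^-1 * v).
Proof.
move=> /(ler_wpM2l (ltW bi0)).
have -> : b^-1 * (w - b * r) = - r + b^-1 * w by field; rewrite lt0r_neq0.
by move: (b^-1 * v) (b^-1 * w) => v' w'; lra.
Qed.

Lemma le_soft_sum a x : a \in s -> expR (- b * soft_chord e a x) <= F x.
Proof.
move=> sa; rewrite (big_rem a)//= lerDl.
by apply: sumr_ge0 => i _; exact: expR_ge0.
Qed.

Lemma soft_sum_gt0 x : 0 < F x.
Proof.
case: s s0 (@le_soft_sum) => [//|a s'] _ h.
by apply: lt_le_trans (h a x (mem_head _ _)); exact: expR_gt0.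
Qed.

Lemma soft_distance_smooth : smooth (soft_distance b e s).
Proof.
apply: smoothZ.
have [a sa] : exists a, a \in s.
  by case: s s0 => [//|a s'] _; exists a; exact: mem_head.
apply: (@smooth_ln _ _ _ (expR (- b * (2 + e)))); first exact: expR_gt0.
  move=> x Sx; apply: le_trans (le_soft_sum x sa); rewrite ler_expR !mulNr lerN2.
  rewrite ler_pM2l//.
  have e2 : 0 <= 2 + e by rewrite addr_ge0// ltW.
  rewrite -(@ler_pXn2r _ 2)// ?nnegrE ?soft_chord_ge0//.
  rewrite soft_chord_sqr//; last exact: sS.
  have := norm_dot_le1 Sx (sS sa) => /ler_normlP[h _].
  have -> : (2 + e) ^+ 2 = 4 + 4 * e + e ^+ 2 by ring.
  have := e0; lra.
(* [smooth_sum] wants every term smooth, but only points of [s] are known to lie on the sphere;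
   terms outside [s] are replaced by 0. *)
have -> : (fun x => F x) = (fun x => \sum_(a <- s | a \in s) expR (- b * soft_chord e a x)).
  by apply/funext => x; rewrite big_seq.
have -> : (fun x => \sum_(a <- s | a \in s) expR (- b * soft_chord e a x)) =
   (fun x => \sum_(a <- s) (if a \in s then expR (- b * soft_chord e a x) else 0)).
  by apply/funext => x; rewrite big_mkcond.
apply: smooth_sum => i; case: (boolP (i \in s)) => si; last exact: smooth_cst.
by apply: smooth_expR; apply: smoothZ; apply: soft_chord_smooth => //; exact: sS.
Qed.

Lemma ln_expRM (r v : R) : 0 < v -> ln (expR r * v) = r + ln v.
Proof. by move=> v0; rewrite lnM ?expRK// posrE expR_gt0. Qed.

Lemma soft_distanceE x : soft_distance b e s x = - (b^-1 * ln (F x)).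
Proof. by rewrite /soft_distance mulNr. Qed.

(** Moving [x] by a chord [r] changes each summand by a factor of at most [expR (b * r)], hence the
    scaled logarithm by at most [r], uniformly in [b], [e] and [s]. *)
Lemma soft_distance_lip : lip_on_sphere 1 (soft_distance b e s).
Proof.
have half x y : S x -> S y ->
    soft_distance b e s x - soft_distance b e s y <= Num.sqrt (2 - 2 * dot x y).
  move=> Sx Sy; set r := Num.sqrt _.
  have Fxy : expR (- b * r) * F y <= F x.
    rewrite mulr_sumr big_seq [leRHS]big_seq; apply: ler_sum => a sa.
    rewrite -expRD ler_expR -mulrDr !mulNr lerN2 ler_pM2l// addrC.
    by apply: soft_chord_lip => //; exact: sS.
  have := soft_sum_gt0 x; have := soft_sum_gt0 y => Fy0 Fx0.
  have h : - b * r + ln (F y) <= ln (F x).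
    rewrite -(ln_expRM _ Fy0) ler_ln// posrE//.
    exact: mulr_gt0 (expR_gt0 _) Fy0.
  by rewrite !soft_distanceE opprK -lerBrDr; exact: scale_le.
move=> x y Sx Sy _; rewrite mul1r ler_norml; apply/andP; split; last exact: half.
by rewrite lerNl opprB dotC; exact: half.
Qed.

Lemma soft_distance_le a x : a \in s -> soft_distance b e s x <= soft_chord e a x.
Proof.
move=> sa; rewrite soft_distanceE -[leRHS]subr0 -[X in _ - X](mulr0 b^-1).
apply: scale_le; rewrite addr0 -[leLHS]expRK ler_ln; first exact: le_soft_sum.
  by rewrite posrE; exact: expR_gt0.
by rewrite posrE; exact: soft_sum_gt0.
Qed.

Lemma soft_distance_ge D x : (forall a, a \in s -> D <= soft_chord e a x) ->
  D - ln (size s)%:R / b <= soft_distance b e s x.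
Proof.
move=> hD; have sz : 0 < (size s)%:R :> R.
  by rewrite ltr0n; case: s s0.
have h : F x <= (size s)%:R * expR (- b * D).
  apply: (@le_trans _ _ (\sum_(a <- s) expR (- b * D))).
    rewrite big_seq [leRHS]big_seq; apply: ler_sum => a sa.
    by rewrite ler_expR !mulNr lerN2 ler_pM2l// hD.
  by rewrite big_const_seq count_predT iter_addr addr0 mulr_natl.
rewrite soft_distanceE [_ / b]mulrC; apply: scale_ge.
rewrite addrC -mulNr -(ln_expRM _ sz) mulrC ler_ln// posrE; first exact: soft_sum_gt0.
by apply: mulr_gt0 => //; exact: expR_gt0.
Qed.

End soft_distance_lemmas.

Variable rho : probability T R.
Hypothesis unif : uniform_sphere rho.
Local Notation E := (Ex rho S).
Local Notation mS := (@measurable_sphere R d).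
Let PS : rho S = 1%E. Proof. by case: unif. Qed.
Hypothesis n0 : (0 < n)%N.
Let nr0 : 0 < n%:R :> R. Proof. by rewrite ltr0n. Qed.

(** With [f] a soft distance to [A], the exponential bounds for [l * f] and [- l * f] are restricted
    to [B] and [A]. In their product the means of [f] cancel, and up to [e] the exponent is
    [2 l^2 / n - l D], minimal at [l = n D / 4]. *)
Lemma separated_sets (A B : set T) (D : R) : measurable A -> measurable B -> 0 < D ->
  A `<=` S -> B `<=` S -> (forall x y, A x -> B y -> D ^+ 2 <= 2 - 2 * dot x y) ->
  E (\1_A) * E (\1_B) <= expR (- (n%:R * D ^+ 2 / 8)).
Proof.
move=> mA mB D0 AS BS sep; apply: le_expR_lim => e e0.
have [[x0 Ax0]|A0] := pselect (exists x, A x); last first.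
  rewrite (_ : E (\1_A) = 0) ?mul0r ?expR_ge0//.
  rewrite (@eq_Ex _ _ _ _ _ _ (fun=> 0)) ?(Ex_cst mS PS)// => x _.
  by rewrite indicE memNset// => Ax; apply: A0; exists x.
pose l := n%:R * D / 4.
have l0 : 0 < l by rewrite divr_gt0// mulr_gt0.
(* [f] is at most [2 w] on [A] and at least [D - w] on [B], a total loss of [3 l w = e] in the
   exponent. The rate [b] below keeps the soft-minimum error [ln (size s) / b] under [w]. *)
pose w := e / (3 * l).
have w0 : 0 < w by rewrite divr_gt0// mulr_gt0.
have w20 : 0 < w ^+ 2 by rewrite exprn_gt0.
have [s [sA sN]] := finite_net w20 AS.
have sS a : a \in s -> S a by move=> /sA /AS.
have s0 : s != [::].
  by have [a] := sN _ Ax0; case: (s).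
pose b := (ln (size s)%:R + 1) / w.
have sz1 : 1 <= (size s)%:R :> R by rewrite ler1n; case: (s) s0.
have lsz : 0 <= ln (size s)%:R :> R by rewrite ln_ge0.
have b0 : 0 < b by rewrite divr_gt0// ltr_wpDl.
pose f := soft_distance b w s.
have fsm : smooth f by exact: soft_distance_smooth.
have flip : lip_on_sphere 1 f by exact: soft_distance_lip.
have fA x : A x -> f x <= 2 * w.
  move=> Ax; have [a sa ax] := sN x Ax; apply: le_trans (@soft_distance_le b w s b0 s0 a x sa) _.
  have w2 : 0 <= 2 * w by rewrite mulr_ge0// ltW.
  rewrite -(@ler_pXn2r _ 2)// ?nnegrE ?soft_chord_ge0//.
  rewrite soft_chord_sqr//; [|exact: sS|exact: AS].
  rewrite [leRHS]exprMn; move: (w ^+ 2) w20 ax => w' w'0 ax; lra.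
have fB y : B y -> D - w <= f y.
  move=> By; apply: le_trans (@soft_distance_ge b w s b0 s0 D y _).
    rewrite lerD2l lerN2 ler_pdivrMr// /b mulrC divfK ?lt0r_neq0//; lra.
  move=> a sa; rewrite -(@ler_pXn2r _ 2)// ?nnegrE ?soft_chord_ge0 ?(ltW D0)//.
  rewrite soft_chord_sqr//; [|exact: sS|exact: BS].
  have := sep a y (sA a sa) By; rewrite dotC; lra.
have conc g : smooth g -> lip_on_sphere l g -> E (fun x => expR (g x - E g)) <= expR (l ^+ 2 / n%:R).
  move=> sg lg; have [B1 [L1 [B10 L10 sos]]] := smooth_smooth_on_sphere sg.
  have bg : bmf S g by case: sg.
  exact: (exp_concentration unif n0 B10 L10 (ltW l0) bg lg sos).
pose g x := l * f x; pose g' x := - l * f x.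
have sg : smooth g by exact: smoothZ.
have sg' : smooth g' by exact: smoothZ.
have bg : bmf S g by case: sg.
have bg' : bmf S g' by case: sg'.
have lg : lip_on_sphere l g.
  move=> x y Sx Sy xy; rewrite -mulrBr normrM (gtr0_norm l0) ler_pM2l//.
  by have := flip x y Sx Sy xy; rewrite mul1r.
have lg' : lip_on_sphere l g'.
  move=> x y Sx Sy xy; rewrite -mulrBr normrM normrN (gtr0_norm l0) ler_pM2l//.
  by have := flip x y Sx Sy xy; rewrite mul1r.
have Eg' : E g' = - E g.
  rewrite -(ExN _ mS)//; apply: eq_Ex => x _; rewrite /g /g'; ring.
have hB : expR (l * (D - w) - E g) * E (\1_B) <= expR (l ^+ 2 / n%:R).
  apply: le_trans (conc g sg lg); rewrite -(ExZ _ mS); last exact: bmf_indic.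
  apply: (le_Ex rho mS).
  - by apply: bmfZ; exact: bmf_indic.
  - by apply: bmf_expR; apply: bmfB => //; exact: bmf_cst.
  move=> x Sx; rewrite indicE; case: (boolP (x \in B)) => xB; rewrite ?mulr0 ?expR_ge0// mulr1.
  by rewrite ler_expR lerD2r /g ler_pM2l// fB//; exact: set_mem.
have hA : expR (- l * (2 * w) + E g) * E (\1_A) <= expR (l ^+ 2 / n%:R).
  apply: le_trans (conc g' sg' lg'); rewrite -(ExZ _ mS); last exact: bmf_indic.
  apply: (le_Ex rho mS).
  - by apply: bmfZ; exact: bmf_indic.
  - by apply: bmf_expR; apply: bmfB => //; exact: bmf_cst.
  move=> x Sx; rewrite indicE; case: (boolP (x \in A)) => xA; rewrite ?mulr0 ?expR_ge0// mulr1.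
  by rewrite ler_expR Eg' opprK lerD2r /g' !mulNr lerN2 ler_pM2l// fA//; exact: set_mem.
have EA0 : 0 <= E (\1_A) by apply: Ex_ge0 => x _; rewrite indicE.
have EB0 : 0 <= E (\1_B) by apply: Ex_ge0 => x _; rewrite indicE.
have := ler_pM (mulr_ge0 (expR_ge0 _) EA0) (mulr_ge0 (expR_ge0 _) EB0) hA hB.
rewrite mulrACA -!expRD.
have -> : - l * (2 * w) + E g + (l * (D - w) - E g) = l * D - e.
  by rewrite /w; field; rewrite lt0r_neq0.
have -> : l ^+ 2 / n%:R + l ^+ 2 / n%:R = n%:R * D ^+ 2 / 8.
  by rewrite /l; field; rewrite lt0r_neq0.
have -> : l * D = n%:R * D ^+ 2 / 4 by rewrite /l; ring.
move=> h; have e1 := expR_ge0 (- (n%:R * D ^+ 2 / 4 - e)).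
have := ler_wpM2l e1 h; rewrite !mulrA -!expRD addNr expR0 mul1r => h'.
apply: le_trans h' _; rewrite ler_expR; lra.
Qed.

End soft_distance.

(** * Cap probabilities *)

Section cap_probability.
Context {R : realType} {n : nat}.
Local Notation d := n.+2.
Local Notation T := (d.-tuple R).
Variable rho : probability T R.
Hypothesis unif : uniform_sphere rho.
Local Notation S := (sphere R d).
Local Notation E := (Ex rho S).
Local Notation mS := (@measurable_sphere R d).
Local Notation m := (n.+1%:R : R).
Local Notation X x := (@tnth n.+2 R x ord0).
Let PS : rho S = 1%E. Proof. by case: unif. Qed.
Variable nu : probability T R.
Hypothesis nuS : on_sphere nu.

Definition cap_prob (s : R) (z : T) : R := Ex nu S (fun x => \I[s < dot x z]).

Lemma measurable_dot_gt (s : R) :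
  measurable_fun setT (fun zx : T * T => s < dot zx.2 zx.1).
Proof.
apply: (measurableT_comp (measurable_gt s)).
rewrite (_ : (fun zx : T * T => dot zx.2 zx.1) = (fun zx => dot zx.1 zx.2)).
  exact: measurable_dot.
by apply/funext => zx; rewrite dotC.
Qed.

Let F s (zx : T * T) : R := \I[s < dot zx.2 zx.1].
Let mF s : measurable_fun setT (F s).
Proof. by have [] := bmf_bool (R := R) setT (measurable_dot_gt s). Qed.
Let bF s : exists M, forall z x, S z -> S x -> `|F s (z, x)| <= M.
Proof.
by exists 1 => z x _ _; rewrite /F; case: (_ < _); rewrite ?normr1 ?normr0.
Qed.

Lemma bmf_cap_prob_slice (s : R) z : bmf S (fun x => \I[s < dot x z] : R).
Proof. exact: (bmf_dot_bool (b := fun r => s < r) z (measurable_gt s)). Qed.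

Lemma cap_massE (s : R) z : cap_mass nu s z = cap_prob s z.
Proof.
have mA : measurable [set x : T | s < dot x z].
  rewrite [Y in measurable Y](_ : _ = (fun x => s < dot x z) @^-1` [set true]).
    rewrite -[Y in measurable Y]setTI.
    by apply: (measurableT_comp (measurable_gt s) (measurable_dotl z)).
  by apply/seteqP; split => x.
rewrite /cap_mass -(Ex_indic mS nuS mA) /=; apply: eq_Ex => x _.
rewrite indicE; congr (nat_of_bool _)%:R.
by apply/idP/idP; rewrite in_setE.
Qed.

Lemma bmf_cap_prob (s : R) : bmf S (cap_prob s).
Proof. exact: (bmf_Ex (F := F s) mS (mF s) (bF s) nuS). Qed.

Lemma cap_prob_ge0 s z : 0 <= cap_prob s z.
Proof. by apply: Ex_ge0 => x _; case: (_ < _). Qed.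

Lemma cap_prob_le1 s z : cap_prob s z <= 1.
Proof.
rewrite -[leRHS](Ex_cst mS nuS); apply: (le_Ex nu mS); first exact: bmf_cap_prob_slice.
  exact: bmf_cst.
by move=> x _; case: (_ < _).
Qed.

(** For each fixed [x] on the sphere, [<x, z>] has under [rho] the law of the first coordinate, so
    after Fubini [nu] drops out. *)
Lemma Ex_cap_prob (s : R) : E (cap_prob s) = E (fun x => \I[s < X x]).
Proof.
rewrite (Ex_swap rho nu mS mS (mF s) (bF s)).
rewrite -[RHS](Ex_cst mS nuS); apply: eq_Ex => x Sx.
rewrite -(Ex_dot unif (f := fun r => \I[s < r]) Sx); last first.
  exact: (bmf_coord_bool (measurable_gt s)).
by apply: eq_Ex => z _; rewrite /F /= dotC.
Qed.

Variable L : R.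
Hypothesis dens : forall A, measurable A -> (nu A <= L%:E * rho A)%E.

Lemma density_ge1 : 1 <= L.
Proof. by have := dens mS; rewrite nuS PS mule1 lee_fin. Qed.

Lemma Ex_bool_dominated (b : T -> bool) : measurable_fun setT b ->
  Ex nu S (fun x => \I[b x]) <= L * E (fun x => \I[b x]).
Proof.
move=> mb; have mA : measurable [set x | b x].
  rewrite [Y in measurable Y](_ : _ = b @^-1` [set true]).
    by rewrite -[Y in measurable Y]setTI; apply: mb.
  by apply/seteqP; split => x.
have eI x : \I[b x] = \1_[set x | b x] x :> R.
  by rewrite indicE; congr (nat_of_bool _)%:R; apply/idP/idP; rewrite in_setE.
rewrite -lee_fin EFinM (eq_Ex _ (fun x _ => eI x)) (Ex_indic mS nuS mA).
by rewrite (eq_Ex _ (fun x _ => eI x)) (Ex_indic mS PS mA); exact: dens.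
Qed.

Lemma cap_prob_dominated (s : R) z : S z -> cap_prob s z <= L * E (fun x => \I[s < X x]).
Proof.
move=> Sz; apply: le_trans (Ex_bool_dominated _) _.
  exact: measurableT_comp (measurable_gt s) (measurable_dotl z).
by rewrite (Ex_dot unif (f := fun r => \I[s < r]) Sz)//; exact: (bmf_coord_bool (measurable_gt s)).
Qed.

(* A point of the first cap that misses the second lies in the cap of height
   [u / D] around the direction of [z - z']. *)
Lemma cap_prob_perturb (s u D : R) z z' : S z -> S z' -> 0 <= u -> 0 < D ->
  2 - 2 * dot z z' < D ^+ 2 ->
  cap_prob s z <= cap_prob (s - u) z' + L * expR (- (m * (u / D) ^+ 2 / 2)).
Proof.
move=> Sz Sz' u0 D0 zD; pose w := lincomb 1 z (-1) z'.
have wwE : dot w w = 2 - 2 * dot z z'.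
  rewrite /w !dotE (dotC z' z); move: Sz Sz'; rewrite /sphere /= => -> ->; ring.
have wx x : dot x w = dot x z - dot x z' by rewrite /w dotC dotE !(dotC _ x); ring.
have L0 : 0 <= L := le_trans ler01 density_ge1.
have e0 : 0 <= L * expR (- (m * (u / D) ^+ 2 / 2)) by rewrite mulr_ge0// expR_ge0.
have [w0|w0] := eqVneq (dot w w) 0.
  rewrite -[leLHS]addr0; apply: lerD => //.
  apply: (le_Ex nu mS); [exact: bmf_cap_prob_slice|exact: bmf_cap_prob_slice|move=> x _].
  have := wx x; rewrite dotC dot_eq0// => /esym/eqP; rewrite subr_eq0 => /eqP ->.
  by case: (ltP s (dot x z')) => h; case: (ltP (s - u)) => h' //; lra.
pose r := Num.sqrt (dot w w).
have r0 : 0 < r by rewrite sqrtr_gt0 lt_neqAle eq_sym w0 dot_ge0.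
have rr : r ^+ 2 = dot w w by rewrite sqr_sqrtr// dot_ge0.
have rD : r < D.
  by rewrite -(@ltr_pXn2r _ 2)// ?nnegrE ?(ltW r0) ?(ltW D0)// rr wwE.
pose v := lincomb r^-1 w 0 w.
have vE x : dot x v = dot x w / r by rewrite /v dotC dotE !(dotC _ x); ring.
have Sv : S v.
  rewrite /sphere /= vE dotC vE -rr; field; exact: lt0r_neq0.
have uD0 : 0 <= u / D by rewrite divr_ge0// ltW.
apply: (@le_trans _ _ (cap_prob (s - u) z' + Ex nu S (fun x => \I[u / D <= dot x v]))).
  have bv := bmf_dot_bool (b := fun r => u / D <= r) v (measurable_ge (u / D)).
  rewrite -(ExD _ mS) //; last exact: bmf_cap_prob_slice.
  apply: (le_Ex nu mS); [exact: bmf_cap_prob_slice|apply: bmfD => //; exact: bmf_cap_prob_slice|move=> x _].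
  case: (ltP s (dot x z)) => h1; last by rewrite addr_ge0.
  case: (ltP (s - u) (dot x z')) => h2; first by rewrite lerDl.
  have -> : u / D <= dot x v.
    rewrite vE wx ler_pdivlMr//; apply: le_trans (ler_wpM2l uD0 (ltW rD)) _.
    rewrite divfK ?lt0r_neq0//; lra.
  by rewrite add0r.
rewrite lerD2l; apply: le_trans (Ex_bool_dominated _) _.
  exact: measurableT_comp (measurable_ge (u / D)) (measurable_dotl v).
apply: ler_wpM2l => //.
rewrite (Ex_dot unif (f := fun r => \I[u / D <= r]) Sv); last exact: bmf_ge.
exact: marginal_tail.
Qed.

End cap_probability.

(** * Deviation probabilities *)

Section numeric.
Context {R : realType}.
Implicit Types p l m d u t q w M C : R.

Lemma expR_ln_inv p : 0 < p -> expR (- ln (1 / p)) = p.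
Proof. by move=> p0; rewrite -lnV ?posrE ?divr_gt0// div1r invrK lnK ?posrE. Qed.

Lemma ln_inv_ge_half p : 0 < p -> p <= 1 / 2 -> 1 / 2 <= ln (1 / p).
Proof.
by move=> p0 p2; have := expR_ge1Dx (- ln (1 / p)); rewrite expR_ln_inv//; lra.
Qed.

Lemma sqr_sum_sqrt_ge a b t : 0 <= a -> 0 <= b -> 0 <= t ->
  (a + b) * t ^+ 2 <= ((Num.sqrt a + Num.sqrt b) * t) ^+ 2.
Proof.
move=> a0 b0 t0; rewrite exprMn; apply: ler_wpM2r; first exact: sqr_ge0.
rewrite sqrrD !sqr_sqrtr//.
have : 0 <= Num.sqrt a * Num.sqrt b by rewrite mulr_ge0 ?sqrtr_ge0.
lra.
Qed.

(** The hypotheses chain into [(4 l)^2 <= 8 l d t^2 <= d m u^2 <= (d u)^2]. With [l = ln (1 / p)]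
    and [k = ln L + kappa], this keeps [u] from being small when [p] is. *)
Lemma deviation_scale_ge l k m d u t : 0 < m -> m <= d -> 0 <= l -> 0 <= u ->
  l <= k -> 2 * l <= d * t ^+ 2 -> 8 * k * t ^+ 2 <= m * u ^+ 2 -> 4 * l <= d * u.
Proof.
move=> m0 md l0 u0 lk ldt ku; have d0 : 0 <= d by lra.
rewrite -(@ler_pXn2r _ 2)// ?nnegrE ?mulr_ge0//.
have h1 : m * u ^+ 2 <= d * u ^+ 2 by apply: ler_wpM2r => //; exact: sqr_ge0.
have h2 : l * (8 * t ^+ 2) <= k * (8 * t ^+ 2).
  by apply: ler_wpM2r => //; rewrite mulr_ge0// sqr_ge0.
have h3 : d * (l * (8 * t ^+ 2)) <= d * (d * u ^+ 2) by apply: ler_wpM2l => //; lra.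
have h4 : 8 * l * (2 * l) <= 8 * l * (d * t ^+ 2) by apply: ler_wpM2l => //; lra.
lra.
Qed.

Lemma sqrt_ratio_le l m d : 0 < m -> m <= d -> 0 <= l ->
  m * Num.sqrt (2 * l / m) <= 2 * Num.sqrt (d * l).
Proof.
move=> m0 md l0; have dl : 0 <= d * l by rewrite mulr_ge0//; lra.
have lm : 0 <= 2 * l / m by rewrite divr_ge0//; lra.
rewrite -(@ler_pXn2r _ 2)// ?nnegrE ?mulr_ge0 ?sqrtr_ge0//; [|lra].
rewrite !exprMn !sqr_sqrtr//.
rewrite [leLHS](_ : _ = 2 * (m * l)); last by field; lra.
have : m * l <= d * l by exact: ler_wpM2r.
lra.
Qed.

(** [tau >= 1/8] gives [l >= m / 128], hence [d <= 16 * sqrt (d * l)]; then [C * u * sqrt (d * l) >=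
    4 * d * u >= 16 * l >= 8]. *)
Lemma high_threshold_scale l m d u tau C : 1 <= m -> d = m + 1 -> 1 / 2 <= l ->
  0 <= u -> 64 <= C -> 1 / 8 <= tau -> m * tau ^+ 2 / 2 <= l -> 4 * l <= d * u ->
  8 <= C * u * Num.sqrt (d * l).
Proof.
move=> m1 -> l1 u0 C64 tau8 ml lu; set q := Num.sqrt _.
have q0 : 0 <= q by exact: sqrtr_ge0.
have dq : m + 1 <= 16 * q.
  rewrite -(@ler_pXn2r _ 2)// ?nnegrE ?mulr_ge0//; [|lra].
  rewrite [leRHS]exprMn sqr_sqrtr ?mulr_ge0//; [|lra|lra].
  have t2 : (1 / 8) ^+ 2 <= tau ^+ 2 by rewrite ler_pXn2r// nnegrE; lra.
  have h : m * (1 / 8) ^+ 2 <= m * tau ^+ 2 by apply: ler_wpM2l => //; lra.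
  rewrite expr2 mulrCA; apply: ler_wpM2l; lra.
have h1 : 64 * (u * q) <= C * (u * q) by apply: ler_wpM2r => //; exact: mulr_ge0.
have h2 : u * (m + 1) <= u * (16 * q) by exact: ler_wpM2l.
lra.
Qed.

(** [tau <= 1/8] makes [7 / 4 / (1 - tau^2)] at most 2, which is the 2 in [exp (2 d tau u)]. The
    prefactor is at most [12 * 2 * 2 = 48], below the 64 required of [C]. *)
Lemma upper_band_numeric p l m d u tau C : 1 <= m -> d = m + 1 -> 0 < p -> 0 <= l ->
  0 <= u -> 64 <= C -> 0 <= tau -> tau <= 1 / 8 ->
  12 * (7 / 4 * u) * m / (1 - tau ^+ 2) *
    expR (m * tau * (7 / 4 * u) / (1 - tau ^+ 2)) * (p * Num.sqrt (2 * l / m)) <=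
  p * (C * u * expR (2 * d * tau * u) * Num.sqrt (d * l)).
Proof.
move=> m1 dE p0 l0 u0 C64 tau0 tau8.
have t2 : tau ^+ 2 <= (1 / 8) ^+ 2 by rewrite ler_pXn2r// ?nnegrE; lra.
have k0 : 0 < 1 - tau ^+ 2 by lra.
pose k := (1 - tau ^+ 2)^-1.
have k8 : 7 / 4 * k <= 2 by rewrite /k ler_pdivrMr//; lra.
have k00 : 0 <= k by rewrite /k invr_ge0 ltW.
have ms := @sqrt_ratio_le l m d; set s := Num.sqrt (2 * l / m); set q := Num.sqrt (d * l).
have {}ms : m * s <= 2 * q by apply: ms => //; lra.
have s0 : 0 <= s by exact: sqrtr_ge0.
have q0 : 0 <= q by exact: sqrtr_ge0.
have e1 : expR (m * tau * (7 / 4 * u) / (1 - tau ^+ 2)) <= expR (2 * d * tau * u).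
  rewrite ler_expR -/k; have tu : 0 <= tau * u by exact: mulr_ge0.
  have h1 : (tau * u * m) * (7 / 4 * k) <= (tau * u * m) * 2.
    by apply: ler_wpM2l => //; rewrite mulr_ge0//; lra.
  have h2 : tau * u * m <= tau * u * d by apply: ler_wpM2l => //; lra.
  lra.
have {}e1 := le_trans e1 (lexx _); move: e1.
set e := expR _; set e' := expR _ => ee; have e0 : 0 <= e by exact: expR_ge0.
rewrite [leLHS](_ : _ = p * (12 * u * (7 / 4 * k) * (m * s) * e)); last by rewrite /k; field; lra.
apply: ler_wpM2l; first exact: ltW.
have h1 : 7 / 4 * k * (m * s) <= 2 * (2 * q).
  by apply: ler_pM => //; rewrite mulr_ge0//; lra.
have h2 : 7 / 4 * k * (m * s) * e <= 2 * (2 * q) * e'.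
  by apply: ler_pM => //; rewrite mulr_ge0// mulr_ge0//; lra.
have h3 := ler_wpM2l u0 h2.
have h4 : 64 * (u * (q * e')) <= C * (u * (q * e')).
  by apply: ler_wpM2r => //; rewrite mulr_ge0// mulr_ge0// (le_trans e0).
have h5 : 0 <= u * (q * e') by rewrite mulr_ge0// mulr_ge0// (le_trans e0).
lra.
Qed.

Lemma lower_band_numeric p l m d u C e b K w : 1 <= m -> d = m + 1 -> 0 < p -> 0 <= l ->
  0 <= u -> 64 <= C -> 1 <= e -> 0 <= w -> w <= 1 / 2 -> 0 <= b -> K <= p * Num.sqrt (2 * l / m) ->
  (1 - w ^+ 2) * b <= m * (7 / 4 * u) * K -> b <= p * (C * u * e * Num.sqrt (d * l)).
Proof.
move=> m1 dE p0 l0 u0 C64 e1 w0 w2 b0.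
have := @sqrt_ratio_le l m d; set s := Num.sqrt (2 * l / m); set q := Num.sqrt (d * l).
move=> ms Kp; have {}ms : m * s <= 2 * q by apply: ms => //; lra.
have q0 : 0 <= q by exact: sqrtr_ge0.
have t2 : w ^+ 2 <= (1 / 2) ^+ 2 by rewrite ler_pXn2r// ?nnegrE; lra.
have hb : 3 / 4 * b <= (1 - w ^+ 2) * b by apply: ler_wpM2r => //; lra.
have mu : 0 <= m * (7 / 4 * u) by rewrite mulr_ge0//; lra.
have h1 := ler_wpM2l mu Kp.
have up : 0 <= u * p by rewrite mulr_ge0// ltW.
have h2 := ler_wpM2l up ms.
have uq : 0 <= u * p * q by exact: mulr_ge0.
have h3 : 64 * 1 <= C * e by apply: ler_pM => //.
have h4 := ler_wpM2r uq h3.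
move=> h; lra.
Qed.

End numeric.

Section deviation.
Context {R : realType} {n : nat}.
Local Notation d := n.+2.
Local Notation T := (d.-tuple R).
Variable rho : probability T R.
Hypothesis unif : uniform_sphere rho.
Local Notation S := (sphere R d).
Local Notation E := (Ex rho S).
Local Notation mS := (@measurable_sphere R d).
Local Notation m := (n.+1%:R : R).
Local Notation X x := (@tnth n.+2 R x ord0).
Let PS : rho S = 1%E. Proof. by case: unif. Qed.
Let m1 : 1 <= m. Proof. by rewrite ler1n. Qed.
Let m0 : 0 < m. Proof. by rewrite ltr0n. Qed.
Let dE : d%:R = m + 1 :> R. Proof. by rewrite -natr1. Qed.

Variable t : R.
Hypothesis t0 : 0 < t.
Local Notation delta := (expR (- (d%:R * t ^+ 2 / 4))).

Lemma set0_or_inhabited (A : set T) : (exists x, A x) \/ E (\1_A) = 0.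
Proof.
have [|A0] := pselect (exists x, A x); [by left|right].
rewrite (@eq_Ex _ _ _ _ _ _ (fun=> 0)) ?(Ex_cst mS PS)// => x _.
by rewrite indicE memNset// => Ax; apply: A0; exists x.
Qed.

(* 49/32 = (7/2)^2 / 8 is large enough for [n * 49/32 >= d/2] when [n >= 1]; in
   dimension 2 the distance [7/2 * t] exceeds the diameter. *)
Lemma separated_small (A B : set T) : measurable A -> measurable B ->
  A `<=` S -> B `<=` S -> (forall x y, A x -> B y -> (7 / 2 * t) ^+ 2 <= 2 - 2 * dot x y) ->
  2 * delta < 1 -> delta < E (\1_A) -> E (\1_B) <= delta.
Proof.
move=> mA mB AS BS sep; have e0 := expR_gt0 (- (d%:R * t ^+ 2 / 4)).
have [n0|n0] := posnP n.
  move=> d1 dA; have [[y By]|->] := set0_or_inhabited B; last exact: ltW.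
  have [[x Ax]|A0] := set0_or_inhabited A; last by move: dA; rewrite A0 ltNge ltW.
  have := sep x y Ax By; have := norm_dot_le1 (AS _ Ax) (BS _ By) => /ler_normlP[h _].
  have := expR_ge1Dx (- (d%:R * t ^+ 2 / 4)); have : d%:R = 2 :> R by rewrite n0.
  by move: d1 e0; set e := expR _ => d1 e0 ->; rewrite exprMn; lra.
move=> _ dA; rewrite leNgt; apply/negP => dB.
have D0 : 0 < 7 / 2 * t by rewrite mulr_gt0.
have h := separated_sets unif n0 mA mB D0 AS BS sep.
have h1 : delta * delta < E (\1_A) * E (\1_B).
  by apply: ltr_pM => //; exact: ltW.
have := lt_le_trans h1 h; rewrite -expRD ltr_expR dE -natr1.
have n1 : 1 <= n%:R :> R by rewrite ler1n.
have : 1 * t ^+ 2 <= n%:R * t ^+ 2 by apply: ler_wpM2r => //; exact: sqr_ge0.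
have := sqr_ge0 t; rewrite exprMn; lra.
Qed.

Variables (nu : probability T R) (L kappa : R).
Hypothesis nuS : on_sphere nu.
Hypothesis dens : forall A, measurable A -> (nu A <= L%:E * rho A)%E.
Let L1 : 1 <= L. Proof. exact: density_ge1 dens. Qed.
Let lnL0 : 0 <= ln L. Proof. exact: ln_ge0. Qed.
Local Notation V := (cap_prob nu).
Variable u : R.
Hypotheses (u0 : 0 < u) (hu : 8 * (ln L + kappa) * t ^+ 2 <= m * u ^+ 2).

(** The exceptional cap has height [u / (2 t)], and [hu] makes its exponent [m u^2 / (8 t^2)] at
    least [ln L + kappa]; the factor [L] from the density is thus cancelled. *)
Lemma cap_prob_robust (s : R) z z' : S z -> S z' -> 2 - 2 * dot z z' < (7 / 2 * t) ^+ 2 ->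
  V s z <= V (s - 7 / 4 * u) z' + expR (- kappa).
Proof.
move=> Sz Sz' close.
have := @cap_prob_perturb R n rho unif nu nuS L dens s (7 / 4 * u) (7 / 2 * t) z z' Sz Sz'.
have D0 : 0 < 7 / 2 * t by rewrite mulr_gt0.
have w0 : 0 <= 7 / 4 * u by rewrite mulr_ge0// ltW.
move=> /(_ w0 D0 close) h; apply: le_trans h _; rewrite lerD2l.
rewrite -[Y in Y * _](_ : expR (ln L) = L); last by rewrite lnK// posrE (lt_le_trans ltr01).
rewrite -expRD ler_expR [7 / 4 * u / _](_ : _ = u / (2 * t)); last by field; exact: lt0r_neq0.
have : ln L + kappa <= m * (u / (2 * t)) ^+ 2 / 2.
  rewrite [leRHS](_ : _ = m * u ^+ 2 / (8 * t ^+ 2)); last by field; exact: lt0r_neq0.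
  by rewrite ler_pdivlMr ?mulr_gt0 ?exprn_gt0//; move: hu; lra.
lra.
Qed.

Variables (p tau C : R).
Hypothesis p0 : 0 < p.
Hypothesis p2 : p <= 1 / 2.
Hypothesis Ep : E (fun x => \I[tau <= X x]) = p.
Hypothesis C64 : 64 <= C.
Local Notation l := (ln (1 / p)).
Local Notation q := (Num.sqrt (d%:R * l)).
Local Notation M := (C * u * expR (2 * d%:R * tau * u) * q).
Local Notation dev := (p * M + 2 * delta + expR (- kappa)).

Let p1 : p < 1. Proof. by move: p2; lra. Qed.
Let tau0 : 0 <= tau. Proof. exact: (threshold_ge0 unif Ep p2). Qed.
Let l2 : 1 / 2 <= l. Proof. exact: ln_inv_ge_half. Qed.
Let q0 : 0 <= q. Proof. exact: sqrtr_ge0. Qed.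
Let pM0 : 0 <= p * M.
Proof.
have C0 : 0 <= C := le_trans (ler0n _ 64) C64.
apply: mulr_ge0; [exact: ltW|apply: mulr_ge0 => //].
by apply: mulr_ge0; [apply: mulr_ge0 => //; exact: ltW|exact: expR_ge0].
Qed.

Lemma Ex_cap_prob_threshold : E (V tau) <= p.
Proof.
rewrite (Ex_cap_prob unif nuS) -Ep; apply: (le_Ex rho mS).
- exact: (bmf_coord_bool (measurable_gt tau)).
- exact: bmf_ge.
by move=> x _; case: (ltP tau (X x)) => [/ltW ->|].
Qed.

Lemma threshold_tail : m * tau ^+ 2 / 2 <= l.
Proof.
have := marginal_tail unif tau0; rewrite Ep -{1}(expR_ln_inv p0) ler_expR; lra.
Qed.

Lemma measurable_cap_lt (s r : R) : measurable [set z | S z /\ s < V r z].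
Proof.
have [mV _] := bmf_cap_prob nuS r; rewrite [Y in measurable Y](_ : _ = S `&` V r @^-1` `]s, +oo[).
  by apply: measurableI; [exact: mS|rewrite -[Y in measurable Y]setTI; exact: mV].
by apply/seteqP; split => z /=; rewrite in_itv/= andbT.
Qed.

Lemma measurable_cap_le (s r : R) : measurable [set z | S z /\ V r z <= s].
Proof.
have [mV _] := bmf_cap_prob nuS r; rewrite [Y in measurable Y](_ : _ = S `&` V r @^-1` `]-oo, s]).
  by apply: measurableI; [exact: mS|rewrite -[Y in measurable Y]setTI; exact: mV].
by apply/seteqP; split => z /=; rewrite in_itv.
Qed.

Lemma measurable_cap_ge (s r : R) : measurable [set z | S z /\ s <= V r z].
Proof.
have [mV _] := bmf_cap_prob nuS r; rewrite [Y in measurable Y](_ : _ = S `&` V r @^-1` `[s, +oo[).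
  by apply: measurableI; [exact: mS|rewrite -[Y in measurable Y]setTI; exact: mV].
by apply/seteqP; split => z /=; rewrite in_itv/= andbT.
Qed.

Lemma measurable_cap_gt (s r : R) : measurable [set z | S z /\ V r z < s].
Proof.
have [mV _] := bmf_cap_prob nuS r; rewrite [Y in measurable Y](_ : _ = S `&` V r @^-1` `]-oo, s[).
  by apply: measurableI; [exact: mS|rewrite -[Y in measurable Y]setTI; exact: mV].
by apply/seteqP; split => z /=; rewrite in_itv.
Qed.

Let delta0 : 0 < delta. Proof. exact: expR_gt0. Qed.
Let k0 : 0 < expR (- kappa). Proof. exact: expR_gt0. Qed.
Let l0 : 0 <= l. Proof. by have := l2; lra. Qed.
Let md : m <= d%:R. Proof. by rewrite ler_nat. Qed.

Lemma upper_deviation : E (\1_[set z | S z /\ p + dev < V tau z]) <= delta.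
Proof.
rewrite leNgt; apply/negP; set U := [set z | _] => dU.
have mU : measurable U by exact: measurable_cap_lt.
have US : U `<=` S by move=> z [].
have [[z [Sz Uz]]|U0] := set0_or_inhabited U; last first.
  by move: dU; rewrite U0 ltNge (ltW delta0).
have V1 := cap_prob_le1 nuS tau z.
have dev1 : p + dev < 1 := lt_le_trans Uz V1.
have dev0 : 2 * delta + expR (- kappa) <= dev by rewrite -addrA lerDr.
(* Markov's inequality for [V tau], whose mean is at most [p]. As [delta <= p + dev], it gives
   [delta^2 < p], from which [2 l <= d t^2] follows. *)
have markov : delta * (p + dev) < p.
  apply: (@lt_le_trans _ _ (E (\1_U) * (p + dev))).
    rewrite ltr_pM2r//; move: p0 delta0 k0 dev0.
    by move: (expR (- kappa)) delta (p * M) => k' e' b; lra.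
  apply: le_trans Ex_cap_prob_threshold; rewrite mulrC -(ExZ _ mS); last exact: bmf_indic.
  apply: (le_Ex rho mS); [by apply: bmfZ; exact: bmf_indic|exact: bmf_cap_prob|].
  move=> x _; rewrite indicE; case: (boolP (x \in U)) => [/set_mem[_ /ltW h]|_].
    by rewrite mulr1.
  by rewrite mulr0; exact: cap_prob_ge0.
(* [V tau z] exceeds [expR (- kappa)], while domination bounds it by [L] times a cap mass of at most
   [p]. *)
have lk : l <= ln L + kappa.
  have : expR (- kappa) <= L * p.
    apply: (@le_trans _ _ (V tau z)).
      apply: le_trans (ltW Uz); move: p0 delta0 k0 dev0.
      by move: (expR (- kappa)) delta (p * M) => k' e' b; lra.
    apply: le_trans (cap_prob_dominated unif nuS dens tau Sz) _.
    rewrite ler_wpM2l ?(le_trans ler01)//.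
    by rewrite -(Ex_cap_prob unif nuS); exact: Ex_cap_prob_threshold.
  rewrite -{1}(expR_ln_inv p0) -{1}(lnK (x := L)) ?posrE ?(lt_le_trans ltr01)//.
  by rewrite -expRD ler_expR; lra.
have dt : 2 * l <= d%:R * t ^+ 2.
  have : delta * delta < p.
    apply: le_lt_trans markov; rewrite ler_pM2l//; move: p0 delta0 k0 dev0.
    by move: (expR (- kappa)) delta (p * M) => k' e' b; lra.
  by rewrite -expRD -[Y in _ < Y](expR_ln_inv p0) ltr_expR; lra.
have lu := deviation_scale_ge m0 md l0 (ltW u0) lk dt hu.
(* For [tau > 1/8], [2 d tau u >= d u / 4 >= l] makes [p * expR (2 d tau u) >= 1], hence
   [p * M >= 8], against [p + dev < 1]. *)
have tau8 : tau <= 1 / 8.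
  rewrite leNgt; apply/negP => /ltW tau8.
  have h8 := high_threshold_scale m1 dE l2 (ltW u0) C64 tau8 threshold_tail lu.
  have : 1 <= p * expR (2 * d%:R * tau * u).
    rewrite -{1}(expR_ln_inv p0) -expRD -[leLHS]expR0 ler_expR.
    have du : 0 <= d%:R * u by apply: mulr_ge0 => //; exact: ltW.
    have := ler_wpM2r du tau8; lra.
  move: dev1 h8 delta0 k0 p0; set e := expR _; set cuq := C * u * q.
  rewrite [C * u * e * q](_ : _ = e * cuq); last by rewrite /cuq; ring.
  rewrite mulrA; move: (p * e) cuq delta (expR _) => a b c e'.
  move=> h1 h2 h3 h4 h5 a1; have : 1 * 8 <= a * b by exact: ler_pM.
  lra.
pose s0 := tau - 7 / 4 * u; pose r := p + dev - expR (- kappa).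
pose B := [set z | S z /\ V s0 z <= r].
have mB : measurable B by exact: measurable_cap_le.
have BS : B `<=` S by move=> x [].
have r1 : r <= 1 by rewrite /r; move: k0 (ltW dev1); lra.
have dB : E (\1_B) <= delta.
  apply: (separated_small mU mB US BS) => //.
    move=> x y [Sx Ux] [Sy By]; rewrite leNgt; apply/negP => close.
    have := cap_prob_robust tau Sx Sy close.
    have := Ux; have := By; rewrite -/s0 /r; lra.
  move: p0 delta0 k0 dev0 dev1.
  by move: (expR (- kappa)) delta (p * M) => k' e' b; lra.
(* Off [B] the value of [V s0] exceeds [r]; on [B], of mass at most [delta], [r <= 1] suffices. One
   copy of [delta] in [dev] pays for [B], and the other makes the final contradiction strict. *)
have lowE : r - delta <= E (V s0).
  apply: (@le_trans _ _ (E (fun x => r - \1_B x))).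
    rewrite (ExB _ mS) ?(Ex_cst mS PS) ?lerD2l ?lerN2//; [exact: bmf_cst|exact: bmf_indic].
  apply: (le_Ex rho mS); [|exact: bmf_cap_prob|].
    by apply: bmfB; [exact: bmf_cst|exact: bmf_indic].
  move=> x Sx; rewrite indicE; case: (boolP (x \in B)) => xB.
    by rewrite mulr1n lerBlDr; apply: (le_trans r1); rewrite lerDr; exact: cap_prob_ge0.
  rewrite subr0 leNgt; apply/negP => /ltW h; case/negP: xB; exact: mem_set.
have w0 : 0 < 7 / 4 * u by rewrite mulr_gt0.
have tau1 : tau < 1 by move: tau8; lra.
have := upper_band unif tau0 tau1 w0; set band := E _ => hb.
have upE : E (V s0) <= p + band.
  rewrite (Ex_cap_prob unif nuS) -Ep /band.
  have bb : bmf S (fun x => \I[(tau - 7 / 4 * u <= X x) && (X x < tau)] : R).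
    apply: (bmf_coord_bool (b := fun x => (tau - 7 / 4 * u <= x) && (x < tau))).
    exact: (measurable_and (measurable_ge _) (measurable_lt _)).
  rewrite -(ExD _ mS)//; last exact: bmf_ge.
  apply: (le_Ex rho mS); [exact: (bmf_coord_bool (measurable_gt s0))| |].
    by apply: bmfD => //; exact: bmf_ge.
  move=> x _; case: (ltP s0 (X x)) => [/ltW h|_]; last by rewrite addr_ge0.
  by rewrite -/s0 h; case: (ltP (X x) tau); rewrite ?addr0 ?lerDr.
have pm := partial_mean_le unif Ep p0 p1.
have num := upper_band_numeric m1 dE p0 l0 (ltW u0) C64 tau0 tau8.
have bandM : band <= p * M.
  apply: le_trans hb (le_trans _ num); apply: ler_wpM2l => //.
  apply: mulr_ge0; last exact: expR_ge0.
  apply: divr_ge0; first by rewrite !mulr_ge0// ltW.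
  by rewrite subr_ge0 expr_le1// ltW.
move: lowE upE bandM delta0 {hb}; rewrite /r.
by move: (expR _) delta (p * M) (E _) band => a1 a2 a3 a4 a5; lra.
Qed.

Lemma lower_deviation : E (\1_[set z | S z /\ V tau z < p - dev]) <= delta.
Proof.
rewrite leNgt; apply/negP; set U := [set z | _] => dU.
have mU : measurable U by exact: measurable_cap_gt.
have US : U `<=` S by move=> z [].
have [[z [Sz Uz]]|U0] := set0_or_inhabited U; last first.
  by move: dU; rewrite U0 ltNge (ltW delta0).
(* Since [V tau z >= 0], a deviation below [p] bounds each term of [dev] by [p]; the a priori bounds
   follow without Markov's inequality or domination. *)
have devp : dev < p.
  by rewrite -subr_gt0; apply: le_lt_trans Uz; exact: cap_prob_ge0.
have [dp kp pMp] : [/\ 2 * delta < p, expR (- kappa) < p & p * M < p].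
  move: pM0 delta0 k0 devp; move: (expR (- kappa)) delta (p * M) => k' e' b.
  by move=> *; split; lra.
have M1 : M < 1 by move: pMp; rewrite gtr_pMr.
have lk : l <= ln L + kappa.
  move: kp; rewrite -[Y in _ < Y](expR_ln_inv p0) ltr_expR; move: lnL0; lra.
have dt : 2 * l <= d%:R * t ^+ 2.
  have : delta < p by apply: le_lt_trans dp; rewrite ler_peMl ?ler1n// ltW.
  rewrite -[Y in _ < Y](expR_ln_inv p0) ltr_expR; move: l0; lra.
have lu := deviation_scale_ge m0 md l0 (ltW u0) lk dt hu.
have e1 : 1 <= expR (2 * d%:R * tau * u).
  rewrite -[leLHS]expR0 ler_expR mulr_ge0 ?(ltW u0)//.
  by rewrite mulr_ge0 ?tau0// mulr_ge0.
have q1 : 1 <= q.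
  rewrite -[leLHS]sqrtr1; apply: ler_wsqrtr.
  have : 2 * (1 / 2) <= d%:R * l.
    by apply: ler_pM => //; rewrite ler_nat.
  by rewrite mul1r divff.
have CuqM : C * u * q <= M.
  rewrite -mulrA [leRHS](_ : _ = expR (2 * d%:R * tau * u) * (C * (u * q))); last by ring.
  by rewrite ler_peMl// mulr_ge0 ?(le_trans _ C64)// mulr_ge0// ltW.
have tau8 : tau <= 1 / 8.
  rewrite leNgt; apply/negP => /ltW tau8.
  have := high_threshold_scale m1 dE l2 (ltW u0) C64 tau8 threshold_tail lu.
  move: CuqM M1; move: (C * u * q) M => a b; lra.
(* A bound on [u] is needed because the band now extends towards the pole, where the factor
   [1 - (tau + 7/4 u)^2] degenerates. *)
have u64 : u <= 1 / 64.
  have h : 64 * (u * 1) <= C * (u * q).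
    by apply: ler_pM => //; [rewrite mulr1 ltW|apply: ler_wpM2l => //; exact: ltW].
  rewrite ler_pdivlMr// mulrC -[u]mulr1; apply: le_trans h _.
  by rewrite mulrA (le_trans CuqM)// ltW.
pose s0 := tau + 7 / 4 * u; pose r := p - dev + expR (- kappa).
pose B := [set z | S z /\ r <= V s0 z].
have mB : measurable B by exact: measurable_cap_ge.
have BS : B `<=` S by move=> x [].
have r0 : 0 <= r.
  by rewrite /r; move: k0 devp; move: (expR (- kappa)) dev => a b; lra.
have dB : E (\1_B) <= delta.
  apply: (separated_small mU mB US BS) => //; last first.
    by move: dp p1; move: delta => a; lra.
  (* Robustness is used from [y] to [x]: a large cap probability at the higher threshold [s0]
     survives at [tau] after the move. *)
  move=> x y [Sx Ux] [Sy By]; rewrite leNgt; apply/negP; rewrite dotC => close.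
  have := cap_prob_robust s0 Sy Sx close; rewrite {1}/s0 addrK.
  have := Ux; have := By; rewrite /r; lra.
have upE : E (V s0) <= r + delta.
  apply: (@le_trans _ _ (E (fun x => r + \1_B x))); last first.
    by rewrite (ExD _ mS) ?(Ex_cst mS PS) ?lerD2l//; [exact: bmf_cst|exact: bmf_indic].
  apply: (le_Ex rho mS); [exact: bmf_cap_prob| |].
    by apply: bmfD; [exact: bmf_cst|exact: bmf_indic].
  move=> x Sx; rewrite indicE; case: (boolP (x \in B)) => xB.
    by rewrite mulr1n; apply: (le_trans (cap_prob_le1 nuS s0 x)); rewrite lerDr.
  rewrite addr0 leNgt; apply/negP => /ltW h; case/negP: xB; exact: mem_set.
have w0 : 0 < 7 / 4 * u by rewrite mulr_gt0.
have tw : tau + 7 / 4 * u <= 1 / 2 by move: tau8 u64; move: u => v; lra.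
have tw1 : tau + 7 / 4 * u < 1 by apply: le_lt_trans tw _; rewrite ltr_pdivrMr// mul1r ltr1n.
have hb := lower_band unif tau0 w0 tw1.
have pm := partial_mean_le unif Ep p0 p1.
have tw0 : 0 <= tau + 7 / 4 * u by apply: addr_ge0 => //; exact: ltW.
have bb : bmf S (fun x => \I[(tau <= X x) && (X x <= tau + 7 / 4 * u)] : R).
  apply: (bmf_coord_bool (b := fun x => (tau <= x) && (x <= tau + 7 / 4 * u))).
  exact: (measurable_and (measurable_ge _) (measurable_le _)).
have b0 : 0 <= E (fun x => \I[(tau <= X x) && (X x <= tau + 7 / 4 * u)]).
  by apply: Ex_ge0 => x _.
have bandM := lower_band_numeric m1 dE p0 l0 (ltW u0) C64 e1 tw0 tw b0 pm hb.
have lowE : p <= E (V s0) + E (fun x => \I[(tau <= X x) && (X x <= tau + 7 / 4 * u)]).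
  rewrite (Ex_cap_prob unif nuS) -[leLHS]Ep -(ExD _ mS)//; last first.
    exact: (bmf_coord_bool (measurable_gt s0)).
  apply: (le_Ex rho mS); [exact: bmf_ge| |].
    by apply: bmfD => //; exact: (bmf_coord_bool (measurable_gt s0)).
  move=> x _; rewrite -/s0; case: (leP tau (X x)) => h1 /=; last by rewrite addr0.
  by case: (leP (X x) s0) => h2; rewrite ?addr0 ?add0r.
move: lowE upE bandM delta0 {hb bb b0}; rewrite /r.
by move: (expR _) delta (p * M) (E _) (E _) => a1 a2 a3 a4 a5; lra.
Qed.

End deviation.

(** * Domination from the essential supremum of the density *)

Section density.
Context {R : realType} {d : nat}.
Local Notation T := (d.-tuple R).
Variables nu rho : probability T R.

Lemma ess_sup_dominated (y : R) (A : set T) : nu `<< rho -> 0 <= y ->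
  (ess_sup rho (Radon_Nikodym (charge_of_finite_measure nu) rho) <= y%:E)%E ->
  measurable A -> (nu A <= y%:E * rho A)%E.
Proof.
move=> nr y0 /ess_supP fy mA; set f := Radon_Nikodym _ _ in fy.
have intf : rho.-integrable setT f by exact: Radon_Nikodym_integrable.
have mf : measurable_fun A f.
  by apply: (measurable_funS measurableT) => //; exact: measurable_int intf.
have -> : nu A = (\int[rho]_(x in A) f x)%E.
  exact: (Radon_Nikodym_integral (nu := charge_of_finite_measure nu) nr mA).
(* The comparison of integrals needs nonnegative integrands, and [f] is the derivative of a charge;
   its positive part obeys the same bound because [0 <= y]. *)
rewrite -integral_cst//; apply: (@le_trans _ _ (\int[rho]_(x in A) f^\+ x)%E).
  rewrite [leLHS]integralE -[leRHS]sube0; apply: leeB => //.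
  by apply: integral_ge0 => x _; rewrite funenegE le_max lexx orbT.
apply: ae_ge0_le_integral => //.
- exact: measurable_funepos.
apply: filterS fy => x fx _; by rewrite funeposE ge_max fx lee_fin.
Qed.

(** A negative essential supremum would bound [nu S = 1] by 0, so the supremum is either infinite or
    a real domination constant. *)
Lemma density_supP : on_sphere nu ->
  density_sup nu rho = +oo%E \/ exists L : R, density_sup nu rho = L%:E /\
    forall A, measurable A -> (nu A <= L%:E * rho A)%E.
Proof.
move=> nuS; rewrite /density_sup; case: asboolP => nr; [|by left].
have neg (y : \bar R) :
    ess_sup rho (Radon_Nikodym (charge_of_finite_measure nu) rho) = y -> (y < 0)%E -> False.
  move=> Ey y0.
  have := ess_sup_dominated nr (lexx 0) _ (@measurable_sphere R d).
  by rewrite Ey nuS mul0e => /(_ (ltW y0)); rewrite lee_fin ler10.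
case Ey: (ess_sup _ _) => [y| |]; [right|by left|by have [] := neg _ Ey].
exists y; split=> // A mA; apply: ess_sup_dominated => //; last by rewrite Ey.
by rewrite leNgt; apply/negP => y0; apply: (neg _ Ey).
Qed.

End density.

(** * Deviation bound with an extended-real [eps_dev] *)

Section theorem.
Context {R : realType} {n : nat}.
Local Notation d := n.+2.
Local Notation T := (d.-tuple R).
Variables rho nu : probability T R.
Hypothesis unif : uniform_sphere rho.
Hypothesis nuS : on_sphere nu.
Local Notation S := (sphere R d).
Local Notation E := (Ex rho S).
Local Notation mS := (@measurable_sphere R d).
Local Notation X x := (@tnth n.+2 R x ord0).
Let PS : rho S = 1%E. Proof. by case: unif. Qed.

Lemma threshold_coord (p tau : R) : is_threshold rho p tau ->
  E (fun x => \I[tau <= X x]) = p.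
Proof.
move=> /(_ _ (@basis_sphere R d ord0)) thr; apply: EFin_inj; rewrite -thr.
have mA : measurable [set y : T | tau <= dot y (basis_vec ord0)].
  rewrite [Y in measurable Y](_ : _ = (fun x => tau <= dot x (basis_vec ord0)) @^-1` [set true]).
    rewrite -[Y in measurable Y]setTI.
    by apply: (measurableT_comp (measurable_ge tau) (measurable_dotl _)).
  by apply/seteqP; split => x.
rewrite -(Ex_indic mS PS mA); congr EFin; apply: eq_Ex => x _.
rewrite indicE -dot_basis; congr (nat_of_bool _)%:R.
by apply/idP/idP; rewrite in_setE.
Qed.

Lemma measurable_deviation (c : \bar R) (p tau : R) :
  measurable [set z | (c < `|cap_mass nu tau z - p|%:E)%E].
Proof.
case: c => [c| |]; last 2 first.
- by rewrite [Y in measurable Y](_ : _ = set0)//; apply/seteqP; split.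
- by rewrite [Y in measurable Y](_ : _ = setT)//; apply/seteqP; split=> z //= _; exact: ltNyr.
have [mV _] := bmfB (bmf_cap_prob nuS tau) (bmf_cst S p).
rewrite [Y in measurable Y](_ : _ = (fun z => `|cap_prob nu tau z - p|) @^-1` `]c, +oo[).
  rewrite -[Y in measurable Y]setTI.
  by apply: (measurableT_comp (@normr_measurable R setT) mV).
by apply/seteqP; split => z /=; rewrite in_itv/= andbT lte_fin (cap_massE nuS).
Qed.

Lemma deviation_split (c p tau delta : R) :
  E (\1_[set z | S z /\ p + c < cap_prob nu tau z]) <= delta ->
  E (\1_[set z | S z /\ cap_prob nu tau z < p - c]) <= delta ->
  (rho [set z | (c%:E < `|cap_mass nu tau z - p|%:E)%E] <= (2 * delta)%:E)%E.
Proof.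
set U := [set z | _ /\ _ < cap_prob _ _ _]; set Lo := [set z | _ /\ cap_prob _ _ _ < _].
move=> hU hL; have mA := measurable_deviation c%:E p tau.
rewrite -(Ex_indic mS PS mA) lee_fin.
have bU : bmf S (\1_U : T -> R) by apply: bmf_indic; exact: measurable_cap_lt.
have bL : bmf S (\1_Lo : T -> R) by apply: bmf_indic; exact: measurable_cap_gt.
apply: (@le_trans _ _ (E (fun x => \1_U x + \1_Lo x))); last first.
  by rewrite (ExD _ mS)//; lra.
apply: (le_Ex rho mS); [exact: bmf_indic|exact: bmfD|].
move=> x Sx; rewrite [leLHS]indicE.
case: (boolP (x \in _)) => [/set_mem/= xA|_]; last by rewrite addr_ge0// indicE.
move: xA; rewrite lte_fin (cap_massE nuS) lter_normr => /orP[h|h].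
  have Ux : U x by split=> //; lra.
  by rewrite !indicE (mem_set Ux) lerDl.
have Lx : Lo x by split=> //; lra.
by rewrite !indicE (mem_set Lx) lerDr.
Qed.

Lemma deviation_probability (p tau kappa t : R) : 0 < p -> p <= 1 / 2 ->
  E (fun x => \I[tau <= X x]) = p -> 0 < kappa -> 0 < t ->
  (rho [set z | (p%:E * eps_dev nu rho 64 p tau kappa t < `|cap_mass nu tau z - p|%:E)%E]
   <= (2 * expR (- (d%:R * t ^+ 2 / 4)))%:E)%E.
Proof.
move=> p0 p2 Ep k0 t0; have dm : d%:R - 1 = n.+1%:R :> R by rewrite -natr1 addrK.
have m0 : 0 < n.+1%:R :> R by rewrite ltr0n.
have [dens|[L [dens domL]]] := density_supP rho nuS.
  (* An infinite density makes [eps_dev] infinite and the event empty. No prefactor vanishes, since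
     [t > 0] and [ln (1 / p) > 0]; [tau >= 0] keeps the exponent nonnegative, even when
     [0 * +oo = 0] applies to it. *)
  rewrite (_ : [set z | _] = set0) ?measure0 ?lee_fin ?mulr_ge0 ?expR_ge0//.
  apply/seteqP; split => // z /=; rewrite (_ : (_ * eps_dev _ _ _ _ _ _ _)%E = +oo%E) //.
  have uE : u_dev nu rho kappa t = +oo%E.
    rewrite /u_dev dens /= dm gt0_muley ?lte_fin ?divr_gt0//= addye// gt0_mulye//.
  have l0 := ln_inv_ge_half p0 p2; have tau0 := threshold_ge0 unif Ep p2.
  rewrite /eps_dev uE gt0_muley ?lte_fin// -muleA gt0_mulye; last first.
    apply: mule_gt0; last by rewrite lte_fin sqrtr_gt0 mulr_gt0//; lra.
    rewrite expeR_gt0// (lt_le_trans (ltNy0))//.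
    by apply: mule_ge0 => //; rewrite lee_fin mulr_ge0.
  by rewrite addye// gt0_muley.
pose u := (Num.sqrt (8 / n.+1%:R * ln L) + Num.sqrt (8 * kappa / n.+1%:R)) * t.
have L1 := density_ge1 unif nuS domL; have L0 := lt_le_trans ltr01 L1.
have u0 : 0 < u.
  apply: mulr_gt0 => //; apply: ltr_wpDl; first exact: sqrtr_ge0.
  by rewrite sqrtr_gt0 divr_gt0// mulr_gt0.
have hu : 8 * (ln L + kappa) * t ^+ 2 <= n.+1%:R * u ^+ 2.
  rewrite -ler_pdivrMl//; apply: le_trans (sqr_sum_sqrt_ge _ _ (ltW t0)).
  - rewrite le_eqVlt; apply/orP; left; apply/eqP; field; exact: lt0r_neq0.
  - by apply: mulr_ge0; [apply: divr_ge0 => //; exact: ltW|exact: ln_ge0].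
  - by apply: divr_ge0; [apply: mulr_ge0 => //; exact: ltW|exact: ltW].
have uE : u_dev nu rho kappa t = u%:E.
  by rewrite /u_dev dens dm lne_EFin//.
pose delta := expR (- (d%:R * t ^+ 2 / 4)).
pose c := p * (64 * u * expR (2 * d%:R * tau * u) * Num.sqrt (d%:R * ln (1 / p)))
  + 2 * delta + expR (- kappa).
have -> : (p%:E * eps_dev nu rho 64 p tau kappa t)%E = c%:E.
  rewrite /eps_dev uE; transitivity (p * (64 * u * expR (2 * d%:R * tau * u) *
    Num.sqrt (d%:R * ln (1 / p)) + (2 * delta + expR (- kappa)) / p))%:E => //.
  congr EFin.
  rewrite /c mulrDr -[in RHS]addrA; congr (_ + _); field; exact: lt0r_neq0.
apply: deviation_split.
  exact: (upper_deviation unif t0 nuS domL u0 hu p0 p2 Ep).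
exact: (lower_deviation unif t0 nuS domL u0 hu p0 p2 Ep).
Qed.

End theorem.

Theorem lemma4p7 (R : realType) :
  exists C : R, 0 < C /\
  forall (d : nat) (rho : probability (d.-tuple R) R),
  (2 <= d)%N -> uniform_sphere rho ->
  forall (p tau : R), 0 < p -> p <= 1 / 2 -> is_threshold rho p tau ->
  forall (nu : probability (d.-tuple R) R), on_sphere nu ->
  forall kappa : R, 0 < kappa ->
  forall t : R, 0 <= t ->
  (rho [set z | p%:E * eps_dev nu rho C p tau kappa t
                < `| cap_mass nu tau z - p |%:E]
   <= (2 * expR (- (d%:R * t ^+ 2 / 4)))%:E)%E.
Proof.
exists 64; split=> // -[|[|n]]// rho _ unif p tau p0 p2 thr nu nuS kappa k0 t.
(* At [t = 0] the right-hand side is 2. This case is separated because [u_dev] vanishes there, while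
   the deviation argument divides by [t] and needs a positive scale. *)
rewrite le_eqVlt => /orP[/eqP <-|t0]; last first.
  exact: deviation_probability (threshold_coord unif thr) k0 t0.
apply: (le_trans (probability_le1 _ (measurable_deviation nuS _ p tau))).
by rewrite expr0n/= mulr0 mul0r oppr0 expR0 mulr1 lee_fin ler1n.
Qed.
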